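(* Let $b=4$, let $1\le s\le b$, let $\mathcal X^{(j)}=T^2$ for $j=1,\dots,s$ (with the recursive triangular split in base $4$ described in the context), and let $f\in\mathcal F_s$. Then there exist positive constants $c,C$ (not depending on $m$) such that $$c\,\frac{m^{s-1}}{b^{2m}}\;\le\;\mathrm{Var}(\hat\mu)\;\le\; C\,\frac{m^{s-1}}{b^{2m}}$$ as $m\to\infty$ (i.e. for all sufficiently large $m$).
   Context: $T^2=\{\boldsymbol x\in\mathbb R^2: x_1,x_2\ge0,\ x_1+x_2\le1\}$, the triangle with vertices $A=(0,0)$, $B=(1,0)$, $C=(0,1)$. The domain is $(T^2)^s$, with points $\boldsymbol x=(\boldsymbol x_1,\dots,\boldsymbol x_s)$, $\boldsymbol x_j=(x_{j1},x_{j2})\in T^2$. Recursive split of $T^2$ in base $4$. A triangle $\Delta(A,B,C)$ is divided into four congruent subtriangles indexed by a digit $u$: $\Delta(A,\frac{A+B}2,\frac{A+C}2)$ for $u=0$; $\Delta(\frac{B+A}2,B,\frac{B+C}2)$ for $u=1$; $\Delta(\frac{C+A}2,\frac{C+B}2,C)$ for $u=2$; $\Delta(\frac{B+C}2,\frac{A+C}2,\frac{A+B}2)$ for $u=3$. Applying this recursively (with the listed vertex order) starting from $T^2$ gives for each digit string $u_1\cdots u_K$ a subtriangle $T^2(u_1,\dots,u_K)$ having a fraction $4^{-K}$ of the area of $T^2$. The map $\phi:[0,1]\to T^2$ sends $u=\sum_{k\ge1}u_k4^{-k}$ to the limit point of $T^2(u_1,\dots,u_K)$ as $K\to\infty$.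 Scrambled geometric nets. Points $\boldsymbol a_1,\dots,\boldsymbol a_{b^m}\in[0,1]^s$ form a $(0,m,s)$-net in base $b$ if every box $\prod_{j=1}^s[c_jb^{-k_j},(c_j+1)b^{-k_j})$, with integers $k_j\ge0$, $0\le c_j<b^{k_j}$, of volume $b^{-m}$ contains exactly one of them. Nested uniform scramble: take mutually independent uniform random permutations $\pi_{j\cdot a_1a_2\cdots a_k}$ of $\{0,\dots,b-1\}$, indexed by $1\le j\le s$, $k\ge0$, and digit strings $a_1\cdots a_k$; if $a_{ij}$ has base $b$ digits $a_{ij1},a_{ij2},\dots$ (choosing the expansion ending in zeros if there are two), then $u_{ij}$ has digits $u_{ij,k+1}=\pi_{j\cdot a_{ij1}\cdots a_{ijk}}(a_{ij,k+1})$. The scrambled $(0,m,s)$ geometric net on $(T^2)^s$ is $\boldsymbol x_i=(\phi(u_{i1}),\dots,\phi(u_{is}))$, $i=1,\dots,n=b^m$. The estimator of the average $\mu=\mathrm{vol}((T^2)^s)^{-1}\int_{(T^2)^s} f(\boldsymbol x)\,d\boldsymbol x$ is $\hat\mu=\frac1n\sum_{i=1}^nf(\boldsymbol x_i)$. Class $\mathcal F_s$ (here $d=2$). For $u\subseteq\{1,\dots,s\}$, $\nabla^uf(\boldsymbol x)$ is the $d^{|u|}$-dimensional vector with coordinates $\partial^{|u|}f(\boldsymbol x)/\prod_{j\in u}\partial x_{j i_j}$, $i_j\in\{1,\dots,d\}$ ($\nabla^\emptyset f=f$). $f$ is smooth if there are finite $B\ge0$ and $\beta\in(0,1]$ such that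 $\|\nabla^uf(\boldsymbol x)-\nabla^uf(\boldsymbol x^* )\|\le B\|\boldsymbol x-\boldsymbol x^*\|^\beta$ for all $u\subseteq\{1,\dots,s\}$ and all $\boldsymbol x,\boldsymbol x^*\in(T^2)^s$. $\mathcal F_s$ is the class of smooth $f$ on $(T^2)^s$ such that $\big\|\int_{(T^2)^s}\nabla^uf(\boldsymbol x)\,d\boldsymbol x\big\|^2>0$ for all $u\subseteq\{1,\dots,s\}$. *)

(* Defs.v *)
(* Real analysis and probability over an arbitrary realType. *)
From HB Require Import structures.
From mathcomp Require Import all_boot all_order all_algebra perm.
From mathcomp Require Import all_classical all_reals all_analysis.
Set Implicit Arguments.
Unset Strict Implicit.
Unset Printing Implicit Defensive.
Import Order.TTheory GRing.Theory Num.Theory.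
Import numFieldNormedType.Exports.
Local Open Scope classical_set_scope.
Local Open Scope ring_scope.

(* A point (x_1, ..., x_s) of (R^2)^s is an s x 2 matrix whose row j is x_j. *)
Definition coord (R : realType) (p : R * R) (k : 'I_2) : R :=
  if k == 0 then p.1 else p.2.

Definition point_of (R : realType) (s : nat) (p : 'I_s -> R * R) : 'M[R]_(s, 2) :=
  \matrix_(j < s, k < 2) coord (p j) k.

Definition T2 (R : realType) : set (R * R) :=
  [set p | [/\ 0 <= p.1, 0 <= p.2 & p.1 + p.2 <= 1]].
Arguments T2 : clear implicits.

Definition T2s (R : realType) (s : nat) : set 'M[R]_(s, 2) :=
  [set x | forall j, T2 R (x j 0, x j 1)].
Arguments T2s : clear implicits.

(** Recursive split of the triangle in base 4 *)

Definition triangle (R : realType) : Type := ((R * R) * (R * R) * (R * R))%type.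

Definition midpoint (R : realType) (p q : R * R) : R * R := 2^-1 *: (p + q).

Definition subtriangle (R : realType) (t : triangle R) (u : 'I_4) : triangle R :=
  let: (A, B, C) := t in
  match val u with
  | 0 => (A, midpoint A B, midpoint A C)
  | 1 => (midpoint B A, B, midpoint B C)
  | 2 => (midpoint C A, midpoint C B, C)
  | _ => (midpoint B C, midpoint A C, midpoint A B)
  end.

(* Digit sequences are indexed from 0: [u k] is the digit of weight 4^-(k+1). *)
Fixpoint T2_cell (R : realType) (u : nat -> 'I_4) (K : nat) : triangle R :=
  if K is K'.+1 then subtriangle (T2_cell R u K') (u K')
  else ((0, 0), (1, 0), (0, 1)).

(* For u in [0, 1]; the expansion ending in zeros is chosen when there are two.
   The only expansion of 1 with integer part 0 has all its digits equal to 3. *)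
Definition digit (R : realType) (u : R) (k : nat) : 'I_4 :=
  if u == 1 then ord_max else inord (Num.truncn (u * 4 ^+ k.+1) %% 4).

Definition of_digits (R : realType) (u : nat -> 'I_4) : R :=
  limn (series (fun k => (u k)%:R / 4 ^+ k.+1 : R)).
Arguments of_digits : clear implicits.

(* The cells are nested with diameters tending to 0, so their limit point is
   the limit of any sequence of their points, here of their first vertices. *)
Definition phi (R : realType) (u : R) : R * R :=
  let A K := (T2_cell R (digit u) K).1.1 in
  (limn (fun K => (A K).1), limn (fun K => (A K).2)).

(** Scrambled geometric nets *)

Definition is_0ms_net (R : realType) (b m s : nat)
    (a : 'I_(b ^ m) -> 'I_s -> R) : Prop :=
  (forall i j, 0 <= a i j <= 1) /\
  (forall k c : 'I_s -> nat,
     (forall j, (c j < b ^ k j)%N) ->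
     \prod_(j < s) (b%:R ^- k j) = b%:R ^- m :> R ->
     exists! i, forall j,
       (c j)%:R * b%:R ^- k j <= a i j < (c j).+1%:R * b%:R ^- k j).

Definition mutually_independent (R : realType) (d : measure_display)
    (Omega : measurableType d) (P : probability Omega R)
    (I : eqType) (T : finType) (X : I -> Omega -> T) : Prop :=
  forall (J : seq I) (A : I -> {set T}), uniq J ->
    P (\bigcap_(i in [set` J]) (X i @^-1` [set` A i])) =
    (\prod_(i <- J) fine (P (X i @^-1` [set` A i])))%:E.

(* [pi (j, [:: a_1; ...; a_k])] is the permutation applied to digit k + 1 of
   coordinate j when the first k digits are a_1, ..., a_k. *)
Definition uniform_permutations (R : realType) (d : measure_display)
    (Omega : measurableType d) (P : probability Omega R) (s : nat)
    (pi : 'I_s * seq 'I_4 -> Omega -> {perm 'I_4}) : Prop :=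
  [/\ (forall i (A : {set {perm 'I_4}}), measurable (pi i @^-1` [set` A])),
      (forall i (sigma : {perm 'I_4}),
         P (pi i @^-1` [set sigma]) = (4`!%:R^-1)%:E) &
      mutually_independent P pi].

Definition scramble (R : realType) (s : nat)
    (pi : 'I_s * seq 'I_4 -> {perm 'I_4}) (j : 'I_s) (a : R) : R :=
  of_digits R (fun k => pi (j, mkseq (digit a) k) (digit a k)).

Definition geometric_net (R : realType) (n s : nat)
    (a : 'I_n -> 'I_s -> R) (pi : 'I_s * seq 'I_4 -> {perm 'I_4})
    (i : 'I_n) : 'M[R]_(s, 2) :=
  point_of (fun j => phi (scramble pi j (a i j))).

Definition mu_hat (R : realType) (n s : nat) (f : 'M[R]_(s, 2) -> R)
    (x : 'I_n -> 'M[R]_(s, 2)) : R :=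
  n%:R^-1 * \sum_(i < n) f (x i).

(** The class F_s *)

(* Integral over (T^2)^s with respect to Lebesgue measure, as an iterated
   integral over the s copies of T^2; by Fubini this is the Lebesgue integral for
   the functions, continuous on (T^2)^s, to which it is applied below. *)
Fixpoint integral_T2s (R : realType) (s : nat) : ('M[R]_(s, 2) -> R) -> R :=
  match s with
  | 0 => fun g => g 0
  | s'.+1 => fun g =>
      \int[(@lebesgue_measure R \x @lebesgue_measure R)%E]_(p in T2 R)
        integral_T2s (fun y : 'M[R]_(s', 2) => g (col_mx (\row_k coord p k) y))
  end.

(* The index (i_j)_{j in u} of a coordinate of nabla^u is encoded, together with
   u, as the map e with e j = Some i_j for j in u and e j = None for j notin u. *)
Definition mindex (s : nat) : finType := {ffun 'I_s -> option 'I_2}.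

Definition mindex_supp (s : nat) (e : mindex s) : {set 'I_s} :=
  [set j | e j != None].

Definition mindex_add (s : nat) (e : mindex s) (j : 'I_s) (i : 'I_2) : mindex s :=
  [ffun j' => if j' == j then Some i else e j'].

Definition norm2_coords (R : realType) (s : nat) (u : {set 'I_s})
    (v : mindex s -> R) : R :=
  Num.sqrt (\sum_(e : mindex s | mindex_supp e == u) v e ^+ 2).

Definition norm2_point (R : realType) (s : nat) (x : 'M[R]_(s, 2)) : R :=
  Num.sqrt (\sum_(j < s) \sum_(k < 2) x j k ^+ 2).

(* [D e] is the mixed partial derivative of f with index e.  A partial derivative
   is taken at the interior points of (T^2)^s: at a corner of T^2 the lines
   parallel to the axes may meet T^2 in a single point.  The values of [D e] on
   the boundary become determined once [D e] is continuous on (T^2)^s, which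
   [holder_partials] requires; continuity also makes the order of
   differentiation irrelevant. *)
Definition mixed_partials (R : realType) (s : nat) (f : 'M[R]_(s, 2) -> R)
    (D : mindex s -> 'M[R]_(s, 2) -> R) : Prop :=
  (forall x, T2s R s x -> D [ffun=> None] x = f x) /\
  (forall (e : mindex s) (j : 'I_s) (i : 'I_2), e j = None ->
     forall x, (T2s R s)° x ->
       is_derive x (delta_mx j i) (D e) (D (mindex_add e j i) x)).

Definition holder_partials (R : realType) (s : nat)
    (D : mindex s -> 'M[R]_(s, 2) -> R) : Prop :=
  exists B beta : R, [/\ 0 <= B, 0 < beta, beta <= 1 &
    forall (u : {set 'I_s}) (x y : 'M[R]_(s, 2)), T2s R s x -> T2s R s y ->
      norm2_coords u (fun e => D e x - D e y) <=
      B * norm2_point (x - y) `^ beta].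

Definition class_F (R : realType) (s : nat) (f : 'M[R]_(s, 2) -> R) : Prop :=
  exists D : mindex s -> 'M[R]_(s, 2) -> R,
    [/\ mixed_partials f D, holder_partials D &
        forall u : {set 'I_s},
          0 < norm2_coords u (fun e => integral_T2s (D e)) ^+ 2].

(* Main.v *)
Require Import Defs.
From mathcomp Require Import all_boot all_order all_algebra perm.
From mathcomp Require Import all_classical all_reals all_analysis.
From mathcomp Require Import measurable_realfun ring lra zify.
Import Order.TTheory GRing.Theory Num.Theory.
Import numFieldNormedType.Exports.
Local Open Scope classical_set_scope.
Local Open Scope ring_scope.
Set Implicit Arguments.
Unset Strict Implicit.
Unset Printing Implicit Defensive.

(* Truncate the scrambled digits at level K and replace f by the function F of
   the first K digits whose value is that of f at the centres of the cells; all
   estimates are uniform in K and K tends to infinity with m fixed.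

   Expand F = sum_l F_l over the levels l = (l_1, ..., l_s), F_l being the
   tensor product over j of the differences of conditional expectations given
   the first l_j and the first l_j - 1 digits.  Nested scrambling makes the
   estimators of distinct F_l uncorrelated, and for l <> 0 the variance of the
   estimator of F_l is
   - 0 if l_1 + ... + l_s <= m, since the scrambled points form a net,
   - at most 4^s 4^-m sup F_l^2 otherwise, since only 4^s points can have a
     nonzero covariance with a given one,
   - exactly 4^-m E F_l^2 if sum_j (l_j - 1) = m.
   The mean value theorem, applied one coordinate at a time, gives
   |F_l| <= C 2^-(l_1 + ... + l_s), and summing over l gives the upper bound.

   For the lower bound take l_j large with sum_j (l_j - 1) = m; there are about
   m^(s-1) such levels.  By Cauchy-Schwarz E F_l^2 >= (E F_l Psi)^2, where Psi is
   the product of the signed differences of the indicators of two sibling cells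
   that are translates of each other along a coordinate axis, and
   E F_l Psi = E F Psi.  As the siblings are translates, the mean value theorem
   turns E F Psi into 2^-(l_1 + ... + l_s), up to a constant, times a Riemann sum
   of a mixed partial derivative of f whose integral is not 0. *)

(** * Averages over finite types and the multiresolution decomposition *)

(** With K digits everything is finite: the permutations in use are uniform on a finite set, every
    expectation is an [avg], and measure theory enters only in the passage to the limit. Moments of
    random permutations are never computed. The uniform law on permutations is invariant under
    composition with translations of Z/4, and translating at suitable nodes of the digit tree gives
    both the uniformity of each point and the vanishing of covariances. Two obstacles shape the
    rest. Partial derivatives are available only at interior points, so f is evaluated at images of
    the barycentre and every segment used by the mean value theorem has to stay in the open
    triangle. And [phi] reads the digits of a real number, which are the scrambled digits only if
    these are not eventually 3; this holds almost surely. The rate: F_l^2 is of order 4^-|l|, where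
    |l| is the sum of the levels, and about |l|^(s-1) levels have a given sum. Only |l| > m counts,
    so the squares add up to the order m^(s-1) 4^-m; the second factor 4^-m comes from averaging 4^m
    points. *)

Section Average.
Context {R : realType}.
Implicit Types T U : finType.

Definition avg T (f : T -> R) : R := #|T|%:R^-1 * \sum_x f x.

Lemma eq_avg T (f g : T -> R) : f =1 g -> avg f = avg g.
Proof. by move=> fg; congr (_ * _); apply: eq_bigr => x _; exact: fg. Qed.

Lemma avg_cst T (c : R) : (0 < #|T|)%N -> avg (fun=> c : R) (T := T) = c.
Proof.
move=> T0; rewrite /avg sumr_const -[c *+ _]mulr_natl mulrA mulVf ?mul1r//.
by rewrite pnatr_eq0 -lt0n.
Qed.

Lemma avgZ T (c : R) (f : T -> R) : avg (fun x => c * f x) = c * avg f.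
Proof. by rewrite /avg -mulr_sumr mulrCA. Qed.

Lemma avgZr T (c : R) (f : T -> R) : avg (fun x => f x * c) = avg f * c.
Proof. by rewrite /avg -mulr_suml mulrA. Qed.

Lemma avgD T (f g : T -> R) : avg (fun x => f x + g x) = avg f + avg g.
Proof. by rewrite /avg big_split mulrDr. Qed.

Lemma avgB T (f g : T -> R) : avg (fun x => f x - g x) = avg f - avg g.
Proof. by rewrite /avg sumrB mulrBr. Qed.

Lemma avg_sum T (J : Type) (r : seq J) (P : pred J) (f : J -> T -> R) :
  avg (fun x => \sum_(i <- r | P i) f i x) = \sum_(i <- r | P i) avg (f i).
Proof. by rewrite /avg exchange_big mulr_sumr. Qed.

Lemma avg_avg T U (f : T -> U -> R) :
  avg (fun x => avg (f x)) = avg (fun y => avg (f ^~ y)).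
Proof.
rewrite /avg -!mulr_sumr exchange_big/= mulrCA; congr (_ * (_ * _)).
Qed.

Lemma avg_bij T (h : T -> T) (f : T -> R) :
  bijective h -> avg (f \o h) = avg f.
Proof.
by move=> bh; congr (_ * _); rewrite [RHS](reindex h)//; exact: onW_bij.
Qed.

Lemma addr_bij (V : zmodType) (a : V) : bijective (+%R a).
Proof. by exists (+%R (- a)) => x; rewrite ?addKr ?addNKr. Qed.

Lemma ler_avg T (f g : T -> R) : (forall x, f x <= g x) -> avg f <= avg g.
Proof. by move=> fg; rewrite ler_wpM2l ?invr_ge0//; apply: ler_sum. Qed.

Lemma avg_ge0 T (f : T -> R) : (forall x, 0 <= f x) -> 0 <= avg f.
Proof. by move=> f0; rewrite mulr_ge0 ?invr_ge0 ?sumr_ge0. Qed.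

Lemma ler_norm_avg T (f : T -> R) : `|avg f| <= avg (fun x => `|f x|).
Proof.
rewrite normrM ger0_norm ?invr_ge0// ler_wpM2l ?invr_ge0//.
exact: ler_norm_sum.
Qed.

Lemma avg_prod (I T : finType) (g : I -> T -> R) :
  avg (fun y : {ffun I -> T} => \prod_i g i (y i)) = \prod_i avg (g i).
Proof.
rewrite /avg big_split/= bigA_distr_bigA/= card_ffun natrX -exprVn.
by rewrite prodr_const.
Qed.

(** Cauchy-Schwarz, from the nonnegativity of the quadratic avg ((f - t g)^2) at its minimiser t = M
    / G. *)
Lemma avg_sqr_le T (f g : T -> R) :
  avg (fun x => f x * g x) ^+ 2 <=
  avg (fun x => f x ^+ 2) * avg (fun x => g x ^+ 2).
Proof.
set F := avg (fun x => f x ^+ 2); set G := avg (fun x => g x ^+ 2).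
set M := avg _.
have F0 : 0 <= F by apply: avg_ge0 => x; exact: sqr_ge0.
have G0 : 0 <= G by apply: avg_ge0 => x; exact: sqr_ge0.
have quad t : 0 <= F - 2 * t * M + t ^+ 2 * G.
  have -> : F - 2 * t * M + t ^+ 2 * G = avg (fun x => (f x - t * g x) ^+ 2).
    rewrite -!avgZ -avgB -avgD; apply: eq_avg => x; ring.
  by apply: avg_ge0 => x; exact: sqr_ge0.
have [G00|Gn0] := eqVneq G 0.
  rewrite G00 mulr0; have [->|M0] := eqVneq M 0; first by rewrite expr0n.
  (* For G = 0 the quadratic is affine in t, and this t gives it the value -1. *)
  have := quad ((F + 1) / (2 * M)); rewrite G00 mulr0 addr0.
  have -> : F - 2 * ((F + 1) / (2 * M)) * M = -1 by field.
  by rewrite lerNr oppr0 ler10.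
have Gp : 0 < G by rewrite lt_neqAle eq_sym Gn0.
have := quad (M / G).
have -> : F - 2 * (M / G) * M + (M / G) ^+ 2 * G = (F * G - M ^+ 2) / G by field.
by rewrite pmulr_lge0 ?invr_gt0// subr_ge0.
Qed.

End Average.

Section Coordinates.
Context {R : realType} {I W : finType}.

Definition upd (y : {ffun I -> W}) j q : {ffun I -> W} :=
  [ffun j' => if j' == j then q else y j'].

(* (y, q) |-> (upd y j q, y j) is an involution *)
Lemma avg_upd (j : I) (f : {ffun I -> W} -> R) :
  avg f = avg (fun y => avg (fun q => f (upd y j q))).
Proof.
have [W0|W0] := posnP #|W|.
  have z (y : {ffun I -> W}) : False.
    by have := fintype0 (y j) W0.
  by apply: eq_avg => y; case: (z y).
rewrite /avg -mulr_sumr; congr (_ * _).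
rewrite [X in _ * X]pair_big/= (reindex (fun p : {ffun I -> W} * W => (upd p.1 j p.2, p.1 j)))/=.
  have updK (p : {ffun I -> W} * W) : upd (upd p.1 j p.2) j (p.1 j) = p.1.
    apply/ffunP => j'; rewrite !ffunE; case: eqP => [->//|//].
  rewrite [X in _ * X](eq_bigr (fun p => f p.1)); last by move=> p _; congr f; exact: updK.
  rewrite -(pair_big xpredT xpredT (fun (y : {ffun I -> W}) (q : W) => f y))/=.
  rewrite [X in _ * X](eq_bigr (fun y => f y *+ #|W|)); last first.
    by move=> y _; rewrite -sumr_const; apply: eq_bigl.
  by rewrite sumrMnl -[X in _ * X]mulr_natl mulKf// pnatr_eq0 -lt0n.
apply: onW_bij; apply: (inv_bij (f := fun p => (upd p.1 j p.2, p.1 j))) => -[y q]/=.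
congr pair; first by apply/ffunP => j'; rewrite !ffunE; case: eqP => [->//|//].
by rewrite ffunE eqxx.
Qed.

End Coordinates.

(** * Martingale difference kernels in one coordinate *)

Section Kernels.
Context {R : realType} {K : nat}.
Local Notation W := {ffun 'I_K -> 'I_4}.

(** Geometrically: w and y lie in the same cell of level k. *)
Definition agree k (w y : W) := [forall i : 'I_K, (i < k)%N ==> (w i == y i)].

Lemma agreeP k (w y : W) :
  reflect (forall i : 'I_K, (i < k)%N -> w i = y i) (agree k w y).
Proof.
apply: (iffP forallP) => [+ i ik|wy i]; first by move=> /(_ i)/implyP/(_ ik)/eqP.
by apply/implyP => /wy ->.
Qed.

Lemma agree_sym k w y : agree k w y = agree k y w.
Proof. by apply/agreeP/agreeP => wy i /wy. Qed.

Lemma agree_trans k w y z : agree k w y -> agree k w z = agree k y z.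
Proof.
by move=> /agreeP wy; apply/agreeP/agreeP => h i ik; [rewrite -wy// h|rewrite wy// h].
Qed.

Lemma agree_le k l w y : (k <= l)%N -> agree l w y -> agree k w y.
Proof.
by move=> kl /agreeP wy; apply/agreeP => i ik; rewrite wy// (leq_trans ik).
Qed.

Lemma agreeK w y : agree K w y = (w == y).
Proof.
by apply/agreeP/eqP => [wy|->//]; apply/ffunP => i; rewrite wy.
Qed.

Lemma agreeS (k : 'I_K) w y : agree k.+1 w y = agree k w y && (w k == y k).
Proof.
apply/agreeP/andP => [wy|[/agreeP wy /eqP wyk] i].
  by split; [apply/agreeP => i ik; apply: wy; exact: leqW|rewrite wy].
by rewrite ltnS leq_eqVlt => /predU1P[/val_inj->//|/wy].
Qed.

Lemma agree_nat k w y : (agree k w y)%:R =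
  \prod_(i < K) (if (i < k)%N then (w i == y i)%:R else 1 : R).
Proof.
have [/agreeP wy|] := boolP (agree k w y).
  by rewrite big1// => i _; case: ifPn => // /wy ->; rewrite eqxx.
rewrite negb_forall => /existsP[i]; rewrite negb_imply => /andP[ik wy].
by rewrite (bigD1 i)//= ik (negbTE wy) mul0r.
Qed.

Lemma avg_agree k w : (k <= K)%N -> avg (fun y => (agree k w y)%:R : R) = 4 ^- k.
Proof.
move=> kK; under eq_avg do rewrite agree_nat.
rewrite (avg_prod (fun (i : 'I_K) (d : 'I_4) => if (i < k)%N then (w i == d)%:R else 1)).
transitivity (\prod_(i < K) (if (i < k)%N then 4^-1 else 1 : R)).
  apply: eq_bigr => i _; case: ifP => _; last by rewrite avg_cst ?card_ord.
  rewrite /avg card_ord -[RHS]mulr1; congr (_ * _).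
  rewrite (bigD1 (w i))//= eqxx big1 ?addr0// => d /negbTE.
  by rewrite eq_sym => ->.
rewrite -big_mkcond/= (big_ord_narrow kK)/= -exprVn -[in RHS](card_ord k) -prodr_const.
exact: eq_bigl.
Qed.

(** Averaging F against it gives the conditional expectation of F given the first k digits: the
    indicator of the common cell divided by its probability 4^-k. *)
Definition cell_kernel k (w y : W) : R := 4 ^+ k * (agree k w y)%:R.
(** Kernel of the martingale difference at level k. At k = 0 nothing is subtracted, which leaves the
    constant 1. *)
Definition level_kernel k (w y : W) : R := cell_kernel k w y - if k is k'.+1 then cell_kernel k' w y else 0.

Lemma cell_kernel_ge0 k w y : 0 <= cell_kernel k w y.
Proof. by rewrite mulr_ge0. Qed.

Lemma cell_kernelC k w y : cell_kernel k w y = cell_kernel k y w.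
Proof. by rewrite /cell_kernel agree_sym. Qed.

Lemma avg_cell_kernel k w : (k <= K)%N -> avg (cell_kernel k w) = 1.
Proof. by move=> kK; rewrite /cell_kernel avgZ avg_agree// mulfV// expf_neq0. Qed.

Lemma avg_level_kernel k w : (k < K)%N -> avg (level_kernel k.+1 w) = 0.
Proof. by move=> kK; rewrite /level_kernel avgB !avg_cell_kernel ?subrr// ltnW. Qed.

Lemma avg_norm_level_kernel k w : (k <= K)%N -> avg (fun y => `|level_kernel k w y|) <= 2.
Proof.
move=> kK; apply: (@le_trans _ _ (avg (fun y => cell_kernel k w y + cell_kernel k.-1 w y))).
  apply: ler_avg => y; apply: (le_trans (ler_normB _ _)).
  by rewrite !ger0_norm ?cell_kernel_ge0 ?lerD2l//; case: (k) => [|k'] //=; rewrite ?cell_kernel_ge0.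
by rewrite avgD !avg_cell_kernel// (leq_trans (leq_pred k)).
Qed.

Lemma level_kernel0 w y : level_kernel 0 w y = 1.
Proof. by rewrite /level_kernel /cell_kernel subr0 expr0 mul1r (_ : agree 0 w y)//; exact/agreeP. Qed.

Lemma level_kernel_supp k w y : level_kernel k.+1 w y != 0 -> agree k w y.
Proof.
apply: contraR => /negbTE n; rewrite /level_kernel /cell_kernel n mulr0 subr0.
have [/(agree_le (leqnSn k))|_] := boolP (agree k.+1 w y); first by rewrite n.
by rewrite mulr0.
Qed.

(** The levels telescope, and agreement in all K digits is equality, so the sum is the identity
    kernel with respect to [avg]. *)
Lemma sum_level_kernel w y : \sum_(k < K.+1) level_kernel k w y = 4 ^+ K * (w == y)%:R.
Proof.
suff H n : \sum_(k < n.+1) level_kernel k w y = cell_kernel n w y by rewrite H /cell_kernel agreeK.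
elim: n => [|n IH]; first by rewrite big_ord_recr big_ord0 /= add0r /level_kernel subr0.
by rewrite big_ord_recr/= IH /level_kernel addrC subrK.
Qed.

Lemma level_kernel_agree k w w' y : agree k w w' -> level_kernel k w y = level_kernel k w' y.
Proof.
move=> ww'; rewrite /level_kernel /cell_kernel (agree_trans _ ww').
case: k ww' => // k ww'; by rewrite (agree_trans _ (agree_le (leqnSn k) ww')).
Qed.

Definition single_digit (k : 'I_K) (c : 'I_4) : W := [ffun k' => if k' == k then c else 0].

Lemma agree_single_digit (k : 'I_K) w c : agree k w (w + single_digit k c).
Proof.
apply/agreeP => i ik; rewrite !ffunE; case: eqP => [ki|_]; last by rewrite addr0.
by rewrite ki ltnn in ik.
Qed.

(** Addition in ['I_4] is modulo 4, so digit k runs once through the four siblings, over which a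
    martingale difference has mean 0. *)
Lemma avg_level_kernel_digit (k : 'I_K) w y : avg (fun c => level_kernel k.+1 (w + single_digit k c) y) = 0.
Proof.
rewrite /level_kernel avgB /cell_kernel !avgZ.
under [X in _ - _ * X]eq_avg do rewrite -(agree_trans _ (agree_single_digit k w _)).
under eq_avg do rewrite agreeS -(agree_trans _ (agree_single_digit k w _)) -mulnb natrM.
rewrite avgZ avg_cst ?card_ord//.
suff -> : avg (fun c => ((w + single_digit k c) k == y k)%:R : R) = 4^-1.
  by rewrite mulrCA exprSr -mulrA mulfV// mulr1 mulrC subrr.
rewrite /avg card_ord -[RHS]mulr1; congr (_ * _).
rewrite (bigD1 (y k - w k))//= !ffunE eqxx subrKC eqxx big1 ?addr0// => c cy.
rewrite !ffunE eqxx; case: eqP => // e; move: cy.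
by rewrite -e addrAC subrr add0r eqxx.
Qed.

End Kernels.

(** * Components of a function of several coordinates *)

Section Components.
Context {R : realType} {s K : nat}.
Local Notation W := {ffun 'I_K -> 'I_4}.
Local Notation Ws := {ffun 'I_s -> W}.
Implicit Types (l : {ffun 'I_s -> 'I_K.+1}) (F : Ws -> R).

Definition component l F (w : Ws) : R :=
  avg (fun y : Ws => (\prod_j level_kernel (l j) (w j) (y j)) * F y).

Lemma card_W_gt0 : (0 < #|{: W}|)%N.
Proof. by apply/card_gt0P; exists 0. Qed.

Lemma card_Ws_gt0 : (0 < #|{: Ws}|)%N.
Proof. by apply/card_gt0P; exists 0. Qed.

(** Distributing the product over j of the telescoping sums expands the identity kernel over all
    level vectors. *)
Lemma sum_component F w : \sum_l component l F w = F w.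
Proof.
rewrite /component -avg_sum.
under eq_avg => y.
  rewrite -mulr_suml.
  rewrite -(bigA_distr_bigA (fun j (k : 'I_K.+1) => level_kernel (R := R) k (w j) (y j))).
  over.
under eq_avg do under eq_bigr do rewrite sum_level_kernel.
rewrite /avg (bigD1 w)//= [X in _ + X]big1 ?addr0; last first.
  move=> y yw; suff [j wy] : exists j, w j != y j.
    by rewrite (bigD1 j)//= (negbTE wy) mulr0 !mul0r.
  by apply/existsP; rewrite -negb_forall; apply: contra yw => /forallP h;
     apply/eqP/ffunP => j; rewrite (eqP (h j)).
under eq_bigr do rewrite eqxx mulr1.
rewrite prodr_const !card_ffun !card_ord !natrX mulKf// !expf_neq0//.
Qed.

Lemma component_agree l F (w w' : Ws) : (forall j, agree (l j) (w j) (w' j)) ->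
  component l F w = component l F w'.
Proof.
move=> ww'; apply: eq_avg => y; congr (_ * _); apply: eq_bigr => j _.
exact: level_kernel_agree.
Qed.

Definition single_digits (j : 'I_s) (k : 'I_K) (c : 'I_4) : Ws :=
  [ffun j' => if j' == j then single_digit k c else 0].

(** One coordinate of positive level is enough for the cancellation: the factors of the other
    coordinates do not depend on the translated digit. *)
Lemma avg_component_digits l F (w : Ws) j (k : 'I_K) : l j = k.+1 :> nat ->
  avg (fun c => component l F (w + single_digits j k c)) = 0.
Proof.
move=> ljk; rewrite /component avg_avg -[RHS](avg_cst (T := Ws) _ card_Ws_gt0).
apply: eq_avg => y; rewrite avgZr.
under eq_avg.
  move=> c; rewrite (bigD1 j)//= !ffunE eqxx ljk.
  under eq_bigr => j' /negbTE j'j do rewrite !ffunE j'j addr0.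
  over.
by rewrite avgZr avg_level_kernel_digit !mul0r.
Qed.

Lemma component0 F w : component [ffun=> ord0] F w = avg F.
Proof.
by apply: eq_avg => y; rewrite big1 ?mul1r// => j _; rewrite ffunE level_kernel0.
Qed.

End Components.

(** * Scrambled nets with finitely many digits *)

Section Scramble.
Context {R : realType} {s K : nat} {I N : finType}.
Local Notation W := {ffun 'I_K -> 'I_4}.
Local Notation Ws := {ffun 'I_s -> W}.
(** [node i j k] is the node of the digit tree whose permutation acts on digit k of coordinate j of
    point i. The two hypotheses say that such a node amounts to a coordinate, a depth and the
    preceding digits. *)
Variables (alpha : I -> Ws) (node : I -> 'I_s -> 'I_K -> N).
Local Notation perms := {ffun N -> {perm 'I_4}}.
Hypothesis node_inj : forall i j k i' j' k', node i j k = node i' j' k' ->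
  [/\ j = j', k = k' & agree k (alpha i j) (alpha i' j)].
Hypothesis node_agree : forall i i' j (k : 'I_K),
  agree k (alpha i j) (alpha i' j) -> node i j k = node i' j k.

Definition scrambled (i : I) (sigma : perms) : Ws :=
  [ffun j => [ffun k => sigma (node i j k) (alpha i j k)]].

Definition add_digit (c : 'I_4) : {perm 'I_4} := perm (addIr c).

(** Translates the output digit at each node. It is a bijection, hence preserves the uniform law,
    and it acts on each scrambled point by a translation. *)
Definition shift_perms (tau : N -> 'I_4) (sigma : perms) : perms :=
  [ffun v => (sigma v * add_digit (tau v))%g].

Lemma shift_bij tau : bijective (shift_perms tau).
Proof.
by exists (shift_perms (fun v => - tau v)) => sigma; apply/ffunP => v; rewrite !ffunE;
   apply/permP => d; rewrite !permM !permE ?addrK// subrK.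
Qed.

Lemma scrambled_shift i tau sigma : scrambled i (shift_perms tau sigma) =
  scrambled i sigma + [ffun j => [ffun k => tau (node i j k)]].
Proof.
by apply/ffunP => j; apply/ffunP => k; rewrite !ffunE permM permE.
Qed.

(** By induction on the position: as long as the original digits agree the nodes coincide, and the
    permutation at the common node is injective. *)
Lemma agree_scrambled i i' sigma j k :
  agree k (scrambled i sigma j) (scrambled i' sigma j) ->
  agree k (alpha i j) (alpha i' j).
Proof.
move=> /agreeP X; apply/agreeP => q; have [n] := ubnP q.
elim: n q => // n IH q qn qk; have := X q qk; rewrite !ffunE.
rewrite (@node_agree i i' j q) => [/perm_inj//|].
by apply/agreeP => r rq; apply: IH; [rewrite (leq_trans rq)|exact: ltn_trans qk].
Qed.

Lemma card_perms_gt0 : (0 < #|{: perms}|)%N.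
Proof. by apply/card_gt0P; exists [ffun=> 1%g]. Qed.

(** A scrambled point is uniform: averaging over all translations at the nodes that point i visits
    adds a uniform c to it. *)
Lemma avg_scrambled i (H : Ws -> R) :
  avg (fun sigma => H (scrambled i sigma)) = avg H.
Proof.
(* Point i visits distinct nodes for distinct (j, k), so the sum has a single term at a visited
   node; elsewhere it is 0. *)
pose tau (c : Ws) v := \sum_(p : 'I_s * 'I_K | node i p.1 p.2 == v) c p.1 p.2.
have tauE c j k : tau c (node i j k) = c j k.
  rewrite /tau (big_pred1 (j, k))// => -[j' k']/=.
  by apply/eqP/eqP => [/node_inj[-> -> _]|[-> ->]].
transitivity (avg (fun c : Ws => avg (fun sigma => H (scrambled i sigma + c)))).
  rewrite -[LHS](avg_cst (T := Ws) _ card_Ws_gt0); apply: eq_avg => c.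
  rewrite -(avg_bij _ (shift_bij (tau c))); apply: eq_avg => sigma /=.
  rewrite scrambled_shift; congr H; congr (_ + _).
  by apply/ffunP => j; apply/ffunP => k; rewrite !ffunE tauE.
rewrite avg_avg -[RHS](avg_cst (T := perms) _ card_perms_gt0).
apply: eq_avg => sigma; exact: (avg_bij H (addr_bij (scrambled i sigma))).
Qed.

(** Translating the permutation at one node leaves G fixed and moves a single digit of the argument
    of H, over which H has mean 0. *)
Lemma avg_scrambled_mul0 i j k (H : Ws -> R) (G : perms -> R) :
  (forall w, avg (fun c => H (w + single_digits j k c)) = 0) ->
  (forall sigma tau, (forall v, v != node i j k -> tau v = 0) ->
     G (shift_perms tau sigma) = G sigma) ->
  avg (fun sigma => H (scrambled i sigma) * G sigma) = 0.
Proof.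
move=> H0 GE; pose tau c v : 'I_4 := if v == node i j k then c else 0.
transitivity (avg (fun c => avg (fun sigma => H (scrambled i sigma + single_digits j k c) * G sigma))).
  rewrite -[LHS](avg_cst (T := 'I_4)) ?card_ord//; apply: eq_avg => c.
  rewrite -(avg_bij _ (shift_bij (tau c))); apply: eq_avg => sigma /=.
  rewrite GE; last by move=> v /negbTE vn; rewrite /tau vn.
  rewrite scrambled_shift; congr (H (_ + _) * _).
  apply/ffunP => j'; apply/ffunP => k'; rewrite !ffunE /tau.
  have [->|/eqP j'j] := eqVneq j' j; last first.
    by rewrite ffunE; case: eqP => // /node_inj[].
  rewrite ffunE; have [->|/eqP k'k] := eqVneq k' k; first by rewrite eqxx.
  by case: eqP => // /node_inj[].
rewrite avg_avg -[RHS](avg_cst (T := perms) _ card_perms_gt0).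
by apply: eq_avg => sigma; rewrite avgZr H0 mul0r.
Qed.

Implicit Types (l : {ffun 'I_s -> 'I_K.+1}) (F : Ws -> R).

(** Digit k of coordinate j is the last one that the first factor reads there. The second factor
    either does not read it or meets another node at that depth, so translating at [node i j k] does
    not change it. *)
Lemma avg_component_mul0 i i' j (k : 'I_K) l l' F : l j = k.+1 :> nat ->
  (l' j <= k)%N || ~~ agree k (alpha i j) (alpha i' j) ->
  avg (fun sigma => component l F (scrambled i sigma) *
    component l' F (scrambled i' sigma)) = 0.
Proof.
move=> lj hk; apply: (@avg_scrambled_mul0 i j k (component l F)
  (fun sigma => component l' F (scrambled i' sigma))).
  by move=> w; exact: avg_component_digits.
move=> sigma tau tau0; apply: component_agree => j'; apply/agreeP => k' k'l.
rewrite scrambled_shift !ffunE tau0 ?addr0//; apply/eqP => /node_inj[jj kk].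
subst j' k'; rewrite agree_sym => ag.
by move: hk; rewrite ag orbF leqNgt k'l.
Qed.

Lemma avg_component l F : l != [ffun=> ord0] -> avg (component l F) = 0.
Proof.
move=> l0; have [j lj] : exists j, l j != ord0.
  apply/existsP; rewrite -negb_forall; apply: contra l0 => /forallP h.
  by apply/eqP/ffunP => j; rewrite ffunE (eqP (h j)).
have lK : ((l j).-1 < K)%N by rewrite prednK ?lt0n// -ltnS.
transitivity (avg (fun w : Ws => avg (fun c => component l F (w + single_digits j (Ordinal lK) c)))).
  rewrite [RHS]avg_avg -[LHS](avg_cst (T := 'I_4)) ?card_ord//; apply: eq_avg => c.
  rewrite -(avg_bij (component l F) (addr_bij (single_digits j (Ordinal lK) c))).
  by apply: eq_avg => w /=; rewrite addrC.
rewrite -[RHS](avg_cst (T := Ws) _ card_Ws_gt0); apply: eq_avg => w.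
by rewrite avg_component_digits//= prednK// lt0n.
Qed.

Definition estim F (sigma : perms) : R := avg (fun i => F (scrambled i sigma)).

Lemma avg_estim_mul F G : avg (fun sigma => estim F sigma * estim G sigma) =
  avg (fun i => avg (fun i' => avg (fun sigma =>
    F (scrambled i sigma) * G (scrambled i' sigma)))).
Proof.
rewrite /estim; under eq_avg do rewrite -avgZr.
rewrite avg_avg; apply: eq_avg => i; rewrite avg_avg; apply: eq_avg => sigma.
by rewrite avgZ.
Qed.

(** In a coordinate where the levels differ, the lower one does not read the last digit of the
    higher one; this kills the term of every pair of points. *)
Lemma avg_estim_component_mul0 l l' F : l != l' ->
  avg (fun sigma => estim (component l F) sigma * estim (component l' F) sigma) = 0.
Proof.
move=> ll'; have [j lj] : exists j, l j != l' j.
  apply/existsP; rewrite -negb_forall; apply: contra ll' => /forallP h.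
  by apply/eqP/ffunP => j; rewrite (eqP (h j)).
wlog ltl : l l' lj {ll'} / (l' j < l j)%N => [hw|].
  have [|lt|/val_inj e] := ltngtP (l' j) (l j); first exact: hw.
    under eq_avg do rewrite mulrC.
    by apply: hw => //; rewrite eq_sym.
  by rewrite e eqxx in lj.
have lK : ((l j).-1 < K)%N by rewrite prednK ?(leq_ltn_trans _ ltl)// -ltnS.
have lP : (l j).-1.+1 = l j by rewrite prednK// (leq_ltn_trans _ ltl).
rewrite avg_estim_mul /avg big1 ?mulr0// => i _; rewrite big1 ?mulr0// => i' _.
apply: (@avg_component_mul0 i i' j (Ordinal lK)) => //=.
by rewrite -ltnS lP ltl.
Qed.

Lemma variance_estim F : (0 < #|I|)%N ->
  avg (fun sigma => estim F sigma ^+ 2) - avg F ^+ 2 =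
  \sum_(l | l != [ffun=> ord0]) avg (fun sigma => estim (component l F) sigma ^+ 2).
Proof.
move=> I0.
have estimE sigma : estim F sigma = \sum_l estim (component l F) sigma.
  rewrite /estim -avg_sum; apply: eq_avg => i; by rewrite sum_component.
have -> : avg (fun sigma => estim F sigma ^+ 2) =
    \sum_l avg (fun sigma => estim (component l F) sigma ^+ 2).
  transitivity (avg (fun sigma => \sum_l \sum_l'
      estim (component l F) sigma * estim (component l' F) sigma)).
    apply: eq_avg => sigma; rewrite expr2 {1}estimE mulr_suml.
    by apply: eq_bigr => l _; rewrite estimE mulr_sumr.
  rewrite avg_sum; apply: eq_bigr => l _; rewrite avg_sum (bigD1 l)//=.
  rewrite big1 ?addr0; last first.
    by move=> l' l'l; rewrite avg_estim_component_mul0// eq_sym.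
  by apply: eq_avg => sigma; rewrite expr2.
(* Level 0 is the constant avg F, whose square is the squared mean being subtracted. *)
rewrite (bigD1 [ffun=> ord0])//= [X in X + _ - _](_ : _ = avg F ^+ 2); last first.
  rewrite -[RHS](avg_cst (T := perms) _ card_perms_gt0); apply: eq_avg => sigma.
  rewrite -[X in _ = X ^+ 2](avg_cst (T := I) _ I0); congr (_ ^+ 2).
  by apply: eq_avg => i; rewrite component0.
by rewrite addrC addKr.
Qed.

Variable m : nat.
Hypothesis cardI : #|I| = (4 ^ m)%N.
Hypothesis net : forall k : 'I_s -> nat, (forall j, (k j <= K)%N) ->
  (\sum_j k j = m)%N -> forall i i',
  (forall j, agree (k j) (alpha i j) (alpha i' j)) -> i = i'.

Let I0 : (0 < #|I|)%N. Proof. by rewrite cardI expn_gt0. Qed.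

(* Exactly one scrambled point lies in each box of volume 4^-m: at most one by
   the net property, and the number of points is one on average. *)
Lemma sum_agree_scrambled (k : 'I_s -> nat) sigma (w : Ws) :
  (forall j, (k j <= K)%N) -> (\sum_j k j = m)%N ->
  \sum_i \prod_j (agree (k j) (scrambled i sigma j) (w j))%:R = 1 :> R.
Proof.
move=> kK km; pose Nw (w : Ws) : R :=
  \sum_i \prod_j (agree (k j) (scrambled i sigma j) (w j))%:R.
have prodE i (v : Ws) : \prod_j (agree (k j) (scrambled i sigma j) (v j))%:R =
    [forall j, agree (k j) (scrambled i sigma j) (v j)]%:R :> R.
  case: forallP => [h|/forallP]; first by rewrite big1// => j _; rewrite h.
  by rewrite negb_forall => /existsP[j /negbTE h]; rewrite (bigD1 j)//= h mul0r.
have N1 v : Nw v <= 1.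
  rewrite /Nw; have [/existsP[i0 /forallP i0v]|] :=
      boolP [exists i, forall j, agree (k j) (scrambled i sigma j) (v j)].
    rewrite (bigD1 i0)//= [X in _ + X]big1 ?addr0 ?prodE ?lern1 ?leq_b1// => i ii0.
    rewrite prodE; case: forallP => // iv; case/eqP: ii0; apply: (net kK km) => j.
    apply: (@agree_scrambled _ _ sigma).
    by rewrite (agree_trans _ (iv j)) agree_sym i0v.
  rewrite negb_exists => /forallP h; rewrite big1// => i _; rewrite prodE.
  by rewrite (negbTE (h i)).
have avgN : avg (fun v => 1 - Nw v) = 0.
  rewrite avgB avg_cst ?card_Ws_gt0// avg_sum.
  under eq_bigr => i _.
    rewrite (avg_prod (fun j v => (agree (k j) (scrambled i sigma j) v)%:R)).
    under eq_bigr do rewrite avg_agree//.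
    over.
  rewrite sumr_const cardI prodfV -expr_sum km.
  by rewrite -[X in _ - X]mulr_natr natrX mulVf ?subrr// expf_neq0.
have /eqP : \sum_v (1 - Nw v) = 0.
  move/eqP: avgN; rewrite mulf_eq0 invr_eq0 pnatr_eq0 -[_ == 0%N]negbK -lt0n.
  by rewrite card_Ws_gt0 => /eqP.
rewrite psumr_eq0 => [|v _]; last by rewrite subr_ge0.
by move=> /allP/(_ w (mem_index_enum _)) /=; rewrite subr_eq0 => /eqP.
Qed.

(** Refine l to a vector k of sum exactly m. Each box of levels k contains one scrambled point and
    the component is constant on it, so the estimator equals the mean of the component, which is
    0. *)
Lemma estim_component0 l F sigma : (m <= K)%N -> (\sum_j l j <= m)%N ->
  l != [ffun=> ord0] -> estim (component l F) sigma = 0.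
Proof.
move=> mK lm l0; have [j0 _] : exists j, l j != ord0.
  apply/existsP; rewrite -negb_forall; apply: contra l0 => /forallP h.
  by apply/eqP/ffunP => j; rewrite ffunE (eqP (h j)).
(* The whole deficit goes to one coordinate, whose level stays at most K because m <= K. *)
pose k j := (l j + (if j == j0 then m - \sum_j l j else 0))%N.
have km : (\sum_j k j = m)%N.
  by rewrite big_split/= -big_mkcond big_pred1_eq subnKC.
have kK j : (k j <= K)%N.
  by apply: leq_trans mK; rewrite -km (bigD1 j)//= leq_addr.
rewrite -[RHS](avg_component F l0).
transitivity (avg (fun w : Ws => \sum_i
    \prod_j (agree (k j) (scrambled i sigma j) (w j))%:R * component l F w)); last first.
  by apply: eq_avg => w; rewrite -mulr_suml sum_agree_scrambled// mul1r.
rewrite avg_sum /estim /avg mulr_sumr; apply: eq_bigr => i _.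
transitivity (avg (fun w : Ws =>
  (\prod_j (agree (k j) (scrambled i sigma j) (w j))%:R) * component l F (scrambled i sigma))).
  rewrite avgZr (avg_prod (fun j v => (agree (k j) (scrambled i sigma j) v)%:R)).
  congr (_ * _); under eq_bigr do rewrite avg_agree//.
  by rewrite cardI prodfV -expr_sum km natrX.
apply: eq_avg => w; have [/forallP iw|] :=
    boolP [forall j, agree (k j) (scrambled i sigma j) (w j)].
  congr (_ * _); apply: component_agree => j; apply: (agree_le _ (iw j)).
  exact: leq_addr.
rewrite negb_forall => /existsP[j /negbTE h].
by rewrite (bigD1 j)//= h !mul0r.
Qed.

(** Supplies a box of volume 4^-m that is no finer than the levels l. *)
Lemma sum_between (l : 'I_s -> nat) : (m <= \sum_j l j)%N ->
  exists2 k : 'I_s -> nat, (forall j, (k j <= l j)%N) & (\sum_j k j = m)%N.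
Proof.
clear; move=> /subnKC; move: (_ - _)%N => d; elim: d l => [|d IH] l dl.
  by exists l => //; rewrite -dl addn0.
have [j lj] : exists j, (0 < l j)%N.
  apply/existsP; rewrite -[[exists _, _]]negbK negb_exists; apply/negP => /forallP h.
  move: dl; rewrite big1 => [|j _]; first by rewrite addnS.
  by apply/eqP; rewrite -leqn0 leqNgt.
pose l' j' := if j' == j then (l j).-1 else l j'.
have [|k kl km] := IH l'.
  apply/eqP; rewrite -eqSS -addnS dl (bigD1 j)//= [X in _ == X.+1](bigD1 j)//=.
  rewrite /l' eqxx -addSn prednK//; apply/eqP; congr (_ + _)%N.
  by apply: eq_bigr => j' /negbTE ->.
exists k => // j'; apply: (leq_trans (kl j')); rewrite /l'.
by case: eqP => // ->; exact: leq_pred.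
Qed.

(** Fix i. A nonzero covariance forces i' to share l_j - 1 digits with i in each coordinate j.
    Choose k <= l of sum m: by the net property such an i' is determined by its digits at positions
    k_j - 1, which leaves at most 4^s possibilities. *)
Lemma avg_estim_component_le l F (M : R) : (m <= \sum_j l j)%N ->
  (forall w, `|component l F w| <= M) ->
  avg (fun sigma => estim (component l F) sigma ^+ 2) <= (4 ^ s)%:R * M ^+ 2 / 4 ^+ m.
Proof.
move=> lm FM.
have M0 : 0 <= M := le_trans (normr_ge0 _) (FM 0).
under eq_avg do rewrite expr2.
rewrite avg_estim_mul -[leRHS](avg_cst (T := I) _ I0); apply: ler_avg => i.
have [k kl km] := sum_between lm.
pose close i' := [forall j, agree (l j).-1 (alpha i j) (alpha i' j)].
have card_close : (#|close| <= 4 ^ s)%N.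
  (* Positions count from 0. For k_j = 0 the predecessor is 0 again, which is harmless since
     agreement to depth 0 always holds. *)
  pose last_dig i' : {ffun 'I_s -> 'I_4} :=
    [ffun j => if insub (k j).-1 is Some q then alpha i' j q else 0].
  have -> : (4 ^ s = #|{: {ffun 'I_s -> 'I_4}}|)%N by rewrite card_ffun !card_ord.
  apply: (leq_card_in last_dig) => i1 i2 /forallP c1 /forallP c2 /ffunP e.
  apply: (net _ km) => j; first by rewrite (leq_trans (kl j))// -ltnS.
  have := e j; rewrite !ffunE; have := kl j.
  case: (k j) => [_ _|q /= ql]; first exact/agreeP.
  have qK : (q < K)%N by rewrite (leq_trans ql)// -ltnS.
  rewrite (insubT (fun q => (q < K)%N) qK)/= => eq.
  rewrite (@agreeS _ (Ordinal qK)) eq eqxx andbT -(agree_trans _ (w := alpha i j)).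
    by apply: agree_le (c2 j); rewrite -ltnS prednK// (leq_ltn_trans _ ql).
  by apply: agree_le (c1 j); rewrite -ltnS prednK// (leq_ltn_trans _ ql).
apply: (@le_trans _ _ (avg (fun i' => M ^+ 2 * (close i')%:R))).
  apply: ler_avg => i'; rewrite /close; case: forallP => [_|/forallP].
    rewrite mulr1; apply: le_trans (ler_norm _) _; apply: le_trans (ler_norm_avg _) _.
    rewrite -[leRHS](avg_cst (T := perms) _ card_perms_gt0); apply: ler_avg => sigma.
    by rewrite normrM expr2 ler_pM.
  rewrite negb_forall mulr0 => /existsP[j nag].
  have lj : (0 < l j)%N.
    rewrite lt0n; apply: contraNneq nag => ->; by apply/agreeP.
  have lK : ((l j).-1 < K)%N by rewrite prednK// -ltnS.
  by rewrite (@avg_component_mul0 i i' j (Ordinal lK) l l F) ?nag ?orbT//= prednK.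
rewrite avgZ /avg -natr_sum cardI natrX [leRHS]mulrAC mulrC ler_wpM2r ?sqr_ge0//.
rewrite mulrC ler_wpM2r ?invr_ge0 ?exprn_ge0// ler_nat.
apply: leq_trans card_close; rewrite -sum1_card [leqRHS]big_mkcond/=.
apply: leq_sum => i' _; rewrite unfold_in /close; by case: forallP.
Qed.

(** Sharing l_j - 1 digits in every coordinate now means sharing a box of volume 4^-m, so only the
    diagonal covariances survive. Each is the mean square of the component under the uniform law. *)
Lemma avg_estim_component_eq l F : (\sum_j (l j).-1 = m)%N -> (forall j, 0 < l j)%N ->
  avg (fun sigma => estim (component l F) sigma ^+ 2) =
  avg (fun w => component l F w ^+ 2) / 4 ^+ m.
Proof.
move=> lm l0; under eq_avg do rewrite expr2.
have lK j : ((l j).-1 < K)%N by rewrite prednK// -ltnS.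
rewrite avg_estim_mul -[RHS](avg_cst (T := I) _ I0); apply: eq_avg => i.
rewrite {1}/avg (bigD1 i)//= [X in _ + X]big1 ?addr0 => [|i' i'i]; last first.
  have [j nag] : exists j, ~~ agree (l j).-1 (alpha i j) (alpha i' j).
    apply/existsP; rewrite -negb_forall; apply: contraNN i'i => /forallP h.
    apply/eqP/esym/(net _ lm) => // j; exact: ltnW.
  by rewrite (@avg_component_mul0 i i' j (Ordinal (lK j)) l l F) ?nag ?orbT//= prednK.
under eq_avg do rewrite -expr2.
by rewrite (avg_scrambled i (fun w => component l F w ^+ 2)) mulrC cardI natrX.
Qed.

End Scramble.

(** * Cells of the triangle *)

Section Geometry.
Context {R : realType}.
Implicit Types (p q : R * R) (d : 'I_4) (w : seq 'I_4).

(** The affine map of T^2 onto its subtriangle d that respects the listed vertex order; for d = 3 it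
    is p |-> (1/2, 1/2) - p/2. *)
Definition child d p : R * R :=
  match val d with
  | 0 => (p.1 / 2, p.2 / 2)
  | 1 => (p.1 / 2 + 2^-1, p.2 / 2)
  | 2 => (p.1 / 2, p.2 / 2 + 2^-1)
  | _ => (2^-1 - p.1 / 2, 2^-1 - p.2 / 2)
  end.

(** The first digit acts outermost, so the image of T^2 is the cell with digits w. *)
Definition descend w p : R * R := foldr child p w.

(* The fourth child is upside down. *)
Definition ratio d : R := if val d == 3 then - 2^-1 else 2^-1.

(** Every cell is a homothetic image of T^2; this is the signed ratio, negative when the digit 3
    occurs an odd number of times. *)
Definition scale w : R := \prod_(d <- w) ratio d.

Lemma childB d p q : (child d p).1 - (child d q).1 = ratio d * (p.1 - q.1) /\
  (child d p).2 - (child d q).2 = ratio d * (p.2 - q.2).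
Proof. by case: d => -[|[|[|[|//]]]] ?; rewrite /child /ratio /=; split; ring. Qed.

Lemma descendB w p q :
  (descend w p).1 - (descend w q).1 = scale w * (p.1 - q.1) /\
  (descend w p).2 - (descend w q).2 = scale w * (p.2 - q.2).
Proof.
elim: w => [|d w [IH1 IH2]]; first by rewrite /scale !big_nil !mul1r.
rewrite /scale !big_cons -!mulrA -/(scale w) -IH1 -IH2; exact: childB.
Qed.

Lemma norm_ratio d : `|ratio d| = 2^-1.
Proof. by rewrite /ratio; case: ifP => _; rewrite ?normrN ger0_norm. Qed.

Lemma norm_scale w : `|scale w| = 2 ^- size w.
Proof.
rewrite /scale normr_prod; under eq_bigr do rewrite norm_ratio.
by rewrite big_const_seq count_predT iter_mulr_1 exprVn.
Qed.

Lemma descend_cat u w p : descend (u ++ w) p = descend u (descend w p).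
Proof. exact: foldr_cat. Qed.

Lemma descend_rcons w d p : descend (rcons w d) p = descend w (child d p).
Proof. by rewrite -cats1 descend_cat. Qed.

Definition T2o p := [&& 0 < p.1, 0 < p.2 & p.1 + p.2 < 1].

Lemma child_T2 d p : T2 R p -> T2 R (child d p).
Proof.
by case: p => x y [/= x0 y0 xy]; case: d => -[|[|[|[|//]]]] ?; split => /=; lra.
Qed.

Lemma child_T2o d p : T2o p -> T2o (child d p).
Proof.
case: p => x y /and3P[/= x0 y0 xy].
by case: d => -[|[|[|[|//]]]] ?; apply/and3P; split => /=; lra.
Qed.

Lemma descend_T2 w p : T2 R p -> T2 R (descend w p).
Proof. by move=> Tp; elim: w => //= d w; exact: child_T2. Qed.

Lemma descend_T2o w p : T2o p -> T2o (descend w p).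
Proof. by move=> Tp; elim: w => //= d w; exact: child_T2o. Qed.

Lemma T2oW p : T2o p -> T2 R p.
Proof. by case/and3P => *; split; lra. Qed.

Lemma midpoint_child d p q : midpoint (child d p) (child d q) = child d (midpoint p q).
Proof.
case: p q => [x y] [z t]; rewrite /midpoint /child.
by case: d => -[|[|[|[|//]]]] ? /=; congr pair; rewrite /GRing.scale/=; field.
Qed.

Lemma midpoint_descend w p q :
  midpoint (descend w p) (descend w q) = descend w (midpoint p q).
Proof. by elim: w => //= d w IH; rewrite midpoint_child IH. Qed.

(** Midpoints commute with affine maps, so splitting a cell is the image of splitting T^2: the new
    digit acts innermost. *)
Lemma T2_cellE (u : nat -> 'I_4) K : T2_cell R u K =
  (descend (mkseq u K) (0, 0), descend (mkseq u K) (1, 0), descend (mkseq u K) (0, 1)).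
Proof.
elim: K => // K IH; rewrite [LHS]/= IH mkseqS !descend_rcons /subtriangle.
rewrite !midpoint_descend /midpoint /child.
by case: (u K) => -[|[|[|[|//]]]] ? /=; congr (_, _, _); congr descend;
  congr pair; rewrite /GRing.scale/=; field.
Qed.

(** An interior reference point, so that all cell centres lie in the open triangle, where partial
    derivatives are available. *)
Definition bary : R * R := (3^-1, 3^-1).

Lemma bary_T2o : T2o bary.
Proof. by apply/and3P; rewrite /bary/=; split; lra. Qed.

Lemma T2_dist p q : T2 R p -> T2 R q -> `|p.1 - q.1| <= 1 /\ `|p.2 - q.2| <= 1.
Proof. by move=> [p1 p2 p12] [q1 q2 q12]; rewrite !ler_norml; split; lra. Qed.

Lemma descend_dist w p q : T2 R p -> T2 R q ->
  `|(descend w p).1 - (descend w q).1| <= 2 ^- size w /\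
  `|(descend w p).2 - (descend w q).2| <= 2 ^- size w.
Proof.
move=> Tp Tq; have [-> ->] := descendB w p q; have [h1 h2] := T2_dist Tp Tq.
rewrite !normrM norm_scale; split; rewrite ger_pMr ?invr_gt0 ?exprn_gt0//.
Qed.

Section Cells.
Context {K : nat}.
Local Notation W := {ffun 'I_K -> 'I_4}.

Definition center (w : W) : R * R := descend (codom w) bary.

Lemma center_T2o (w : W) : T2o (center w).
Proof. exact/descend_T2o/bary_T2o. Qed.

Lemma codom_agree k (w y : W) : agree k w y -> take k (codom w) = take k (codom y).
Proof.
move=> /agreeP wy; rewrite !codomE -(map_take k w) -(map_take k y); apply/eq_in_map => i.
move=> /(nthP i)[n]; rewrite size_take size_enum_ord => nlt.
have [nk nK] : (n < k)%N /\ (n < K)%N by move: nlt; case: ifP; lia.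
by rewrite nth_take// => <-; apply: wy; rewrite nth_enum_ord.
Qed.

Lemma size_codomW (w : W) : size (codom w) = K.
Proof. by rewrite size_codom card_ord. Qed.

Lemma center_agree k (w y : W) : (k <= K)%N -> agree k w y ->
  `|(center w).1 - (center y).1| <= 2 ^- k /\
  `|(center w).2 - (center y).2| <= 2 ^- k.
Proof.
move=> kK /codom_agree wy; rewrite /center.
rewrite -(cat_take_drop k (codom w)) -(cat_take_drop k (codom y)) wy !descend_cat.
have := @descend_dist (take k (codom y)) _ _ (descend_T2 (drop k (codom w)) (T2oW bary_T2o))
  (descend_T2 (drop k (codom y)) (T2oW bary_T2o)).
by rewrite size_takel// size_codomW.
Qed.

Lemma codom_upd (k : 'I_K) (w : W) c :
  codom (upd w k c) = take k (codom w) ++ c :: drop k.+1 (codom w).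
Proof.
have -> : take k (codom w) = take k (codom (upd w k c)).
  apply: codom_agree; apply/agreeP => i ik; rewrite ffunE; case: eqP => // ik'.
  by rewrite ik' ltnn in ik.
have -> : drop k.+1 (codom w) = drop k.+1 (codom (upd w k c)).
  rewrite !codomE -(map_drop k.+1 w) -(map_drop k.+1 (upd w k c)); apply/eq_in_map => i.
  move=> /(nthP i)[n]; rewrite size_drop size_enum_ord => nK <-.
  rewrite ffunE nth_drop; case: eqP => // /(congr1 val).
  rewrite /= nth_enum_ord; lia.
have kE : nth c (codom (upd w k c)) k = c.
  rewrite codomE (nth_map k) ?size_enum_ord// nth_ord_enum ffunE eqxx//.
rewrite -{1}[codom (upd w k c)](cat_take_drop k); congr cat.
by rewrite (drop_nth c) ?kE// size_codomW.
Qed.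

Definition move_axis (i : 'I_2) p (t : R) : R * R :=
  if i == 0 then (p.1 + t, p.2) else (p.1, p.2 + t).

(* The digit selecting the child that is the translate of child 0 along axis i. *)
Definition axis_digit (i : 'I_2) : 'I_4 := lift ord0 (widen_ord (leqnSn 2) i).

Definition parent_scale (k : 'I_K) (w : W) : R := scale (take k (codom w)).

Lemma parent_scale_agree (k : 'I_K) (w y : W) : agree k w y ->
  parent_scale k w = parent_scale k y.
Proof. by rewrite /parent_scale => /codom_agree ->. Qed.

Lemma norm_parent_scale (k : 'I_K) (w : W) : `|parent_scale k w| = 2 ^- k.
Proof. by rewrite norm_scale size_takel// size_codomW ltnW. Qed.

(** In the frame of the parent the two siblings differ by 1/2 along axis i; the map of the parent
    multiplies this by its signed ratio. *)
Lemma center_upd (i : 'I_2) (k : 'I_K) (w : W) :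
  center (upd w k (axis_digit i)) =
  move_axis i (center (upd w k 0)) (parent_scale k w / 2).
Proof.
rewrite /center !codom_upd !descend_cat /= /parent_scale.
set v := take k _; set q := descend _ bary.
have [h1 h2] := descendB v (child (axis_digit i) q) (child 0 q).
rewrite [LHS]surjective_pairing /move_axis.
case: (eqVneq i 0) => i0; congr pair; apply/eqP; rewrite -subr_eq0.
- by rewrite opprD addrA h1 i0 /child/=; apply/eqP; field.
- by rewrite h2 i0 /child/= subrr mulr0.
- rewrite h1 /child /axis_digit; case: i i0 {h1 h2} => -[|[|//]] ? //= _.
  by rewrite subrr mulr0.
rewrite opprD addrA h2 /child /axis_digit; case: i i0 {h1 h2} => -[|[|//]] ? //= _.
by apply/eqP; field.
Qed.

End Cells.

End Geometry.

(** * Mean value estimates *)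

Section Partials.
Context {R : realType}.
Implicit Types (p q : R * R) (E : R * R -> R).

Definition pderiv (i : 'I_2) E E' := forall p, T2o p ->
  is_derive (0 : R) (1 : R) (fun t => E (move_axis i p t)) (E' p).

Lemma move_axisD i p t u : move_axis i (move_axis i p t) u = move_axis i p (t + u).
Proof. by rewrite /move_axis; case: eqP => _ /=; rewrite addrA. Qed.

Lemma move_axis0 i p : move_axis i p 0 = p.
Proof. by rewrite /move_axis !addr0; case: eqP => _; case: p. Qed.

Lemma T2o_move_axis i p h t : T2o p -> T2o (move_axis i p h) -> 0 <= t <= h ->
  T2o (move_axis i p t).
Proof.
case: p => x y; rewrite /move_axis; case: eqP => _ /and3P[/= ? ? ?] /and3P[/= ? ? ?] /andP[? ?];
  by apply/and3P; split => /=; lra.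
Qed.

Lemma is_derive_translate (f : R -> R) (a l : R) :
  is_derive (0 : R) (1 : R) (fun t => f (a + t)) l -> is_derive a (1 : R) f l.
Proof.
move=> df; have -> : f = (fun t => f (a + t)) \o (fun x => x - a).
  by apply/funext => x /=; rewrite subrKC.
rewrite -[l]mulr1; apply: is_derive1_comp; last first.
  by rewrite -[X in is_derive _ _ _ X]subr0; apply: is_deriveB.
by rewrite subrr.
Qed.

(** Both signs of h occur, since upside down parents give negative displacements. For h < 0 the
    nonnegative case is applied from the other endpoint. *)
Lemma MVT_axis i E E' p h : pderiv i E E' -> T2o p -> T2o (move_axis i p h) ->
  exists t, [/\ `|t| <= `|h|, T2o (move_axis i p t) &
    E (move_axis i p h) - E p = h * E' (move_axis i p t)].
Proof.
move=> dE.
suff H q l : 0 <= l -> T2o q -> T2o (move_axis i q l) ->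
    exists t, [/\ 0 <= t <= l, T2o (move_axis i q t) &
      E (move_axis i q l) - E q = l * E' (move_axis i q t)].
  move=> Tp Th; have [h0|h0] := leP 0 h.
    have [t [/andP[t0 th] Tt Et]] := H p h h0 Tp Th; exists t; split => //.
    by rewrite !ger0_norm.
  have Nh0 : 0 <= - h by rewrite oppr_ge0 ltW.
  have [|t [/andP[t0 th] Tt Et]] := H (move_axis i p h) (- h) Nh0 Th.
    by rewrite move_axisD subrr move_axis0.
  move: Tt Et; rewrite !move_axisD subrr move_axis0 => Tt Et; exists (h + t).
  split => //; last by rewrite -opprB Et mulNr opprK.
  by rewrite [`|h|]ltr0_norm// ler_norml; lra.
move=> l0 Tq Tl.
have df t : 0 <= t <= l -> 
    is_derive t (1 : R) (fun t => E (move_axis i q t)) (E' (move_axis i q t)).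
  move=> tl; apply: is_derive_translate; have := dE _ (T2o_move_axis Tq Tl tl).
  by under eq_fun do rewrite move_axisD.
have [||t tl] := @MVT_segment R
  (fun t => E (move_axis i q t)) (fun t => E' (move_axis i q t)) 0 l l0.
- by move=> t; rewrite in_itv/= => /andP[t0 tl]; apply: df; rewrite !ltW.
- apply: continuous_in_subspaceT => t /[!inE]/=; rewrite in_itv/= => /df dt.
  by apply/differentiable_continuous/derivable1_diffP; case: dt.
rewrite move_axis0 subr0 => Et; move: tl; rewrite in_itv/= => tl.
by exists t; split; rewrite ?Et 1?mulrC//; exact: T2o_move_axis tl.
Qed.

Lemma lipschitz_T2o E E0 E1 (M : R) p q :
  pderiv 0 E E0 -> pderiv 1 E E1 ->
  (forall r, T2o r -> `|E0 r| <= M) -> (forall r, T2o r -> `|E1 r| <= M) ->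
  T2o p -> T2o q -> `|E p - E q| <= M * (`|p.1 - q.1| + `|p.2 - q.2|).
Proof.
move=> dE0 dE1 M0 M1 Tp Tq.
have step i E' r h : pderiv i E E' -> (forall r, T2o r -> `|E' r| <= M) ->
    T2o r -> T2o (move_axis i r h) -> `|E (move_axis i r h) - E r| <= M * `|h|.
  move=> dE EM Tr Th; have [t [_ Tt ->]] := MVT_axis dE Tr Th.
  by rewrite normrM mulrC ler_wpM2r// EM.
(* The path turns at (p.1, q.2). With p.1 <= q.1 this corner satisfies p.1 + q.2 <= q.1 + q.2 < 1,
   whereas the opposite corner may leave the triangle. *)
wlog pq1 : p q Tp Tq / p.1 <= q.1 => [hw|].
  by have [|/ltW] := leP p.1 q.1 => /hw;
    [apply|rewrite distrC [`|p.1 - _|]distrC [`|p.2 - _|]distrC; apply].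
have Tr : T2o (p.1, q.2).
  by case: p q Tp Tq pq1 => ? ? [? ?] /and3P[/= ? ? ?] /and3P[/= ? ? ?] /= ?;
    apply/and3P; split => /=; lra.
have qE : q = move_axis 0 (p.1, q.2) (q.1 - p.1).
  by rewrite /move_axis/= subrKC; case: (q).
have rE : (p.1, q.2) = move_axis 1 p (q.2 - p.2) by rewrite /move_axis/= subrKC.
rewrite distrC -(subrK (E (p.1, q.2)) (E q)) -addrA.
apply: (le_trans (ler_normD _ _)); rewrite mulrDr; apply: lerD.
  by rewrite [`|p.1 - _|]distrC; have := step 0 E0 _ (q.1 - p.1) dE0 M0 Tr; rewrite -qE; exact.
rewrite [`|p.2 - _|]distrC.
have := step 1 E1 p (q.2 - p.2) dE1 M1 Tp; rewrite -rE; exact.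
Qed.

Lemma is_derive_avg (T : finType) (h : T -> R -> R) (dh : T -> R) (x : R) :
  (forall i, is_derive x (1 : R) (h i) (dh i)) ->
  is_derive x (1 : R) (fun t => avg (fun i => h i t)) (avg dh).
Proof.
move=> dhi; have -> : (fun t => avg (fun i => h i t)) = #|T|%:R^-1 \*: (\sum_i h i).
  by apply/funext => t; rewrite /avg/= fct_sumE.
apply: is_deriveZ.
by elim/big_ind2 : _ => // [|] *; [exact: is_derive_cst|exact: is_deriveD].
Qed.

Lemma is_deriveZr (f : R -> R) (c x l : R) : is_derive x (1 : R) f l ->
  is_derive x (1 : R) (fun t => c * f t) (c * l).
Proof. exact: is_deriveZ. Qed.

End Partials.

(** * Kernel integrals over several coordinates *)

Section Functionals.
Context {R : realType} {s : nat} {Y : finType}.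
Implicit Types (J : seq 'I_s) (x : 'I_s -> R * R) (y : {ffun 'I_s -> Y}).
Implicit Types (kp : 'I_s -> Y -> R) (g : ('I_s -> R * R) -> R).
Implicit Types (G : mindex s -> ('I_s -> R * R) -> R) (e : mindex s).
Variable pt : Y -> R * R.
Hypothesis pt_T2o : forall q, T2o (pt q).
Hypothesis Y0 : (0 < #|Y|)%N.

Let Ys0 : (0 < #|{: {ffun 'I_s -> Y}}|)%N.
Proof. by rewrite card_ffun expn_gt0 Y0. Qed.

Definition fupd x (j : 'I_s) (p : R * R) : 'I_s -> R * R :=
  fun j' => if j' == j then p else x j'.

Definition mix J y x : 'I_s -> R * R := fun j => if j \in J then pt (y j) else x j.

(** The coordinates outside J are frozen at x. This allows induction on J: what is already
    integrated is a function of the next coordinate that can be differentiated. *)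
Definition kernel_integral J kp g x : R :=
  avg (fun y => (\prod_(j <- J) kp j (y j)) * g (mix J y x)).

Definition mindex_adds (a : 'I_s -> 'I_2) J e : mindex s :=
  foldl (fun e j => mindex_add e j (a j)) e J.

Lemma fupd_T2o x j p : (forall j, T2o (x j)) -> T2o p -> forall j', T2o (fupd x j p j').
Proof. by move=> Tx Tp j'; rewrite /fupd; case: ifP. Qed.

Lemma mix_T2o J y x : (forall j, T2o (x j)) -> forall j, T2o (mix J y x j).
Proof. by move=> Tx j; rewrite /mix; case: ifP. Qed.

Lemma mix_fupd J y x j p : j \notin J -> mix J y (fupd x j p) = fupd (mix J y x) j p.
Proof.
move=> jJ; apply/funext => j'; rewrite /mix /fupd; case: eqP => [->|//].
by rewrite (negbTE jJ).
Qed.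

Lemma kernel_integral_nil kp g x : kernel_integral [::] kp g x = g x.
Proof.
rewrite /kernel_integral -[RHS](avg_cst (T := {ffun 'I_s -> Y}) _ Ys0); apply: eq_avg => y.
by rewrite big_nil mul1r; congr g; apply/funext.
Qed.

Lemma kernel_integral_cons j J kp g x : j \notin J -> kernel_integral (j :: J) kp g x =
  avg (fun q => kp j q * kernel_integral J kp g (fupd x j (pt q))).
Proof.
move=> jJ; rewrite /kernel_integral (avg_upd j); under [RHS]eq_avg do rewrite -avgZ.
rewrite [RHS]avg_avg; apply: eq_avg => y; apply: eq_avg => q.
rewrite big_cons ffunE eqxx -mulrA; congr (_ * (_ * _)).
  apply: eq_big_seq => j' j'J; rewrite ffunE; case: eqP => // e.
  by move: jJ; rewrite -e j'J.
congr g; rewrite mix_fupd//; apply/funext => j'; rewrite /mix /fupd inE ffunE.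
by case: eqP.
Qed.

Definition partials G := forall e j i, e j = None ->
  forall x, (forall j, T2o (x j)) ->
  pderiv i (fun q => G e (fupd x j q)) (fun q => G (mindex_add e j i) (fupd x j q)).

Lemma kernel_integral_pderiv G e j i J kp x : partials G -> e j = None -> j \notin J ->
  (forall j, T2o (x j)) ->
  pderiv i (fun q => kernel_integral J kp (G e) (fupd x j q))
           (fun q => kernel_integral J kp (G (mindex_add e j i)) (fupd x j q)).
Proof.
move=> pG ej jJ Tx p Tp; apply: is_derive_avg => y; apply: is_deriveZr.
under eq_fun do rewrite mix_fupd//.
by rewrite mix_fupd//; exact: (pG e j i ej _ (mix_T2o J y Tx)).
Qed.

(** A coordinate costs the L^1 norm of its kernel or, for a kernel of mean 0, its first absolute
    moment about a point [pt q0]: the value at that point is subtracted and the Lipschitz estimate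
    applied, with constants from the induction hypothesis for the index enlarged by j. *)
Lemma kernel_integral_le G (M : R) kp (b : 'I_s -> R) J e x :
  partials G -> (forall e x, (forall j, T2o (x j)) -> `|G e x| <= M) ->
  (forall j, avg (fun q => `|kp j q|) <= b j \/
     avg (kp j) = 0 /\ exists q0, avg (fun q => `|kp j q| *
       (`|(pt q).1 - (pt q0).1| + `|(pt q).2 - (pt q0).2|)) <= b j) ->
  uniq J -> (forall j, j \in J -> e j = None) -> (forall j, T2o (x j)) ->
  `|kernel_integral J kp (G e) x| <= M * \prod_(j <- J) b j.
Proof.
move=> pG GM Hb.
have b0 j : 0 <= b j.
  have [h|[_ [q0 h]]] := Hb j; apply: le_trans h; apply: avg_ge0 => q.
    exact: normr_ge0.
  by apply: mulr_ge0; [exact: normr_ge0|apply: addr_ge0].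
elim: J e x => [|j J IH] e x; first by rewrite kernel_integral_nil big_nil mulr1 => _ _ /GM.
move=> /= /andP[jJ uJ] eJ Tx; rewrite kernel_integral_cons// big_cons.
have eJ' j' : j' \in J -> e j' = None by move=> j'J; rewrite eJ// inE j'J orbT.
set E := fun p => kernel_integral J kp (G e) (fupd x j p).
rewrite mulrCA; set B := M * _.
have EB p : T2o p -> `|E p| <= B by move=> Tp; apply: IH => //; exact: fupd_T2o.
have [kb|[k0 [q0 kb]]] := Hb j.
  apply: (le_trans (ler_norm_avg _)).
  apply: (@le_trans _ _ (avg (fun q => `|kp j q| * B))).
    by apply: ler_avg => q; rewrite normrM ler_wpM2l//; apply: EB.
  rewrite avgZr ler_wpM2r//; case/card_gt0P: Y0 => q0 _.
  exact: le_trans (EB (pt q0) (pt_T2o q0)).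
have -> : avg (fun q => kp j q * kernel_integral J kp (G e) (fupd x j (pt q))) =
    avg (fun q => kp j q * (E (pt q) - E (pt q0))).
  by under [RHS]eq_avg do rewrite mulrBr; rewrite avgB avgZr k0 mul0r subr0.
apply: (le_trans (ler_norm_avg _)).
apply: (@le_trans _ _ (avg (fun q => `|kp j q| *
       (`|(pt q).1 - (pt q0).1| + `|(pt q).2 - (pt q0).2|) * B))); last first.
  rewrite avgZr ler_wpM2r//; exact: le_trans (EB (pt q0) (pt_T2o q0)).
apply: ler_avg => q; rewrite normrM -mulrA ler_wpM2l// mulrC.
have dE i := kernel_integral_pderiv i kp pG (eJ j (mem_head _ _)) jJ Tx.
apply: (@lipschitz_T2o R E _ _ B _ _ (dE 0) (dE 1)) => //.
- move=> r Tr; apply: IH => //; last exact: fupd_T2o.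
  move=> j' j'J; rewrite ffunE; case: eqP => [e'|_]; last exact: eJ'.
  by rewrite -e' j'J in jJ.
- move=> r Tr; apply: IH => //; last exact: fupd_T2o.
  move=> j' j'J; rewrite ffunE; case: eqP => [e'|_]; last exact: eJ'.
  by rewrite -e' j'J in jJ.
Qed.

(* The functional at coordinate j averages finite differences along the axis
   [a j], which the mean value theorem turns into averages of derivatives. *)
Lemma kernel_integral_diff_approx G (a : 'I_s -> 'I_2) kp (c : 'I_s -> R) (eta : R)
    (close : 'I_s -> rel (R * R)) J e x :
  partials G -> (forall j, 0 <= c j) -> 0 <= eta ->
  (forall j E E', pderiv (a j) E E' ->
     exists xi : Y -> R * R, [/\ forall q, T2o (xi q),
       forall q, close j (xi q) (pt q) &
       avg (fun q => kp j q * E (pt q)) = c j * avg (fun q => E' (xi q))]) ->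
  (forall e j x p q, (forall j, T2o (x j)) -> T2o p -> T2o q -> close j p q ->
     `|G e (fupd x j p) - G e (fupd x j q)| <= eta) ->
  uniq J -> (forall j, j \in J -> e j = None) -> (forall j, T2o (x j)) ->
  `|kernel_integral J kp (G e) x -
      (\prod_(j <- J) c j) * kernel_integral J (fun _ _ => 1) (G (mindex_adds a J e)) x|
  <= (\prod_(j <- J) c j) * ((size J)%:R * eta).
Proof.
move=> pG c0 eta0 Hk Gclose.
elim: J e x => [|j J IH] e x.
  by rewrite !kernel_integral_nil big_nil mul1r subrr normr0 mul0r mulr0.
move=> /= /andP[jJ uJ] eJ Tx.
set e' := mindex_add e j (a j).
have e'J j' : j' \in J -> e' j' = None.
  move=> j'J; rewrite ffunE; case: eqP => [e1|_]; last by rewrite eJ// inE j'J orbT.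
  by rewrite -e1 j'J in jJ.
have ej : e j = None by rewrite eJ ?mem_head.
have [xi [Txi xiclose xiE]] := Hk j _ _ (kernel_integral_pderiv (a j) kp pG ej jJ Tx).
rewrite !kernel_integral_cons// {}xiE big_cons; set C := \prod_(j <- J) _.
have C0 : 0 <= C by exact: prodr_ge0.
set G' := G (mindex_adds a J e').
rewrite -mulrA -mulrBr normrM ger0_norm// -[leRHS]mulrA ler_wpM2l// -avgZ -avgB.
apply: (le_trans (ler_norm_avg _)).
rewrite -[leRHS](avg_cst (T := Y) _ Y0); apply: ler_avg => q.
(* Two errors: the induction hypothesis at the intermediate point xi, and moving xi to the grid
   point, which costs eta. *)
rewrite mul1r -[X in `|X|](subrKA (C * kernel_integral J (fun _ _ => 1) G' (fupd x j (xi q)))).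
apply: (le_trans (ler_normD _ _)).
rewrite -[(size J).+1]addn1 natrD mulrDl mul1r mulrDr; apply: lerD.
  by apply: IH => //; exact: fupd_T2o.
rewrite -mulrBr normrM ger0_norm// ler_wpM2l// /kernel_integral -avgB.
apply: (le_trans (ler_norm_avg _)).
rewrite -[leRHS](avg_cst (T := {ffun 'I_s -> Y}) _ Ys0); apply: ler_avg => y.
by rewrite big1// !mul1r !mix_fupd//; apply: Gclose => //; exact: mix_T2o.
Qed.

End Functionals.

(** * Size of the components *)

Section TestFunctions.
Context {R : realType} {K : nat}.
Local Notation W := {ffun 'I_K -> 'I_4}.
Implicit Types (q w y : W) (k : 'I_K) (i : 'I_2).

(* A signed difference of the indicators of two sibling cells, translates of
   each other along axis i; the sign compensates for upside down parents. *)
Definition sibling_test i k q : R :=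
  Num.sg (parent_scale k q) * ((q k == axis_digit i)%:R - (q k == 0)%:R).

Lemma agree_upd k w c : agree k w (upd w k c).
Proof.
apply/agreeP => j jk; rewrite ffunE; case: eqP => // e.
by rewrite e ltnn in jk.
Qed.

Lemma sibling_test_agree i k q w : agree k.+1 q w -> sibling_test i k q = sibling_test i k w.
Proof.
rewrite agreeS => /andP[/parent_scale_agree qw /eqP qk].
by rewrite /sibling_test qw qk.
Qed.

Lemma sibling_test_upd i k q c : sibling_test i k (upd q k c) =
  Num.sg (parent_scale k q) * ((c == axis_digit i)%:R - (c == 0)%:R).
Proof.
rewrite /sibling_test -(parent_scale_agree (agree_upd k q c)) ffunE.
by case: (k =P k).
Qed.

Lemma sum_sibling_test_upd i k q (v : 'I_4 -> R) :
  \sum_c sibling_test i k (upd q k c) * v c =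
  Num.sg (parent_scale k q) * (v (axis_digit i) - v 0).
Proof.
under eq_bigr do rewrite sibling_test_upd -mulrA mulrBl.
have pick (d : 'I_4) : \sum_c (c == d)%:R * v c = v d.
  rewrite (bigD1 d) ?eqxx//= mul1r big1 ?addr0// => c /negbTE ->.
  by rewrite mul0r.
by rewrite -mulr_sumr sumrB !pick.
Qed.

Lemma norm_sibling_test_le1 i k q : `|sibling_test i k q| <= 1.
Proof.
rewrite /sibling_test normrM normr_sg.
case: (parent_scale k q == 0); rewrite ?mul0r ?ler01 ?mul1r//=.
case: (q k == _); case: (q k == _); rewrite ?subrr ?subr0 ?sub0r ?normrN ?normr0 ?normr1 ?ler01//.
Qed.

(** The test function is itself a martingale difference of level k + 1: it depends on the first k +
    1 digits and sums to 0 over siblings. The projection therefore fixes it. *)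
Lemma avg_sibling_test_kernel i k y :
  avg (fun w => level_kernel k.+1 w y * sibling_test i k w) = sibling_test i k y.
Proof.
rewrite /level_kernel; under eq_avg do rewrite mulrBl.
rewrite avgB [X in _ - X](_ : _ = 0) ?subr0.
  transitivity (avg (fun w => cell_kernel k.+1 y w * sibling_test i k y)).
    apply: eq_avg => w; rewrite cell_kernelC /cell_kernel.
    have [/sibling_test_agree ->//|_] := boolP (agree _ _ _).
    by rewrite mulr0 !mul0r.
  by rewrite avgZr avg_cell_kernel// mul1r.
rewrite (avg_upd k) -[RHS](avg_cst (T := W) _ (card_W_gt0)); apply: eq_avg => w.
transitivity (avg (fun c : 'I_4 => sibling_test i k (upd w k c) * cell_kernel k w y)).
  apply: eq_avg => c; rewrite mulrC /cell_kernel; congr (_ * (_ * _%:R)).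
  by rewrite (agree_trans _ (agree_upd k w c)).
by rewrite /avg sum_sibling_test_upd subrr !mulr0.
Qed.

(** 2^-(k + 3) is 1/4, from averaging over digit k, times 2^-k / 2, the distance between the
    siblings; the sign in the test function makes it positive. The intermediate point is within 2^-k
    of the centre with digit k set to 0, itself within 2^-k of the centre of q. *)
Lemma avg_sibling_test_deriv i k (E E' : R * R -> R) : pderiv i E E' ->
  exists xi : W -> R * R, [/\ forall q, T2o (xi q),
    forall q, (`|(xi q).1 - (center q).1| <= 2 / 2 ^+ k) &&
      (`|(xi q).2 - (center q).2| <= 2 / 2 ^+ k) &
    avg (fun q => sibling_test i k q * E (center q)) = 2 ^- (k + 3) * avg (fun q => E' (xi q))].
Proof.
move=> dE.
have /choice[t tE] q : exists t, [/\ `|t| <= `|parent_scale k q / 2|,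
    T2o (move_axis i (center (upd q k 0)) t) &
    E (center (upd q k (axis_digit i))) - E (center (upd q k 0)) =
    parent_scale k q / 2 * E' (move_axis i (center (upd q k 0)) t)].
  rewrite center_upd; apply: (MVT_axis dE); first exact: center_T2o.
  by rewrite -center_upd; exact: center_T2o.
exists (fun q => move_axis i (center (upd q k 0)) (t q)); split.
- by move=> q; case: (tE q).
- move=> q; have [tq _ _] := tE q.
  have tk : `|t q| <= 2 ^- k.
    apply: (le_trans tq); rewrite normrM norm_parent_scale ger0_norm//.
    by rewrite ger_pMr ?invr_gt0 ?exprn_gt0//; lra.
  have kK : (k <= K)%N by exact: ltnW.
  have [h1 h2] := @center_agree R _ k _ _ kK (agree_upd k q 0).
  rewrite mulr_natl mulr2n /move_axis; case: ifP => _ /=;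
    move: tk h1 h2; rewrite !ler_norml => /andP[? ?] /andP[? ?] /andP[? ?];
    have : 0 <= 2 ^- k :> R by rewrite invr_ge0 exprn_ge0.
    by move=> ?; apply/andP; split; apply/andP; split; lra.
  by move=> ?; apply/andP; split; apply/andP; split; lra.
rewrite (avg_upd k) -avgZ; apply: eq_avg => q.
rewrite /avg card_ord (sum_sibling_test_upd i k q (fun c => E (center (upd q k c)))).
have [_ _ ->] := tE q.
rewrite !mulrA -[_ * Num.sg _ * _]mulrA -normrEsg norm_parent_scale.
by rewrite exprD; field; rewrite expf_neq0.
Qed.

End TestFunctions.

(** * Upper and lower bounds for components *)

Section ComponentBounds.
Context {R : realType} {s K : nat}.
Local Notation W := {ffun 'I_K -> 'I_4}.
Local Notation Ws := {ffun 'I_s -> W}.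
Variable G : mindex s -> ('I_s -> R * R) -> R.
Hypothesis pG : partials G.
Implicit Type l : {ffun 'I_s -> 'I_K.+1}.

Let e0 : mindex s := [ffun=> None].

Definition at_centers (g : ('I_s -> R * R) -> R) (y : Ws) : R :=
  g (fun j => center (y j)).

Let x0 : 'I_s -> R * R := fun=> bary.
Let x0_T2o j : T2o (x0 j). Proof. exact: bary_T2o. Qed.

Lemma kernel_integral_index_enum kp g :
  kernel_integral (@center R K) (index_enum 'I_s) kp g x0 =
  avg (fun y : Ws => (\prod_j kp j (y j)) * at_centers g y).
Proof.
apply: eq_avg => y; congr (_ * g _); apply/funext => j.
by rewrite /mix mem_index_enum.
Qed.

(** Coordinate j contributes 8 * 2^-l_j. For l_j = k + 1 the kernel has L^1 norm at most 2 and lives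
    in a cell of level k, where the distances along both axes add up to at most 2 * 2^-k. For l_j =
    0 the kernel is 1. *)
Lemma component_le (M : R) l w :
  (forall e x, (forall j, T2o (x j)) -> `|G e x| <= M) ->
  `|component l (at_centers (G e0)) w| <= M * (8 ^+ s * 2 ^- \sum_j l j).
Proof.
move=> GM; rewrite /component.
rewrite -(kernel_integral_index_enum (fun j q => level_kernel (l j) (w j) q) (G e0)).
have := @kernel_integral_le R s W (@center R K) (@center_T2o R K) card_W_gt0 G M
  (fun j q => level_kernel (l j) (w j) q) (fun j => 8 * 2 ^- l j) (index_enum 'I_s) e0 x0 pG GM.
rewrite big_split/= prodr_const card_ord prodfV -expr_sum; apply => //.
- move=> j; have := ltn_ord (l j); case: (nat_of_ord (l j)) => [_|k kK].
    left; under eq_avg do rewrite level_kernel0 normr1.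
    by rewrite avg_cst ?card_W_gt0// expr0 invr1 mulr1 ler1n.
  right; split; first exact: avg_level_kernel.
  exists (w j); apply: (@le_trans _ _ (avg (fun q => `|level_kernel k.+1 (w j) q| * (2 * 2 ^- k)))).
    apply: ler_avg => q; have [->|/level_kernel_supp wq] := eqVneq (level_kernel (R := R) k.+1 (w j) q) 0.
      by rewrite normr0 !mul0r.
    rewrite ler_wpM2l//; rewrite agree_sym in wq.
    have kK' : (k <= K)%N by rewrite ltnW.
    have [h1 h2] := @center_agree R _ _ _ _ kK' wq.
    by rewrite mulr_natl mulr2n lerD.
  rewrite avgZr; have kk : 2 ^- k.+1 = 2 ^- k / 2 :> R.
    by rewrite exprS invfM mulrC.
  have k0 : 0 <= 2 ^- k :> R by rewrite invr_ge0 exprn_ge0.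
  apply: (@le_trans _ _ (2 * (2 * 2 ^- k))).
    by rewrite ler_wpM2r ?avg_norm_level_kernel// mulr_ge0.
  by rewrite kk; lra.
- exact: index_enum_uniq.
- by move=> j _; rewrite ffunE.
Qed.

(** Half of the lower bound 2 * delta on the discrete mean of the derivative is given up to the
    error s * eta. The exponent l_j + 2 is the k + 3 of the finite differences, with k = l_j - 1. *)
Lemma component_sqr_ge (a : 'I_s -> 'I_2) (l : {ffun 'I_s -> 'I_K.+1}) (eta delta r : R) :
  (forall j, 0 < l j)%N -> 0 <= eta -> s%:R * eta <= delta ->
  (forall j, 4 / 2 ^+ l j <= r) ->
  (forall e j x p q, (forall j, T2o (x j)) -> T2o p -> T2o q ->
     `|p.1 - q.1| <= r -> `|p.2 - q.2| <= r ->
     `|G e (fupd x j p) - G e (fupd x j q)| <= eta) ->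
  2 * delta <= `|avg (at_centers (G [ffun j => Some (a j)]))| ->
  (delta * 2 ^- (\sum_(j < s) (l j + 2))) ^+ 2 <=
  avg (fun w => component l (at_centers (G e0)) w ^+ 2).
Proof.
move=> l0 eta0 se lr Gr dA.
have lK j : ((l j).-1 < K)%N by rewrite prednK// -ltnS.
pose k j := Ordinal (lK j).
have lk j : l j = (k j).+1 :> nat by rewrite /= prednK.
set F := at_centers (G e0).
pose Psi (w : Ws) : R := \prod_j sibling_test (a j) (k j) (w j).
have d0 : 0 <= delta by apply: le_trans se; rewrite mulr_ge0.
(* The projection onto level l is moved from F to Psi, which it fixes. *)
have reproduce : avg (fun w => component l F w * Psi w) = avg (fun y => Psi y * F y).
  transitivity (avg (fun y : Ws => avg (fun w : Ws =>
      (\prod_j (level_kernel (l j) (w j) (y j) * sibling_test (a j) (k j) (w j))) * F y))).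
    rewrite avg_avg; apply: eq_avg => w; rewrite /component -avgZr.
    by apply: eq_avg => y; rewrite big_split/= mulrAC.
  apply: eq_avg => y; rewrite avgZr; congr (_ * _).
  rewrite (avg_prod (fun j w => level_kernel (l j) w (y j) * sibling_test (a j) (k j) w)).
  by apply: eq_bigr => j _; rewrite lk avg_sibling_test_kernel.
have Psi1 : avg (fun w => Psi w ^+ 2) <= 1.
  rewrite -[leRHS](avg_cst (T := Ws) _ card_Ws_gt0); apply: ler_avg => w.
  rewrite -real_normK ?num_real// exprn_ile1// normr_prod prodr_ile1// => j _.
  by rewrite normr_ge0 norm_sibling_test_le1.
set C := 2 ^- (\sum_(j < s) (l j + 2)).
have C0 : 0 <= C by rewrite invr_ge0 exprn_ge0.
suff H : delta * C <= `|avg (fun w => component l F w * Psi w)|.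
  have := avg_sqr_le (component l F) Psi; rewrite -[_ ^+ 2]real_normK ?num_real// => CS.
  have : (delta * C) ^+ 2 <= `|avg (fun w => component l F w * Psi w)| ^+ 2.
    by rewrite ler_sqr ?nnegrE// mulr_ge0.
  move=> /le_trans/(_ CS)/le_trans; apply; rewrite ler_piMr//.
  by apply: avg_ge0 => w; exact: sqr_ge0.
rewrite reproduce -(kernel_integral_index_enum (fun j => sibling_test (a j) (k j)) (G e0)).
pose c j : R := 2 ^- (k j + 3).
have CE : C = \prod_j c j.
  rewrite /C prodfV -expr_sum; congr (_ ^- _); apply: eq_bigr => j _.
  by rewrite lk addSnnS.
have kr j : 2 / 2 ^+ k j <= r.
  apply: le_trans (lr j); rewrite lk exprS invfM mulrA; apply: ler_wpM2r.
    by rewrite invr_ge0 exprn_ge0.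
  by lra.
have := @kernel_integral_diff_approx R s W (@center R K) (@center_T2o R K) card_W_gt0 G a
  (fun j => sibling_test (a j) (k j)) c eta
  (fun j p q => (`|p.1 - q.1| <= 2 / 2 ^+ k j) && (`|p.2 - q.2| <= 2 / 2 ^+ k j))
  (index_enum 'I_s) e0 x0 pG.
have -> : mindex_adds a (index_enum 'I_s) e0 = [ffun j => Some (a j)].
  suff H J (e : mindex s) j :
      mindex_adds a J e j = if j \in J then Some (a j) else e j.
    by apply/ffunP => j; rewrite H mem_index_enum ffunE.
  elim: J e => //= j' J IH e; rewrite IH inE ffunE.
  by case: eqP => [->|//]; case: ifP.
rewrite [X in _ * X]kernel_integral_index_enum -CE.
rewrite [X in _ * X](_ : _ = avg (at_centers (G [ffun j => Some (a j)]))); last first.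
  by apply: eq_avg => y; rewrite big1// mul1r.
set A := avg _ in dA *; set X := kernel_integral _ _ _ _ _.
rewrite [size _](_ : _ = s); last first.
  by rewrite -[RHS]card_ord -sum1_card -sum1_size.
move=> H; have {}H : `|X - C * A| <= C * (s%:R * eta).
  apply: H => //.
  - by move=> j; rewrite invr_ge0 exprn_ge0.
  - by move=> j E E'; exact: avg_sibling_test_deriv.
  - move=> e j x p q Tx Tp Tq /andP[h1 h2].
    by apply: Gr => //; [exact: le_trans h1 _|exact: le_trans h2 _].
  - exact: index_enum_uniq.
  - by move=> j _; rewrite ffunE.
have CA : C * (2 * delta) <= `|C * A| by rewrite normrM ger0_norm// ler_wpM2l.
have XA : C * (s%:R * eta) <= C * delta by rewrite ler_wpM2l.
have := lerB_dist (C * A) X; rewrite [`|C * A - X|]distrC => tri.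
rewrite mulrC; nra.
Qed.

End ComponentBounds.

(** * Summation over the levels *)

Section Counting.
Context {R : realType}.

Lemma exprV4 k : 4 ^- k = (2 ^- k) ^+ 2 :> R.
Proof.
rewrite exprVn -exprM mulnC exprM; congr (_ ^- _).
by rewrite expr2 -natrM.
Qed.

Lemma sum_geom_from (a n : nat) :
  \sum_(q < n) (if (a <= q)%N then 4 ^- (q - a) else 0) <= 2 :> R.
Proof.
have p0 k : 0 < 4 ^- k :> R by rewrite invr_gt0 exprn_gt0.
(* The subtracted term is what makes the bound inductive. *)
suff H : \sum_(q < n) (if (a <= q)%N then 4 ^- (q - a) else 0) <= 2 - 2 * 4 ^- (n - a) :> R.
  by apply: (le_trans H); rewrite gerBl mulr_ge0// ltW.
elim: n => [|n IH]; first by rewrite big_ord0 sub0n expr0 invr1; lra.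
rewrite big_ord_recr/=; case: leqP => an.
  by rewrite subSn// exprS invfM; have := p0 (n - a)%N; lra.
by move: IH; rewrite addr0 (_ : n.+1 - a = n - a)%N//; lia.
Qed.

(** Subtraction is truncated: each l <= m contributes 1, and the remaining terms form a geometric
    series. *)
Lemma sum_geom_above (m n : nat) : \sum_(l < n) 4 ^- (l - m) <= m%:R + 2 :> R.
Proof.
have p0 k : 0 < 4 ^- k :> R by rewrite invr_gt0 exprn_gt0.
suff H : \sum_(l < n) 4 ^- (l - m) <= (minn n m)%:R + 2 - 2 * 4 ^- (n - m) :> R.
  apply: (le_trans H); have := p0 (n - m)%N.
  have : (minn n m)%:R <= m%:R :> R by rewrite ler_nat geq_minr.
  by lra.
elim: n => [|n IH]; first by rewrite big_ord0 sub0n min0n expr0 invr1; lra.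
rewrite big_ord_recr/=; have := p0 (n - m)%N; case: (leqP m n) => mn.
  move: IH; rewrite subSn// exprS invfM !(minn_idPr _)//; last exact: leqW.
  by lra.
move: IH; have /eqP -> : (n - m == 0)%N by rewrite subn_eq0 ltnW.
have /eqP -> : (n.+1 - m == 0)%N by rewrite subn_eq0.
rewrite !(minn_idPl _)//; last exact: ltnW.
by rewrite expr0 invr1 -[n.+1]addn1 natrD; lra.
Qed.

Lemma excess_le (I : finType) (P : pred I) (l : I -> nat) m :
  (\sum_(i | P i) (l i - m) <= \sum_(i | P i) l i - m)%N.
Proof.
have [/existsP[j /andP[Pj jm]]|] := boolP [exists j, P j && (m <= l j)%N].
  rewrite (bigD1 j)//= [X in (_ <= X - _)%N](bigD1 j)//= -addnBAC// leq_add2l.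
  by apply: leq_sum => i _; exact: leq_subr.
rewrite negb_exists => /forallP h; rewrite big1// => i Pi.
by apply/eqP; rewrite subn_eq0 ltnW// ltnNge; have := h i; rewrite Pi.
Qed.

(** Fix all levels but the first, with sum t. Summing over a first level of at least m - t gives a
    geometric series, bounded by 2 * 4^-m * 4^-(t - m) with truncated subtraction. By [excess_le]
    the last factor splits over the s other coordinates, each of which sums to at most m + 2. The
    bound is free of K. *)
Lemma sum_large_levels (s K m : nat) :
  \sum_(l : {ffun 'I_s.+1 -> 'I_K.+1} | (m <= \sum_j l j)%N) 4 ^- (\sum_j l j)
  <= 2 * (m%:R + 2) ^+ s / 4 ^+ m :> R.
Proof.
pose Phi (l : {ffun 'I_s.+1 -> 'I_K.+1}) : R :=
  if (m <= \sum_j l j)%N then 4 ^- (\sum_j l j) else 0.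
have p0 k : 0 <= 4 ^- k :> R by rewrite invr_ge0 exprn_ge0.
pose h (j : 'I_s.+1) (q : 'I_K.+1) : R := if j == ord0 then 1 else 4 ^- (q - m).
have key (l : {ffun 'I_s.+1 -> 'I_K.+1}) : avg (fun q => Phi (upd l ord0 q)) <=
    K.+1%:R^-1 * (2 / 4 ^+ m) * \prod_j h j (l j).
  rewrite /avg card_ord -mulrA ler_wpM2l ?invr_ge0//.
  pose t := (\sum_(j | j != ord0) l j)%N.
  have updE q : (\sum_j upd l ord0 q j = q + t)%N.
    rewrite (bigD1 ord0)//= ffunE eqxx; congr (_ + _)%N.
    by apply: eq_bigr => j /negbTE j0; rewrite ffunE j0.
  have prodE : \prod_j h j (l j) = \prod_(j | j != ord0) 4 ^- (l j - m).
    rewrite (bigD1 ord0)//= /h eqxx mul1r.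
    by apply: eq_bigr => j /negbTE ->.
  apply: (@le_trans _ _ (\sum_(q < K.+1) (if (m - t <= q)%N then 4 ^- (q - (m - t)) else 0) *
      (4 ^- m * \prod_j h j (l j)))).
    apply: ler_sum => q _; rewrite /Phi updE.
    have -> : (m <= q + t)%N = (m - t <= q)%N by rewrite leq_subLR addnC.
    case: ifPn => mq; last by rewrite mul0r.
    have -> : (q + t = (q - (m - t)) + m + (t - m))%N by lia.
    rewrite !exprD !invfM -mulrA ler_wpM2l// ler_wpM2l// prodE prodfV -expr_sum.
    rewrite lef_pV2 ?posrE ?exprn_gt0// ler_eXn2l// ?ltr1n//.
    exact: excess_le.
  rewrite -mulr_suml -[leRHS]mulrA; apply: ler_pM => //.
  - by apply: sumr_ge0 => q _; case: ifP.
  - by apply: mulr_ge0 => //; apply: prodr_ge0 => j _; rewrite /h; case: ifP.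
  - exact: sum_geom_from.
rewrite big_mkcond/= -/(Phi _).
(* Written as an average, the sum obeys the coordinatewise and product rules for [avg]; the powers
   of K + 1 cancel in the end. *)
have -> : \sum_l Phi l = K.+1%:R ^+ s.+1 * avg Phi.
  by rewrite /avg card_ffun !card_ord natrX mulVKf// expf_neq0// pnatr_eq0.
rewrite (avg_upd ord0).
apply: (@le_trans _ _ (K.+1%:R ^+ s.+1 * avg (fun l : {ffun 'I_s.+1 -> 'I_K.+1} =>
   K.+1%:R^-1 * (2 / 4 ^+ m) * \prod_j h j (l j)))).
  by rewrite ler_wpM2l ?exprn_ge0//; exact: ler_avg.
rewrite avgZ avg_prod big_ord_recl {1}/h eqxx avg_cst ?card_ord// mul1r.
apply: (@le_trans _ _ (K.+1%:R ^+ s.+1 * (K.+1%:R^-1 * (2 / 4 ^+ m) *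
   \prod_(j < s) (K.+1%:R^-1 * (m%:R + 2))))).
  rewrite ler_wpM2l ?exprn_ge0// ler_wpM2l//.
  apply: ler_prod => j _; apply/andP; split.
    by apply: avg_ge0 => q; exact: p0.
  by rewrite /avg card_ord ler_wpM2l ?invr_ge0//; exact: sum_geom_above.
rewrite prodr_const card_ord exprMn exprS exprVn.
have K0 : K.+1%:R != 0 :> R by rewrite pnatr_eq0.
have Ks0 : K.+1%:R ^+ s != 0 :> R by rewrite expf_neq0.
rewrite le_eqVlt; apply/orP; left; apply/eqP; field.
by rewrite expf_neq0//=; apply/andP; split.
Qed.

(** With q the quotient of m by 2 (s + 1), s of the numbers l_j - 1 are chosen freely in [kappa,
    kappa + q) and the first coordinate absorbs the rest. As kappa and q are at most m / (2 (s +
    1)), that rest is still at least kappa. *)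
Lemma card_balanced_levels (s K m kappa : nat) : (m < K)%N ->
  (2 * s.+1 * kappa <= m)%N ->
  ((m %/ (2 * s.+1)) ^ s <=
   #|[pred l : {ffun 'I_s.+1 -> 'I_K.+1} |
     [forall j, kappa < l j] && (\sum_j (l j).-1 == m)]|)%N.
Proof.
move=> mK mk; set q := (m %/ _)%N.
have qm : (2 * s.+1 * q <= m)%N by rewrite mulnC leq_trunc_div.
have small (v : {ffun 'I_s -> 'I_q}) : (\sum_j (kappa + v j) + kappa <= m)%N.
  have : (\sum_j (kappa + v j) <= s * (kappa + q))%N.
    rewrite -[X in (_ <= X * _)%N](card_ord s) -sum_nat_const; apply: leq_sum => j _.
    by rewrite leq_add2l ltnW.
  by move: mk qm; lia.
pose fill (v : {ffun 'I_s -> 'I_q}) (j : 'I_s.+1) : nat :=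
  if unlift ord0 j is Some j' then (kappa + v j').+1
  else (m - \sum_j' (kappa + v j')).+1.
have fillK v j : (fill v j < K.+1)%N.
  rewrite ltnS /fill; case: unliftP => [j' _|_]; last by lia.
  have := small v; rewrite (bigD1 j')//=; lia.
pose f v : {ffun 'I_s.+1 -> 'I_K.+1} := [ffun j => Ordinal (fillK v j)].
have f_inj : injective f.
  move=> v v' /ffunP vv'; apply/ffunP => j; apply/val_inj.
  have := congr1 val (vv' (lift ord0 j)); rewrite !ffunE /= /fill liftK => -[].
  by move/eqP; rewrite eqn_add2l => /eqP.
have -> : (q ^ s = #|{: {ffun 'I_s -> 'I_q}}|)%N by rewrite card_ffun !card_ord.
rewrite -(card_codom f_inj); apply/subset_leq_card/fintype.subsetP => l /codomP[v ->].
rewrite inE; apply/andP; split.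
  apply/forallP => j; rewrite ffunE /= /fill; case: unliftP => [j' _|_].
    by rewrite ltnS leq_addr.
  by have := small v; lia.
rewrite big_ord_recl ffunE /= {1}/fill unlift_none /=.
rewrite [X in (_ + X)%N](eq_bigr (fun j => kappa + v j)%N); last first.
  by move=> j _; rewrite ffunE /= /fill liftK.
by rewrite subnK// (leq_trans _ (small v))// leq_addr.
Qed.

End Counting.

(** * Variance bounds uniform in the truncation level *)

Section FiniteVariance.
Context {R : realType} {s : nat}.
Variable G : mindex s.+1 -> ('I_s.+1 -> R * R) -> R.
Hypothesis pG : partials G.
Variable M : R.
Hypothesis GM : forall e x, (forall j, T2o (x j)) -> `|G e x| <= M.
Hypothesis Gcont : forall eta : R, 0 < eta -> exists2 r : R, 0 < r &
  forall e j x p q, (forall j, T2o (x j)) -> T2o p -> T2o q ->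
    `|p.1 - q.1| <= r -> `|p.2 - q.2| <= r ->
    `|G e (fupd x j p) - G e (fupd x j q)| <= eta.
Variables (a : 'I_s.+1 -> 'I_2) (delta : R) (K1 : nat).
Hypothesis delta0 : 0 < delta.
Hypothesis G_avg : forall K, (K1 <= K)%N ->
  2 * delta <= `|avg (at_centers (K := K) (G [ffun j => Some (a j)]))|.

(** The quantification over point sets, digits and nodes comes after c and C, so the same constants
    serve every net. *)
Definition scramble_bounds (c C : R) (m K : nat) :=
  forall (I N : finType) (alpha : I -> {ffun 'I_s.+1 -> {ffun 'I_K -> 'I_4}})
    (node : I -> 'I_s.+1 -> 'I_K -> N),
  (forall i j k i' j' k', node i j k = node i' j' k' ->
    [/\ j = j', k = k' & agree k (alpha i j) (alpha i' j)]) ->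
  (forall i i' j (k : 'I_K),
    agree k (alpha i j) (alpha i' j) -> node i j k = node i' j k) ->
  #|I| = (4 ^ m)%N ->
  (forall k : 'I_s.+1 -> nat, (forall j, (k j <= K)%N) ->
    (\sum_j k j = m)%N -> forall i i',
    (forall j, agree (k j) (alpha i j) (alpha i' j)) -> i = i') ->
  let F := at_centers (G [ffun=> None]) in
  c * (m%:R ^+ s / 4 ^+ (2 * m)) <=
    avg (fun sigma => estim alpha node F sigma ^+ 2) - avg F ^+ 2 <=
  C * (m%:R ^+ s / 4 ^+ (2 * m)).

Lemma finite_variance : exists c C : R, [/\ 0 < c, 0 < C &
  exists m0, forall m, (m0 <= m)%N -> exists K0, forall K, (K0 <= K)%N ->
    scramble_bounds c C m K].
Proof.
have p0 (b : R) k : 0 < b -> 0 < b ^- k by move=> b0; rewrite invr_gt0 exprn_gt0.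
have M0 : 0 <= M := le_trans (normr_ge0 _) (GM [ffun=> None] (x := fun=> bary) (fun=> bary_T2o)).
pose eta := delta / s.+1%:R.
have eta0 : 0 < eta by rewrite divr_gt0.
have [r r0 Gr] := Gcont eta0.
(* Beyond level kappa the cells are small enough for the modulus of continuity r. *)
have [kappa kr] : exists kappa : nat, forall l, (kappa < l)%N -> 4 / 2 ^+ l <= r.
  have r4 : 0 <= 4 / r by rewrite divr_ge0// ltW.
  exists (Num.bound (4 / r)) => l lb; rewrite ler_pdivrMr ?exprn_gt0//.
  rewrite mulrC -ler_pdivrMr// (le_trans (ltW (archi_boundP r4)))//.
  rewrite -natrX ler_nat (leq_trans (ltnW lb))//.
  exact: ltnW (ltn_expl _ _).
(* The squared bound on one component, where the l_j + 2 add up to m + 3 (s + 1), times a number of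
   levels of at least (m / (4 (s + 1)))^s; the factors depending on m are left out. *)
pose c := (delta * 2 ^- (3 * s.+1)) ^+ 2 / (4 * s.+1%:R) ^+ s.
(* The factor 2^s comes from m + 2 <= 2 m, and the summand 1 keeps C positive when M = 0. *)
pose C := 4 ^+ s.+1 * (M * 8 ^+ s.+1) ^+ 2 * (2 * 2 ^+ s) + 1.
exists c, C; split.
- by rewrite /c divr_gt0 ?exprn_gt0 ?mulr_gt0// p0.
- by rewrite /C ltr_wpDl// !mulr_ge0 ?exprn_ge0// sqr_ge0.
(* The summands ensure the count of balanced levels, a quotient of m by 2 (s + 1) of at least 1, and
   m + 2 <= 2 m. *)
exists (2 * s.+1 * kappa + 2 * s.+1 + 2)%N => m m0.
exists (maxn K1 m.+1) => K; rewrite geq_max => /andP[K1K mK].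
move=> I N alpha node node_inj node_agree cardI net; set F := at_centers _ => /=.
have I0 : (0 < #|I|)%N by rewrite cardI expn_gt0.
rewrite (variance_estim node_inj)//.
have mKW : (m <= K)%N by exact: ltnW.
have m4 : 4 ^- (2 * m) = 4 ^- m * 4 ^- m :> R by rewrite mul2n -addnn exprD invfM.
apply/andP; split; last first.
  pose B := 4 ^+ s.+1 * (M * 8 ^+ s.+1) ^+ 2 / 4 ^+ m : R.
  have B0 : 0 <= B.
    by rewrite /B !mulr_ge0 ?exprn_ge0 ?sqr_ge0// invr_ge0 exprn_ge0.
  apply: (@le_trans _ _ (\sum_(l : {ffun 'I_s.+1 -> 'I_K.+1} | (m <= \sum_j l j)%N)
      B * 4 ^- (\sum_j l j))).
    rewrite [leLHS]big_mkcond [leRHS]big_mkcond; apply: ler_sum => l _.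
    have B4 : 0 <= (if (m <= \sum_j l j)%N then B * 4 ^- (\sum_j l j) else 0).
      by case: (leqP m _) => // _; rewrite mulr_ge0// ltW// p0.
    have [_|l0] := eqVneq l [ffun=> ord0]; first exact: B4.
    have [lm|/ltnW lm] := leqP m (\sum_j l j); last first.
      rewrite /avg big1 ?mulr0//.
      by move=> sigma _; rewrite (estim_component0 node_agree cardI net)// expr0n.
    have cl w : `|component l F w| <= M * (8 ^+ s.+1 * 2 ^- \sum_j l j) := component_le pG l w GM.
    apply: (le_trans (avg_estim_component_le node_inj cardI net lm cl)).
    rewrite natrX /B le_eqVlt; apply/orP; left; apply/eqP.
    have -> : 4 ^- (\sum_j l j) = (2 ^- (\sum_j l j)) ^+ 2 :> R.
      exact: exprV4.
    by rewrite !exprMn; ring.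
  rewrite -mulr_sumr; apply: (le_trans (ler_wpM2l B0 (sum_large_levels s K m))).
  have mm : (m%:R + 2) ^+ s <= (2 * m%:R) ^+ s :> R.
    rewrite lerXn2r ?nnegrE ?addr_ge0 ?mulr_ge0// -natrD -natrM ler_nat.
    by lia.
  apply: (@le_trans _ _ (B * (2 * (2 * m%:R) ^+ s / 4 ^+ m))).
    by rewrite ler_wpM2l// ler_wpM2r ?(ltW (p0 _ _ _))// ler_wpM2l.
  rewrite /B /C m4 [(2 * _) ^+ s]exprMn.
  have q0 : 0 <= m%:R ^+ s * (4 ^- m * 4 ^- m) :> R.
    by rewrite mulr_ge0 ?exprn_ge0// mulr_ge0// ltW// p0.
  apply: (@le_trans _ _ (4 ^+ s.+1 * (M * 8 ^+ s.+1) ^+ 2 * (2 * 2 ^+ s) *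
      (m%:R ^+ s * (4 ^- m * 4 ^- m)))).
    by rewrite le_eqVlt; apply/orP; left; apply/eqP; ring.
  by rewrite ler_wpM2r// lerDl.
pose good := [pred l : {ffun 'I_s.+1 -> 'I_K.+1} |
  [forall j, kappa < l j]%N && (\sum_j (l j).-1 == m)%N].
pose b := (delta * 2 ^- (m + 3 * s.+1)) ^+ 2 / 4 ^+ m : R.
have b0 : 0 <= b by rewrite /b mulr_ge0 ?sqr_ge0// ltW// p0.
apply: (@le_trans _ _ (\sum_(l | good l) b)); last first.
  rewrite [leLHS]big_mkcond [leRHS]big_mkcond; apply: ler_sum => l _.
  have E0 : 0 <= avg (fun sigma => estim alpha node (component l F) sigma ^+ 2).
    by apply: avg_ge0 => sigma; exact: sqr_ge0.
  case: ifP => [/andP[/forallP lk /eqP lm]|_]; last by case: ifP.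
  have l0 j : (0 < l j)%N by exact: leq_ltn_trans (lk j).
  rewrite ifT; last first.
    apply/eqP => /ffunP/(_ ord0); rewrite ffunE => e.
    by have := l0 ord0; rewrite e.
  rewrite (avg_estim_component_eq node_inj cardI net)// /b ler_wpM2r ?(ltW (p0 _ _ _))//.
  have -> : (m + 3 * s.+1 = \sum_(j < s.+1) (l j + 2))%N.
    rewrite -lm mulnC -[X in (X * 3)%N](card_ord s.+1) -sum_nat_const -big_split/=.
    apply: eq_bigr => j _; case: (nat_of_ord (l j)) (l0 j) => //= n _.
    by rewrite addn3 addn2.
  apply: (@component_sqr_ge R s.+1 K G pG a l eta delta r) => //.
  - exact: ltW.
  - by rewrite /eta mulrC divfK// pnatr_eq0.
  - by move=> j; exact: kr.
  - exact: G_avg.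
have := @card_balanced_levels s K m kappa mK; rewrite -/good.
have mk : (2 * s.+1 * kappa <= m)%N by apply: leq_trans m0; lia.
move=> /(_ mk) cg.
have -> : \sum_(l | good l) b = b * #|good|%:R by rewrite sumr_const mulr_natr.
apply: (@le_trans _ _ (b * ((m %/ (2 * s.+1)) ^ s)%:R)); last first.
  by rewrite ler_wpM2l// ler_nat.
have mq : m%:R / (4 * s.+1%:R) <= (m %/ (2 * s.+1))%:R :> R.
  rewrite ler_pdivrMr ?mulr_gt0// -!natrM ler_nat.
  have := divn_eq m (2 * s.+1); have := ltn_pmod m (isT : 0 < 2 * s.+1)%N.
  have : (0 < m %/ (2 * s.+1))%N by rewrite divn_gt0//; lia.
  by nia.
rewrite natrX; apply: (@le_trans _ _ (b * (m%:R / (4 * s.+1%:R)) ^+ s)).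
  rewrite le_eqVlt; apply/orP; left; apply/eqP; rewrite /b /c m4.
  have -> : 2 ^- (m + 3 * s.+1) = 2 ^- m * 2 ^- (3 * s.+1) :> R by rewrite exprD invfM.
  have -> : 4 ^- m = (2 ^- m) ^+ 2 :> R.
    exact: exprV4.
  rewrite [(m%:R / _) ^+ s]expr_div_n; move: (2 ^- m) ((4 * _) ^- s) (2 ^- (3 * _)) => x y z.
  move: (m%:R ^+ s) => t; ring.
by rewrite ler_wpM2l// lerXn2r ?nnegrE// divr_ge0// mulr_ge0.
Qed.

End FiniteVariance.

(** * Partial derivatives of a function of the class *)

Section FromClass.
Context {R : realType} {s : nat}.
Implicit Types (x y : 'I_s -> R * R).

Lemma point_of_T2s x : (forall j, T2 R (x j)) -> T2s R s (point_of x).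
Proof. by move=> Tx j; rewrite !mxE /Defs.coord /=; case: (x j) (Tx j). Qed.

Lemma point_of_T2s_interior x : (forall j, T2o (x j)) -> (T2s R s)° (point_of x).
Proof.
move=> Tx.
(* Both coordinates may move by e, hence the margin 2 * e at the hypotenuse. *)
have [e e0 He] : exists2 e : R, 0 < e &
    forall j, [/\ e <= (x j).1, e <= (x j).2 & 2 * e <= 1 - (x j).1 - (x j).2].
  pose m j := Num.min (Num.min (x j).1 (x j).2) ((1 - (x j).1 - (x j).2) / 2).
  exists (\big[Order.min/1]_j m j).
    apply: lt_bigmin => // j _; rewrite /m.
    by have /and3P[? ? ?] := Tx j; rewrite !lt_min; apply/andP; split; [apply/andP|]; lra.
  move=> j; have := bigmin_le 1 j m; set b := \big[_/_]_j _.
  by rewrite /m !le_min => /andP[/andP[? ?] ?]; split => //; lra.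
apply/nbhs_ballP; exists e => //= y [_ xy] j.
have h k : `|Defs.coord (x j) k - y j k| < e.
  by have := xy j k; rewrite -ball_normE /= mxE.
have [h1 h2] := (h 0, h 1); have [e1 e2 e3] := He j.
move: h1 h2; rewrite /Defs.coord /= !ltr_norml => /andP[? ?] /andP[? ?].
by split => /=; lra.
Qed.

Lemma point_of_move_axis x j i p t :
  point_of (fupd x j (move_axis i p t)) =
  t *: delta_mx j i + point_of (fupd x j p).
Proof.
apply/matrixP => j' k; rewrite !mxE /fupd /move_axis /Defs.coord.
have [_|_] := eqVneq j' j; last by rewrite mulr0 add0r.
by case: i k => -[|[|//]] ? [[|[|//]] ?] /=; rewrite ?mulr0 ?mulr1 ?add0r 1?addrC.
Qed.

Lemma is_derive_line (f : 'M[R]_(s, 2) -> R) (x v : 'M[R]_(s, 2)) (l : R) :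
  is_derive x v f l -> is_derive (0 : R) (1 : R) (fun t => f (t *: v + x)) l.
Proof.
case=> df <-.
have E : (fun h : R => h^-1 *: ((fun t => f (t *: v + x)) (h *: 1 + 0) - f (0 *: v + x))) =
         (fun h : R => h^-1 *: (f (h *: v + x) - f x)).
  by apply/funext => h; rewrite addr0 [h *: 1]mulr1 scale0r add0r.
by split; rewrite /derivable /derive /= E.
Qed.

Variables (f : 'M[R]_(s, 2) -> R) (D : mindex s -> 'M[R]_(s, 2) -> R).
Hypothesis Dpartials : mixed_partials f D.
Hypothesis Dholder : holder_partials D.

Definition partial_at e x : R := D e (point_of x).

Lemma partials_partial_at : partials partial_at.
Proof.
move=> e j i ej x Tx p Tp; rewrite /partial_at.
under eq_fun do rewrite point_of_move_axis.
apply: is_derive_line; apply: Dpartials.2 => //.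
by apply: point_of_T2s_interior; exact: fupd_T2o.
Qed.

(** A single partial derivative is bounded by the norm of the vector containing it; 2 s + 1 is a
    crude bound for sqrt (2 s). *)
Lemma partial_at_holder : exists B beta : R, [/\ 0 <= B, 0 < beta &
  forall e x y r, 0 <= r -> (forall j, T2 R (x j)) -> (forall j, T2 R (y j)) ->
    (forall j, `|(x j).1 - (y j).1| <= r /\ `|(x j).2 - (y j).2| <= r) ->
    `|partial_at e x - partial_at e y| <= B * ((2 * s).+1%:R * r) `^ beta].
Proof.
have [B [beta [B0 beta0 _ H]]] := Dholder; exists B, beta; split => //.
move=> e x y r r0 Tx Ty xy.
have := H (mindex_supp e) _ _ (point_of_T2s Tx) (point_of_T2s Ty).
rewrite /norm2_coords; set S := \sum_(_ | _) _ => HS.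
apply: (@le_trans _ _ (Num.sqrt S)).
  rewrite -sqrtr_sqr ler_wsqrtr// /S (bigD1 e)//= lerDl.
  by apply: sumr_ge0 => *; exact: sqr_ge0.
apply: (le_trans HS); rewrite ler_wpM2l// ge0_ler_powR ?nnegrE ?mulr_ge0 ?sqrtr_ge0 ?(ltW beta0)//.
rewrite -[leRHS]ger0_norm ?mulr_ge0// -sqrtr_sqr ler_wsqrtr//.
apply: (@le_trans _ _ (\sum_(j < s) \sum_(k < 2) r ^+ 2)).
  apply: ler_sum => j _; apply: ler_sum => k _; rewrite !mxE -real_normK ?num_real//.
  rewrite ler_sqr ?nnegrE//; have [h1 h2] := xy j.
  by rewrite /Defs.coord; case: ifP.
rewrite !sumr_const !card_ord -mulrnA -[_ *+ _]mulr_natl exprMn ler_wpM2r ?sqr_ge0//.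
rewrite -natrX ler_nat; nia.
Qed.

Lemma partial_at_bounded : exists M : R, forall e x, (forall j, T2 R (x j)) ->
  `|partial_at e x| <= M.
Proof.
have [B [beta [B0 beta0 H]]] := partial_at_holder.
exists (\sum_e `|partial_at e (fun=> bary)| + B * ((2 * s).+1%:R * 1) `^ beta).
move=> e x Tx; rewrite -[X in `|X|](subrKC (partial_at e (fun=> bary))).
apply: (le_trans (ler_normD _ _)); apply: lerD.
  by rewrite (bigD1 e)//= lerDl sumr_ge0.
apply: H => //; first by move=> j; exact/T2oW/bary_T2o.
by move=> j; apply: T2_dist => //; exact/T2oW/bary_T2o.
Qed.

Lemma partial_at_ucont (eta : R) : 0 < eta -> exists2 r : R, 0 < r &
  forall e x y, (forall j, T2 R (x j)) -> (forall j, T2 R (y j)) ->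
    (forall j, `|(x j).1 - (y j).1| <= r /\ `|(x j).2 - (y j).2| <= r) ->
    `|partial_at e x - partial_at e y| <= eta.
Proof.
move=> eta0; have [B [beta [B0 beta0 H]]] := partial_at_holder.
have B1 : 0 < B + 1 by rewrite ltr_wpDl.
(* The radius below turns the Hoelder bound into B * z <= eta; the denominator B + 1 allows B =
   0. *)
pose z := eta / (B + 1).
have z0 : 0 < z by rewrite divr_gt0.
exists (z `^ (beta^-1) / (2 * s).+1%:R); first by rewrite divr_gt0// powR_gt0.
move=> e x y Tx Ty xy; apply: (le_trans (H e x y _ _ Tx Ty xy)).
  by rewrite divr_ge0// powR_ge0.
rewrite [_ * (_ / _)]mulrC divfK ?pnatr_eq0// -powRrM mulVf ?gt_eqF// powRr1 ?(ltW z0)//.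
by rewrite /z mulrA ler_pdivrMr// mulrC ler_wpM2l ?(ltW eta0)// lerDl.
Qed.

End FromClass.

(** * Riemann sums over powers of the triangle *)

Section LebesgueTriangle.
Context {R : realType}.
Local Notation RL := (measurableTypeR R).
Local Notation mu := (@lebesgue_measure R).
Local Notation mu2 := (@lebesgue_measure R \x @lebesgue_measure R)%E.
(* The measure structure on [pushforward] that takes the proof of
   measurability of the map as an explicit argument. *)
Local Notation pushforward_measure :=
  measure_function_pushforward__canonical__measure_function_Measure.

Let dilation (a c : R) : RL -> RL := fun x => (x - c) / a.

Let measurable_dilation a c : measurable_fun [set: RL] (dilation a c).
Proof. by apply: measurable_funM => //; exact: measurable_funB. Qed.

Let norm_ge0 (a : R) : 0 <= `|a|^-1. Proof. by rewrite invr_ge0. Qed.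

Lemma dilation_preimage_itv (a c u v : R) : a != 0 ->
  mu (dilation a c @^-1` `]u, v]) = (`|a|%:E * mu `]u, v])%E.
Proof.
move=> a0; rewrite lebesgue_measure_itv/= lte_fin.
have [a_gt0|a_lt0|e] := ltgtP 0 a; last by rewrite -e eqxx in a0.
  have -> : dilation a c @^-1` `]u, v] = `]a * u + c, a * v + c]%classic.
    apply/seteqP; split => x /=; rewrite !in_itv/= /dilation ltr_pdivlMr// ler_pdivrMr//
      => /andP[? ?]; apply/andP; split; lra.
  rewrite lebesgue_measure_itv/= lte_fin ltrD2r ltr_pM2l// ger0_norm ?ltW//.
  case: ifP => _; last by rewrite mule0.
  by rewrite -!EFinD -EFinM; congr (_%:E); ring.
(* For a < 0 the interval becomes half-open on the other side, which does not change its length. *)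
have -> : dilation a c @^-1` `]u, v] = `[a * v + c, a * u + c[%classic.
  apply/seteqP; split => x /=; rewrite !in_itv/= /dilation ltr_ndivlMr// ler_ndivrMr//
    => /andP[? ?]; apply/andP; split; lra.
rewrite lebesgue_measure_itv/= lte_fin ltrD2r ltr_nM2l// ltr0_norm//.
case: ifP => _; last by rewrite mule0.
by rewrite -!EFinD -EFinM; congr (_%:E); ring.
Qed.

(** The measure of the preimage divided by |a| is a measure that agrees with length on half-open
    intervals, so uniqueness of Lebesgue measure applies. *)
Lemma lebesgue_measure_dilation (a c : R) (A : set RL) : a != 0 -> measurable A ->
  mu (dilation a c @^-1` A) = (`|a|%:E * mu A)%E.
Proof.
move=> a0 mA.
pose nu := mscale (NngNum (norm_ge0 a)) (pushforward_measure mu (@measurable_dilation a c)).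
have -> : mu A = nu A.
  apply: lebesgue_measure_unique => // _ [[u v]] _ <-.
  transitivity (`|a|^-1%:E * mu (dilation a c @^-1` `]u, v]))%E; last by [].
  rewrite (dilation_preimage_itv c u v a0) muleA -EFinM.
  by rewrite mulVf ?normr_eq0// mul1e.
transitivity (`|a|%:E * (`|a|^-1%:E * mu (dilation a c @^-1` A)))%E; last by [].
by rewrite muleA -EFinM mulfV ?normr_eq0// mul1e.
Qed.

Definition dilation2 (a : R) (c p : R * R) : R * R := ((p.1 - c.1) / a, (p.2 - c.2) / a).

Lemma measurable_dilation2 a c : measurable_fun [set: RL * RL] (dilation2 a c : RL * RL -> RL * RL).
Proof.
apply/measurable_fun_pairP; split.
  exact: (measurableT_comp (@measurable_dilation a c.1) measurable_fst).
exact: (measurableT_comp (@measurable_dilation a c.2) measurable_snd).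
Qed.

Lemma lebesgue_measure_dilation2 (a : R) (c : R * R) (A : set (RL * RL)) : a != 0 -> measurable A ->
  mu2 (dilation2 a c @^-1` A) = ((`|a| ^+ 2)%:E * mu2 A)%E.
Proof.
move=> a0 mA; have sq0 : 0 <= (`|a| ^+ 2)^-1 by rewrite invr_ge0 sqr_ge0.
have an0 : `|a| != 0 by rewrite normr_eq0.
pose nu := mscale (NngNum sq0) (pushforward_measure mu2 (@measurable_dilation2 a c)).
have -> : mu2 A = nu A.
  apply: product_measure_unique => // B C mB mC.
  transitivity ((`|a| ^+ 2)^-1%:E *
    mu2 ((dilation a c.1 @^-1` B) `*` (dilation a c.2 @^-1` C)))%E; first by [].
  rewrite product_measure1E//; last 2 first.
  - by rewrite -[X in measurable X]setTI; exact: measurable_dilation.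
  - by rewrite -[X in measurable X]setTI; exact: measurable_dilation.
  transitivity ((`|a| ^+ 2)^-1%:E * ((`|a|%:E * mu B) * (`|a|%:E * mu C)))%E.
    by congr (_ * (_ * _))%E; exact: lebesgue_measure_dilation.
  rewrite muleACA !muleA -!EFinM.
  by rewrite -mulrA -expr2 mulVf ?mul1e// expf_neq0.
transitivity ((`|a| ^+ 2)%:E * ((`|a| ^+ 2)^-1%:E * mu2 (dilation2 a c @^-1` A)))%E; last by [].
by rewrite muleA -EFinM mulfV ?mul1e// expf_neq0.
Qed.

Lemma measurable_T2 : measurable (T2 R : set (RL * RL)).
Proof.
have -> : T2 R = [set p : RL * RL | 0 <= p.1] `&` ([set p | 0 <= p.2] `&`
    [set p : RL * RL | p.1 + p.2 <= 1]).
  by apply/seteqP; split => p /=; [case|case=> ? []].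
have m1 : measurable_fun [set: RL * RL] (fst : RL * RL -> R) by exact: measurable_fst.
have m2 : measurable_fun [set: RL * RL] (snd : RL * RL -> R) by exact: measurable_snd.
have m12 : measurable_fun [set: RL * RL] (fun p : RL * RL => p.1 + p.2 : R).
  exact: measurable_funD.
apply: measurableI; [|apply: measurableI].
- have := m1 measurableT `[0, +oo[%classic (measurable_itv _); rewrite setTI.
  by congr measurable; apply/seteqP; split => p /=; rewrite in_itv/= andbT.
- have := m2 measurableT `[0, +oo[%classic (measurable_itv _); rewrite setTI.
  by congr measurable; apply/seteqP; split => p /=; rewrite in_itv/= andbT.
have := m12 measurableT `]-oo, 1]%classic (measurable_itv _); rewrite setTI.
by congr measurable; apply/seteqP; split => p /=; rewrite in_itv.
Qed.

Lemma mu2_T2_fin : mu2 (T2 R) \is a fin_num.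
Proof.
have h : T2 R `<=` `[0, 1]%classic `*` `[0, 1]%classic.
  by move=> p [p1 p2 p12]; split; rewrite /= in_itv/=; apply/andP; split; lra.
rewrite ge0_fin_numE// (@le_lt_trans _ _ (mu2 (`[0, 1]%classic `*` `[0, 1]%classic)))//.
  by apply: le_measure; rewrite ?inE; [exact: measurable_T2|exact: measurableX|].
have mu01 : mu `[0, 1]%classic = 1%:E.
  by rewrite lebesgue_measure_itv/= lte_fin ltr01 oppr0 adde0.
rewrite product_measure1E// [X in (X < _)%E](_ : _ = (1%:E * 1%:E)%E); last first.
  by congr (_ * _)%E; exact: mu01.
by rewrite -EFinM ltry.
Qed.

End LebesgueTriangle.

(** * Riemann sums on one triangle *)

Section TriangleRiemannSums.
Context {R : realType}.
Local Notation RL := (measurableTypeR R).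
Local Notation mu2 := (@lebesgue_measure R \x @lebesgue_measure R)%E.

Definition area_T2 : R := fine (mu2 (T2 R)).

Lemma area_T2_ge0 : 0 <= area_T2.
Proof. by rewrite /area_T2 fine_ge0. Qed.

Lemma integrable_T2 (f : RL * RL -> R) (B : R) : measurable_fun (T2 R) f ->
  (forall p, T2 R p -> `|f p| <= B) -> mu2.-integrable (T2 R) (EFin \o f).
Proof.
move=> mf fB; apply: measurable_bounded_integrable => //.
- exact: measurable_T2.
- by rewrite -ge0_fin_numE// mu2_T2_fin.
exists B; split; first exact: num_real.
by move=> x Bx p Tp /=; rewrite (le_trans (fB p Tp))// ltW.
Qed.

Definition ucont_T2 (h : R * R -> R) := forall eta : R, 0 < eta ->
  exists2 r : R, 0 < r & forall p q, T2 R p -> T2 R q ->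
    `|p.1 - q.1| <= r -> `|p.2 - q.2| <= r -> `|h p - h q| <= eta.

Definition grid_cell (k i : nat) : set RL := [set x : RL | i%:R <= 2 ^+ k * x < i.+1%:R].

Lemma measurable_grid_cell k i : measurable (grid_cell k i).
Proof.
have m : measurable_fun [set: RL] (fun x : RL => 2 ^+ k * x : R).
  exact: measurable_funM.
have := m measurableT `[i%:R, i.+1%:R[%classic (measurable_itv _); rewrite setTI.
by congr measurable; apply/seteqP; split => p /=; rewrite in_itv.
Qed.

(** Step functions that prove measurability of an h controlled only on T^2: rounding both
    coordinates down keeps a point of T^2 in T^2. The index 2^k is included for points with a
    coordinate equal to 1. *)
Definition grid_fun (h : R * R -> R) (k : nat) (p : RL * RL) : R :=
  \sum_(i < (2 ^ k).+1) \sum_(j < (2 ^ k).+1)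
    h (i%:R / 2 ^+ k, j%:R / 2 ^+ k) * \1_(grid_cell k i `*` grid_cell k j) p.

Lemma measurable_grid_fun h k D : measurable_fun D (grid_fun h k).
Proof.
apply: measurable_sum => i; apply: measurable_sum => j.
apply: measurable_funM => //; apply: measurable_indic.
by apply: measurableX; exact: measurable_grid_cell.
Qed.

Lemma grid_funE h k p : T2 R p -> exists q, [/\ T2 R q, grid_fun h k p = h q,
  `|q.1 - p.1| <= 2 ^- k & `|q.2 - p.2| <= 2 ^- k].
Proof.
case: p => x y [/= x0 y0 xy].
have k0 : 0 < 2 ^+ k :> R by rewrite exprn_gt0.
pose i := Num.trunc (2 ^+ k * x); pose j := Num.trunc (2 ^+ k * y).
have ix : i%:R <= 2 ^+ k * x < i.+1%:R by apply: truncn_itv; rewrite mulr_ge0// ltW.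
have jy : j%:R <= 2 ^+ k * y < j.+1%:R by apply: truncn_itv; rewrite mulr_ge0// ltW.
have le1 (n : nat) (z : R) : n%:R <= 2 ^+ k * z -> z <= 1 -> (n < (2 ^ k).+1)%N.
  move=> nz z1; rewrite ltnS -(ler_nat R) natrX; apply: (le_trans nz).
  by rewrite ger_pMr.
have iK : (i < (2 ^ k).+1)%N by apply: (le1 _ x); [case/andP: ix|lra].
have jK : (j < (2 ^ k).+1)%N by apply: (le1 _ y); [case/andP: jy|lra].
have uniq_cell (n n' : nat) (z : R) : n%:R <= 2 ^+ k * z < n.+1%:R ->
    n'%:R <= 2 ^+ k * z < n'.+1%:R ->
    n = n'.
  move=> /andP[a1 a2] /andP[b1 b2].
  have := le_lt_trans a1 b2; have := le_lt_trans b1 a2; rewrite !ltr_nat; lia.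
have near (n : nat) (z : R) : n%:R <= 2 ^+ k * z < n.+1%:R ->
    n%:R / 2 ^+ k <= z /\ `|n%:R / 2 ^+ k - z| <= 2 ^- k.
  move=> /andP[a1 a2].
  have nz : n%:R / 2 ^+ k <= z by rewrite ler_pdivrMr// mulrC.
  split => //; rewrite distrC ger0_norm ?subr_ge0// lerBlDl.
  rewrite -[X in _ + X]mul1r -mulrDl ler_pdivlMr//.
  by rewrite natr1 mulrC ltW.
have [nx nx'] := near _ _ ix; have [ny ny'] := near _ _ jy.
exists (i%:R / 2 ^+ k, j%:R / 2 ^+ k); split => //=.
  split => /=; [by rewrite divr_ge0// ltW|by rewrite divr_ge0// ltW|].
  by apply: le_trans xy; exact: lerD.
rewrite /grid_fun (bigD1 (Ordinal iK))//= (bigD1 (Ordinal jK))//= indicE mem_set//= mulr1.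
rewrite [X in _ + X + _]big1 ?addr0; last first.
  move=> j' j'j; rewrite indicE memNset ?mulr0// => -[_ /= j'y].
  by move: j'j; rewrite -val_eqE/= (uniq_cell _ _ _ j'y jy) eqxx.
rewrite big1 ?addr0// => i' i'i; rewrite big1// => j' _.
rewrite indicE memNset ?mulr0// => -[/= i'x _].
by move: i'i; rewrite -val_eqE/= (uniq_cell _ _ _ i'x ix) eqxx.
Qed.

Lemma exprV2_small (r : R) : 0 < r -> exists K : nat, forall k, (K <= k)%N -> 2 ^- k <= r.
Proof.
move=> r0; have r1 : 0 <= r^-1 by rewrite invr_ge0 ltW.
exists (Num.bound r^-1) => k kb; rewrite invf_ple ?posrE ?exprn_gt0//.
rewrite (le_trans (ltW (archi_boundP r1)))// -natrX ler_nat.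
exact: leq_trans kb (ltnW (ltn_expl _ _)).
Qed.

Lemma measurable_ucont_T2 h : ucont_T2 h -> measurable_fun (T2 R : set (RL * RL)) h.
Proof.
move=> hu; apply: (measurable_fun_cvg (h := grid_fun h)) => [k|p Tp].
  exact: measurable_grid_fun.
apply/cvgrPdist_le => e e0; have [r r0 hr] := hu e e0.
have [K rK] := exprV2_small r0; exists K => // k /= /rK kr.
have [q [Tq -> q1 q2]] := grid_funE h k Tp.
by apply: hr => //; rewrite distrC; [exact: le_trans q1 _|exact: le_trans q2 _].
Qed.

Section Cells.
Context {K : nat}.
Local Notation W := {ffun 'I_K -> 'I_4}.

(** The closed cell, as a preimage under the inverse of the cell map; this form gives its
    measurability and area. Neighbouring cells overlap along edges. *)
Definition cell (w : W) : set (RL * RL) :=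
  dilation2 (scale (codom w)) (descend (codom w) (0, 0)) @^-1` T2 R.

Lemma scale_neq0 (w : seq 'I_4) : scale w != 0 :> R.
Proof. by rewrite -normr_eq0 norm_scale invr_eq0 expf_neq0. Qed.

Lemma descend_dilation2 (w : seq 'I_4) (p : R * R) :
  descend w (dilation2 (scale w) (descend w (0, 0)) p) = p.
Proof.
have s0 := scale_neq0 w; have [] := descendB w (dilation2 (scale w) (descend w (0, 0)) p) (0, 0).
set q := descend w (dilation2 _ _ _); rewrite /= !subr0 ![scale w * _]mulrC !divfK//.
by move=> /addIr h1 /addIr h2; rewrite [q]surjective_pairing h1 h2; case: (p).
Qed.

Lemma dilation2_descend (w : seq 'I_4) (q : R * R) :
  dilation2 (scale w) (descend w (0, 0)) (descend w q) = q.
Proof.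
have s0 := scale_neq0 w; have [h1 h2] := descendB w q (0, 0).
by rewrite /dilation2 h1 h2 /= !subr0 ![scale w * _]mulrC !mulfK//; case: (q).
Qed.

Lemma cell_T2 (w : W) p : cell w p -> T2 R p.
Proof. by move=> wp; rewrite -(descend_dilation2 (codom w) p); exact: descend_T2. Qed.

Lemma cell_center (w : W) p : cell w p ->
  `|p.1 - (center w).1| <= 2 ^- K /\ `|p.2 - (center w).2| <= 2 ^- K.
Proof.
move=> wp; rewrite -(descend_dilation2 (codom w) p).
by have := descend_dist (codom w) wp (T2oW (@bary_T2o R)); rewrite size_codomW.
Qed.

Lemma measurable_cell (w : W) : measurable (cell w).
Proof.
rewrite -[X in measurable X]setTI; apply: measurable_dilation2 => //.
exact: measurable_T2.
Qed.

Lemma area_cell (w : W) : fine (mu2 (cell w)) = 4 ^- K * area_T2.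
Proof.
have mT := @measurable_T2 R.
rewrite /cell lebesgue_measure_dilation2 ?scale_neq0//.
rewrite fineM ?mu2_T2_fin//= norm_scale size_codomW; congr (_ * _).
by rewrite exprVn -exprM mulnC exprM; congr (_ ^- _); rewrite expr2 -natrM.
Qed.

Lemma cell_cover p : T2 R p -> exists w : W, cell w p.
Proof.
move=> Tp; suff [w [wK [q Tq ->]]] : exists w : seq 'I_4, size w = K /\
    exists2 q, T2 R q & p = descend w q.
  have [v vw] : exists v : W, codom v = w.
    exists [ffun k : 'I_K => nth 0 w k].
    apply: (@eq_from_nth _ 0); rewrite size_codomW ?wK// => i iK.
    rewrite codomE (nth_map (Ordinal iK)) ?size_enum_ord// ffunE nth_enum_ord//.
  by exists v; rewrite /cell vw /= dilation2_descend.
elim: K p Tp => [|k IH] p Tp; first by exists [::]; split => //; exists p.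
have [d [q Tq ->]] : exists d : 'I_4, exists2 q, T2 R q & p = child d q.
  case: p Tp => x y [/= x0 y0 xy].
  have [h1|h1] := leP (2^-1) x.
    exists (inord 1), (2 * x - 1, 2 * y); first by split => /=; lra.
    by rewrite /child /= inordK//=; congr pair; field.
  have [h2|h2] := leP (2^-1) y.
    exists (inord 2), (2 * x, 2 * y - 1); first by split => /=; lra.
    by rewrite /child /= inordK//=; congr pair; field.
  have [h3|h3] := leP (x + y) (2^-1).
    exists (inord 0), (2 * x, 2 * y); first by split => /=; lra.
    by rewrite /child /= inordK//=; congr pair; field.
  exists (inord 3), (1 - 2 * x, 1 - 2 * y); first by split => /=; lra.
  by rewrite /child /= inordK//=; congr pair; field.
have [w [wk [r Tr ->]]] := IH q Tq.
by exists (d :: w); rewrite /= wk; split => //; exists r.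
Qed.

Definition cell_fun (c : W -> R) (p : RL * RL) : R := \sum_w c w * \1_(cell w) p.

Lemma measurable_cell_fun c D : measurable_fun D (cell_fun c).
Proof.
apply: measurable_sum => w; apply: measurable_funM => //.
by apply: measurable_indic; exact: measurable_cell.
Qed.

Lemma indic_le1 (A : set (RL * RL)) p : `|\1_A p| <= 1 :> R.
Proof. by rewrite indicE; case: (p \in A); rewrite ?normr1 ?normr0. Qed.

Lemma cell_fun_bounded c p : `|cell_fun c p| <= \sum_w `|c w|.
Proof.
apply: (le_trans (ler_norm_sum _ _ _)); apply: ler_sum => w _.
by rewrite normrM ler_piMr// indic_le1.
Qed.

Lemma Rintegral_cell_fun c :
  \int[mu2]_(p in T2 R) cell_fun c p = area_T2 * avg c.
Proof.
have mT := @measurable_T2 R.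
have int_cell w : mu2.-integrable (T2 R) (EFin \o (\1_(cell w) : RL * RL -> R)).
  apply: (@integrable_T2 _ 1) => [|p _]; last exact: indic_le1.
  by apply: measurable_indic; exact: measurable_cell.
have area w : \int[mu2]_(p in T2 R) (\1_(cell w) p : R) = 4 ^- K * area_T2.
  rewrite -(area_cell w) /Rintegral integral_indic//; last exact: measurable_cell.
  by rewrite setIidl//; exact: cell_T2.
suff H (r : seq W) : mu2.-integrable (T2 R)
      (EFin \o (fun p : RL * RL => \sum_(w <- r) c w * \1_(cell w) p)) /\
    \int[mu2]_(p in T2 R) (\sum_(w <- r) c w * \1_(cell w) p) =
    \sum_(w <- r) c w * (4 ^- K * area_T2).
  rewrite /cell_fun (H _).2 -mulr_suml /avg card_ffun !card_ord natrX.
  by rewrite mulrC mulrCA mulrA.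
elim: r => [|w r [IH1 IH2]].
  split; last by under eq_Rintegral do rewrite big_nil; rewrite Rintegral_cst// mul0r big_nil.
  apply: (@integrable_T2 _ 0) => [|p _ /=]; last by rewrite big_nil normr0.
  by apply: measurable_sum => w; apply: measurable_funM => //;
     apply: measurable_indic; exact: measurable_cell.
have int_w : mu2.-integrable (T2 R) (EFin \o (fun p : RL * RL => c w * \1_(cell w) p)).
  by have := integrableZl mT (c w) (int_cell w).
split.
  have := integrableD mT int_w IH1; apply: eq_integrable => // p _ /=.
  by rewrite big_cons EFinD.
under eq_Rintegral do rewrite big_cons.
by rewrite RintegralD// RintegralZl// IH2 area big_cons.
Qed.

(** The number n of cells containing a point exceeds 1 on shared edges. Instead of discarding the
    edges, bound |h - phi| by eta * n + B * (n - 1) on T^2: the integral of n is the total area of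
    the cells, that is the area of T^2, so the second term integrates to 0. *)
Lemma riemann_T2 (h : R * R -> R) (eta : R) : ucont_T2 h ->
  (forall p q, T2 R p -> T2 R q -> `|p.1 - q.1| <= 2 ^- K ->
     `|p.2 - q.2| <= 2 ^- K -> `|h p - h q| <= eta) ->
  `|\int[mu2]_(p in T2 R) h p - area_T2 * avg (fun w : W => h (center w))|
  <= area_T2 * eta.
Proof.
move=> hu hK; have mT := @measurable_T2 R.
have mh := measurable_ucont_T2 hu.
have center_T2 (w : W) : T2 R (center w) by exact/T2oW/center_T2o.
have eta0 : 0 <= eta.
  have Tb := T2oW (@bary_T2o R).
  apply: le_trans (hK bary bary Tb Tb _ _); rewrite ?subrr ?normr0 ?invr_ge0 ?exprn_ge0//.
pose B := \sum_(w : W) `|h (center w)| + eta.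
have hB p : T2 R p -> `|h p| <= B.
  move=> Tp; have [w wp] := cell_cover Tp; have [h1 h2] := cell_center wp.
  rewrite -[h p](subrKC (h (center w))); apply: (le_trans (ler_normD _ _)).
  apply: lerD; last exact: hK.
  by rewrite (bigD1 w)//= lerDl sumr_ge0.
have B0 : 0 <= B := le_trans (normr_ge0 _) (hB _ (T2oW (@bary_T2o R))).
pose phi := cell_fun (fun w => h (center w)).
have int_h : mu2.-integrable (T2 R) (EFin \o h) := integrable_T2 mh hB.
have int_c c : mu2.-integrable (T2 R) (EFin \o cell_fun c).
  apply: (integrable_T2 (B := \sum_w `|c w|)); first exact: measurable_cell_fun.
  by move=> p _; exact: cell_fun_bounded.
have int_B : mu2.-integrable (T2 R) (EFin \o (fun=> B)).
  by apply: (integrable_T2 (B := `|B|)) => // p _ /=.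
rewrite -(Rintegral_cell_fun (fun w => h (center w))) -RintegralB//.
have int_hc : mu2.-integrable (T2 R) (EFin \o (fun p => h p - phi p)).
  by have := integrableB mT int_h (int_c (fun w => h (center w))).
apply: (le_trans (le_normr_Rintegral mT int_hc)).
apply: (@le_trans _ _ (\int[mu2]_(p in T2 R) (cell_fun (fun=> eta + B) p - B))).
  apply: le_Rintegral => //.
  - by have := integrable_norm int_hc.
  - by have := integrableB mT (int_c (fun=> eta + B)) int_B.
  move=> p Tp; have [w wp] := cell_cover Tp.
  rewrite /phi /cell_fun -mulr_sumr; set n := \sum_w \1_(cell w) p.
  have n1 : 1 <= n.
    by rewrite /n (bigD1 w)//= indicE mem_set// lerDl sumr_ge0.
  have -> : h p - \sum_v h (center v) * \1_(cell v) p =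
      \sum_v (h p - h (center v)) * \1_(cell v) p - h p * (n - 1).
    under [X in _ = X - _]eq_bigr do rewrite mulrBl.
    by rewrite sumrB -mulr_sumr -/n; ring.
  apply: (le_trans (ler_normB _ _)).
  have -> : (eta + B) * n - B = eta * n + B * (n - 1) by ring.
  apply: lerD.
    rewrite /n mulr_sumr; apply: (le_trans (ler_norm_sum _ _ _)); apply: ler_sum => v _.
    rewrite normrM; have [vp|vp] := pselect (cell v p).
      rewrite indicE mem_set// normr1 !mulr1; have [g1 g2] := cell_center vp.
      exact: hK.
    by rewrite indicE memNset// normr0 !mulr0.
  rewrite normrM [X in _ * X]ger0_norm ?subr_ge0//.
  by rewrite ler_wpM2r ?subr_ge0// hB.
rewrite RintegralB// Rintegral_cell_fun Rintegral_cst// avg_cst ?card_W_gt0//.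
by rewrite [B * _]mulrC -mulrBr addrK.
Qed.

End Cells.

End TriangleRiemannSums.

(** * From one triangle to the product, by induction *)

Section ProductRiemannSums.
Context {R : realType}.
Local Notation mu2 := (@lebesgue_measure R \x @lebesgue_measure R)%E.

Definition fcons (T : Type) s (q : T) (z : 'I_s -> T) (j : 'I_s.+1) : T :=
  if unlift ord0 j is Some j' then z j' else q.

Lemma fcons0 (T : Type) s (q : T) (z : 'I_s -> T) : fcons q z ord0 = q.
Proof. by rewrite /fcons unlift_none. Qed.

Lemma fconsS (T : Type) s (q : T) (z : 'I_s -> T) j : fcons q z (lift ord0 j) = z j.
Proof. by rewrite /fcons liftK. Qed.

Lemma avg_fcons (W : finType) s (Phi : {ffun 'I_s.+1 -> W} -> R) :
  avg Phi = avg (fun q => avg (fun z : {ffun 'I_s -> W} => Phi [ffun j => fcons q z j])).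
Proof.
rewrite /avg -mulr_sumr mulrA; congr (_ * _).
  by rewrite !card_ffun !card_ord expnS natrM invfM.
rewrite [RHS]pair_big/=.
pose f (p : W * {ffun 'I_s -> W}) : {ffun 'I_s.+1 -> W} := [ffun j => fcons p.1 p.2 j].
rewrite (reindex f)/=; first by apply: eq_bigl => p.
apply: onW_bij; exists (fun y : {ffun 'I_s.+1 -> W} => (y ord0, [ffun j => y (lift ord0 j)])).
  move=> [q z]; rewrite /f ffunE fcons0; congr pair; apply/ffunP => j.
  by rewrite !ffunE fconsS.
move=> y; apply/ffunP => j; rewrite ffunE /fcons /=.
by case: unliftP => [j'|] ->; rewrite ?ffunE.
Qed.

Definition close_T2s s (g : 'M[R]_(s, 2) -> R) (r eta : R) :=
  forall x y : 'I_s -> R * R, (forall j, T2 R (x j)) -> (forall j, T2 R (y j)) ->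
    (forall j, `|(x j).1 - (y j).1| <= r /\ `|(x j).2 - (y j).2| <= r) ->
    `|g (point_of x) - g (point_of y)| <= eta.

Definition ucont_T2s s (g : 'M[R]_(s, 2) -> R) :=
  forall eta : R, 0 < eta -> exists2 r : R, 0 < r & close_T2s g r eta.

Definition section_at s (g : 'M[R]_(s.+1, 2) -> R) (p : R * R) : 'M[R]_(s, 2) -> R :=
  fun y => g (col_mx (\row_k Defs.coord p k) y).

Lemma point_of_fcons s (p : R * R) (x : 'I_s -> R * R) :
  point_of (fcons p x) = col_mx (\row_k Defs.coord p k) (point_of x) :> 'M[R]_(1 + s, 2).
Proof.
apply/matrixP => j k; rewrite !mxE; case: splitP => j' jj'.
  rewrite mxE; congr (Defs.coord _ k).
  have -> : j = ord0 :> 'I_s.+1 by apply/val_inj; rewrite /= jj' (ord1 j').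
  by rewrite fcons0.
rewrite mxE; congr (Defs.coord _ k).
have -> : j = lift ord0 j' :> 'I_s.+1 by apply/val_inj; rewrite /= jj'.
by rewrite fconsS.
Qed.

Lemma section_atE s (g : 'M[R]_(s.+1, 2) -> R) p x :
  section_at g p (point_of x) = g (point_of (fcons p x)).
Proof. by rewrite /section_at -point_of_fcons. Qed.

Lemma fcons_T2 s p (x : 'I_s -> R * R) :
  T2 R p -> (forall j, T2 R (x j)) -> forall j, T2 R (fcons p x j).
Proof. by move=> Tp Tx j; rewrite /fcons; case: unlift. Qed.

Lemma close_section_at s (g : 'M[R]_(s.+1, 2) -> R) r eta p : 0 <= r -> T2 R p ->
  close_T2s g r eta -> close_T2s (section_at g p) r eta.
Proof.
move=> r0 Tp gr x y Tx Ty xy; rewrite !section_atE; apply: gr.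
- exact: fcons_T2.
- exact: fcons_T2.
by move=> j; rewrite /fcons; case: unlift => //; rewrite !subrr normr0.
Qed.

Definition riemann_sum s K (g : 'M[R]_(s, 2) -> R) : R :=
  avg (fun y : {ffun 'I_s -> {ffun 'I_K -> 'I_4}} => g (point_of (fun j => center (y j)))).

Lemma riemann_sumS s K (g : 'M[R]_(s.+1, 2) -> R) : riemann_sum K g =
  avg (fun w : {ffun 'I_K -> 'I_4} => riemann_sum K (section_at g (center w))).
Proof.
rewrite /riemann_sum avg_fcons; apply: eq_avg => w; apply: eq_avg => y.
rewrite section_atE; congr (g (point_of _)); apply/funext => j.
by rewrite ffunE /fcons; case: unlift.
Qed.

(** Each coordinate adds [area_T2 ^+ s * eta] to the error. The induction applies the result on one
    triangle to the inner integral G, once G is known to be uniformly continuous. *)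
Lemma riemann_T2s s (g : 'M[R]_(s, 2) -> R) K eta : ucont_T2s g ->
  close_T2s g (2 ^- K) eta ->
  `|integral_T2s g - area_T2 ^+ s * riemann_sum K g| <= s%:R * area_T2 ^+ s * eta.
Proof.
have V0 := @area_T2_ge0 R.
have p0 k : 0 < 2 ^- k :> R by rewrite invr_gt0 exprn_gt0.
elim: s g K eta => [|s IH] g K eta gu gK.
  rewrite /= /riemann_sum (@eq_avg _ _ _ (fun=> g 0)).
    by rewrite avg_cst ?card_Ws_gt0// mul1r subrr normr0 !mul0r.
  by move=> y; congr g; apply/matrixP => -[].
pose G p := integral_T2s (section_at g p).
have Vs0 : 0 <= area_T2 ^+ s :> R by rewrite exprn_ge0.
have su p : T2 R p -> ucont_T2s (section_at g p).
  move=> Tp e /gu[r r0 gr]; exists r => //; apply: close_section_at => //; exact: ltW.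
have GK p k e : T2 R p -> close_T2s g (2 ^- k) e ->
    `|G p - area_T2 ^+ s * riemann_sum k (section_at g p)| <= s%:R * area_T2 ^+ s * e.
  by move=> Tp gk; apply: IH; [exact: su|apply: close_section_at => //; exact: ltW].
(* Continuity of the inner integral is read off its Riemann sums, at a level k so fine that the
   approximation errors total at most an arbitrary e'. *)
have Gclose p q r e : 0 <= r -> T2 R p -> T2 R q -> `|p.1 - q.1| <= r -> `|p.2 - q.2| <= r ->
    close_T2s g r e -> `|G p - G q| <= area_T2 ^+ s * e.
  move=> r0 Tp Tq pq1 pq2 gr; apply/ler_addgt0Pr => e' e'0.
  pose c : R := 2 * (s%:R * area_T2 ^+ s) + 1.
  have c0 : 0 < c by rewrite /c ltr_wpDl// !mulr_ge0.
  have [r' r'0 gr'] := gu (e' / c) (divr_gt0 e'0 c0).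
  have [k kr'] := exprV2_small r'0.
  have gk : close_T2s g (2 ^- k) (e' / c).
    move=> x y Tx Ty xy; apply: gr' => // j; have [h1 h2] := xy j.
    by have := kr' k (leqnn k) => h; split; [exact: le_trans h1 _|exact: le_trans h2 _].
  have Hp := GK p k _ Tp gk; have Hq := GK q k _ Tq gk.
  set Ap := area_T2 ^+ s * _ in Hp; set Aq := area_T2 ^+ s * _ in Hq.
  have Hpq : `|Ap - Aq| <= area_T2 ^+ s * e.
    rewrite /Ap /Aq -mulrBr normrM ger0_norm// ler_wpM2l// /riemann_sum -avgB.
    apply: (le_trans (ler_norm_avg _)).
    rewrite -[leRHS](avg_cst (T := {ffun 'I_s -> {ffun 'I_k -> 'I_4}}) _ card_Ws_gt0).
    apply: ler_avg => y; rewrite !section_atE; apply: gr.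
    - by apply: fcons_T2 => // j; exact/T2oW/center_T2o.
    - by apply: fcons_T2 => // j; exact/T2oW/center_T2o.
    by move=> j; rewrite /fcons; case: unlift => //= j'; rewrite !subrr normr0.
  have -> : G p - G q = (G p - Ap) + (Ap - Aq) - (G q - Aq) by ring.
  apply: (le_trans (ler_normB _ _)).
  have tri := ler_normD (G p - Ap) (Ap - Aq).
  have : 2 * (s%:R * area_T2 ^+ s) * (e' / c) <= e'.
    by rewrite [_ * (e' / c)]mulrA ler_pdivrMr// [leLHS]mulrC ler_wpM2l ?(ltW e'0)// /c lerDl.
  by lra.
have Gu : ucont_T2 G.
  move=> e e0; have c0 : 0 < area_T2 ^+ s + 1 :> R by rewrite ltr_wpDl.
  have [r r0 gr] := gu (e / (area_T2 ^+ s + 1)) (divr_gt0 e0 c0).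
  exists r => // p q Tp Tq pq1 pq2.
  apply: (le_trans (Gclose p q r _ (ltW r0) Tp Tq pq1 pq2 gr)).
  by rewrite mulrA ler_pdivrMr// mulrC ler_wpM2l ?(ltW e0)// lerDl.
have -> : integral_T2s g = \int[mu2]_(p in T2 R) G p by [].
have HG := @riemann_T2 R K G (area_T2 ^+ s * eta) Gu.
have {}HG := HG (fun p q Tp Tq pq1 pq2 =>
  Gclose p q _ _ (ltW (p0 K)) Tp Tq pq1 pq2 gK).
rewrite riemann_sumS; set A := avg _ in HG *; set B := avg _.
have AB : `|A - area_T2 ^+ s * B| <= s%:R * area_T2 ^+ s * eta.
  rewrite /A /B -avgZ -avgB; apply: (le_trans (ler_norm_avg _)).
  rewrite -[leRHS](avg_cst (T := {ffun 'I_K -> 'I_4}) _ card_W_gt0).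
  by apply: ler_avg => w; apply: GK => //; exact/T2oW/center_T2o.
have -> : \int[mu2]_(p in T2 R) G p - area_T2 ^+ s.+1 * B =
    (\int[mu2]_(p in T2 R) G p - area_T2 * A) + area_T2 * (A - area_T2 ^+ s * B).
  by rewrite exprS; ring.
apply: (le_trans (ler_normD _ _)); rewrite [X in _ + X]normrM (ger0_norm V0).
have : area_T2 * `|A - area_T2 ^+ s * B| <= area_T2 * (s%:R * area_T2 ^+ s * eta).
  by rewrite ler_wpM2l.
rewrite -natr1 exprS => h; apply: le_trans (lerD HG h) _.
by rewrite le_eqVlt; apply/orP; left; apply/eqP; ring.
Qed.

End ProductRiemannSums.

(** * Digits and the map phi *)

Section Digits.
Context {R : realType}.
Implicit Types (X : nat -> 'I_4) (u : R).

Definition partial_digits X : nat -> R := series (fun k => (X k)%:R / 4 ^+ k.+1).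

Lemma partial_digitsS X n : partial_digits X n.+1 = partial_digits X n + (X n)%:R / 4 ^+ n.+1.
Proof. by rewrite /partial_digits /series /= big_nat_recr. Qed.

Lemma partial_digits0 X : partial_digits X 0 = 0.
Proof. by rewrite /partial_digits /series /= big_geq. Qed.

Let p0 k : 0 < 4 ^- k :> R. Proof. by rewrite invr_gt0 exprn_gt0. Qed.

Lemma digit_le3 (d : 'I_4) : (d : nat)%:R <= 3 :> R.
Proof. by rewrite ler_nat -ltnS. Qed.

Lemma partial_digits_nondecreasing X :
  {homo partial_digits X : m n / (m <= n)%N >-> m <= n}.
Proof.
apply/nondecreasing_seqP => n; rewrite partial_digitsS lerDl.
by rewrite mulr_ge0// ltW.
Qed.

(** The right ends of the nested intervals do not increase, because digits are at most 3. *)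
Lemma partial_digits_gap X m n : (m <= n)%N ->
  partial_digits X n + 4 ^- n <= partial_digits X m + 4 ^- m.
Proof.
move=> /subnKC <-; elim: (n - m)%N => [|k IH]; first by rewrite addn0.
apply: le_trans IH; rewrite addnS partial_digitsS -addrA lerD2l.
have := digit_le3 (X (m + k)%N); have := p0 (m + k); rewrite exprS invfM.
by move: (4 ^- _) => z z0 d3; nra.
Qed.

Lemma cvg_partial_digits X : cvgn (partial_digits X).
Proof.
apply: nondecreasing_is_cvgn; first exact: partial_digits_nondecreasing.
exists 1 => _ [n _ <-]; have := partial_digits_gap X (leq0n n).
by rewrite partial_digits0 expr0 invr1 add0r; apply: le_trans; rewrite lerDl ltW.
Qed.

Lemma of_digits_ge X n : partial_digits X n <= of_digits R X.
Proof.
apply: nondecreasing_cvgn_le; first exact: partial_digits_nondecreasing.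
exact: cvg_partial_digits.
Qed.

Lemma of_digits_le X n : of_digits R X <= partial_digits X n + 4 ^- n.
Proof.
apply: limr_le; first exact: cvg_partial_digits.
exists n => // k /= nk; apply: le_trans (partial_digits_gap X nk).
by rewrite lerDl ltW.
Qed.

Lemma of_digits_ge0 X : 0 <= of_digits R X.
Proof. by rewrite -(partial_digits0 X) of_digits_ge. Qed.

Lemma of_digits_le1 X : of_digits R X <= 1.
Proof.
by have := of_digits_le X 0; rewrite partial_digits0 expr0 invr1 add0r.
Qed.

Lemma of_digits_lt X n k : (n <= k)%N -> X k != ord_max ->
  of_digits R X < partial_digits X n + 4 ^- n.
Proof.
move=> nk Xk; apply: (lt_le_trans _ (partial_digits_gap X nk)).
apply: (le_lt_trans (of_digits_le X k.+1)).
rewrite partial_digitsS -addrA ltrD2l.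
have X2 : (X k : nat)%:R <= 2 :> R.
  have := ltn_ord (X k); rewrite ltnS leq_eqVlt => /predU1P[e|h]; last by rewrite ler_nat.
  by case/eqP: Xk; apply/val_inj.
by have := p0 k; rewrite exprS invfM; move: (4 ^- _) => z z0; nra.
Qed.

Definition int_digits X n : nat := \sum_(k < n) X k * 4 ^ (n - k.+1).

Lemma int_digitsS X n : int_digits X n.+1 = (4 * int_digits X n + X n)%N.
Proof.
rewrite /int_digits big_ord_recr /= subnn expn0 muln1; congr (_ + _)%N.
rewrite big_distrr/=; apply: eq_bigr => k _; rewrite mulnCA; congr (_ * _)%N.
by rewrite -expnS -subSn.
Qed.

Lemma int_digitsE X n : (int_digits X n)%:R = partial_digits X n * 4 ^+ n :> R.
Proof.
elim: n => [|n IH]; first by rewrite /int_digits big_ord0 partial_digits0 mul0r.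
rewrite int_digitsS natrD natrM IH partial_digitsS exprS.
by field; rewrite expf_neq0.
Qed.

Lemma truncn_of_digits X n k : (n <= k)%N -> X k != ord_max ->
  Num.truncn (of_digits R X * 4 ^+ n) = int_digits X n.
Proof.
move=> nk Xk; apply: truncn_def; have card_points_gt0 : 0 < 4 ^+ n :> R by rewrite exprn_gt0.
rewrite -[(int_digits X n).+1]addn1 natrD int_digitsE; apply/andP; split.
  by rewrite ler_pM2r// of_digits_ge.
rewrite -ltr_pdivlMr// mulrDl mulfK ?gt_eqF// mul1r.
exact: of_digits_lt nk Xk.
Qed.

(** A sequence that is not eventually 3 has its value strictly below the right end of each of its
    intervals, so truncation recovers the digits. Strictness at n = 0 excludes the value 1, which
    [digit] treats apart. *)
Lemma digit_of_digits X : (forall n, exists2 k, (n <= k)%N & X k != ord_max) ->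
  digit (of_digits R X) =1 X.
Proof.
move=> HX n; rewrite /digit.
have [k nk Xk] := HX n.+1; rewrite (truncn_of_digits nk Xk).
case: eqP => [u1|_].
  have [k' _ Xk'] := HX 0%N; have := of_digits_lt (leq0n k') Xk'.
  by rewrite u1 partial_digits0 add0r expr0 invr1 ltxx.
apply/val_inj; rewrite int_digitsS /= mulnC modnMDl modn_small//.
by rewrite inordK.
Qed.

Lemma truncn_digit u n : 0 <= u -> u < 1 ->
  Num.truncn (u * 4 ^+ n.+1) = (4 * Num.truncn (u * 4 ^+ n)%R + digit u n)%N.
Proof.
move=> u0 u1; rewrite /digit lt_eqF// inordK ?ltn_pmod//.
set x := u * 4 ^+ n; have -> : u * 4 ^+ n.+1 = 4 * x by rewrite exprS mulrCA.
have x0 : 0 <= x by rewrite mulr_ge0 ?exprn_ge0.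
have x40 : 0 <= 4 * x by rewrite mulr_ge0.
suff -> : Num.truncn x = (Num.truncn (4 * x)%R %/ 4)%N by rewrite mulnC -divn_eq.
have /andP[h1 h2] := truncn_itv x40; set q := Num.truncn (4 * x) in h1 h2 *.
apply: truncn_def; apply/andP; split.
  rewrite -(ler_pM2l (_ : 0 < 4))// -natrM; apply: le_trans h1.
  by rewrite ler_nat mulnC leq_trunc_div.
rewrite -(ltr_pM2l (_ : 0 < 4))// -natrM; apply: (lt_le_trans h2).
by rewrite ler_nat mulnC ltn_ceil.
Qed.

Lemma truncn_digits_eq u (v : R) n : 0 <= u -> u < 1 -> 0 <= v -> v < 1 ->
  (forall k, (k < n)%N -> digit u k = digit v k) ->
  Num.truncn (u * 4 ^+ n) = Num.truncn (v * 4 ^+ n).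
Proof.
move=> u0 u1 v0 v1; elim: n => [|n IH] H.
  by rewrite !expr0 !mulr1 !(@truncn_def _ _ 0)// ?u0 ?v0.
rewrite !truncn_digit// H// IH// => k kn; apply: H; exact: leqW.
Qed.

End Digits.

(** * Distance from phi to the cell centres *)

Section Phi.
Context {R : realType}.

Lemma cvg_of_dist (x : nat -> R) : (forall K n, (K <= n)%N -> `|x n - x K| <= 2 ^- K) ->
  cvgn x /\ forall K, `|limn x - x K| <= 2 ^- K.
Proof.
move=> xd.
have cx : cvgn x.
  apply: cauchy_cvg; apply/cauchy_exP => e e0; have e20 : 0 < e / 2 by rewrite divr_gt0.
  have [K eK] := exprV2_small e20.
  exists (x K); exists K => // n /= Kn; rewrite -ball_normE /= distrC.
  apply: (le_lt_trans (xd K n Kn)); apply: (le_lt_trans (eK K (leqnn K))).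
  by rewrite ltr_pdivrMr// ltr_pMr// ltr1n.
split => // K; rewrite ler_distl; apply/andP; split.
  apply: limr_ge; first exact: cx.
  exists K => // n /= /xd; rewrite ler_norml => /andP[? _].
  by lra.
apply: limr_le; first exact: cx.
exists K => // n /= /xd; rewrite ler_norml => /andP[_ ?].
by lra.
Qed.

Lemma mkseq_take (T : Type) (f : nat -> T) K n : (K <= n)%N ->
  mkseq f n = mkseq f K ++ mkseq (fun k => f (K + k)%N) (n - K).
Proof.
move=> Kn; rewrite -{1}(subnKC Kn) /mkseq iotaD map_cat; congr (_ ++ _).
by rewrite add0n -[X in iota X _]addn0 iotaDl -map_comp.
Qed.

Lemma codom_mkseq (X : nat -> 'I_4) K : codom [ffun k : 'I_K => X k] = mkseq X K.
Proof.
rewrite codomE /mkseq -val_enum_ord -map_comp.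
by apply: eq_map => k /=; rewrite ffunE.
Qed.

(** The limit point is within 2^-K of the first vertex of the cell, and that vertex within 2^-K of
    the centre, along each axis. *)
Lemma phi_near (u : R) : T2 R (phi u) /\ forall K,
  `|(phi u).1 - (center [ffun k : 'I_K => digit u k]).1| <= 2 / 2 ^+ K /\
  `|(phi u).2 - (center [ffun k : 'I_K => digit u k]).2| <= 2 / 2 ^+ K.
Proof.
pose A K : R * R := descend (mkseq (digit u) K) (0, 0).
have T00 : T2 R (0, 0) by split => /=; lra.
have AE : (fun K => (T2_cell R (digit u) K).1.1) = A.
  by apply/funext => K; rewrite T2_cellE.
have dist K n : (K <= n)%N -> `|(A n).1 - (A K).1| <= 2 ^- K /\ `|(A n).2 - (A K).2| <= 2 ^- K.
  move=> Kn; rewrite /A (mkseq_take _ Kn) descend_cat.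
  have := descend_dist (mkseq (digit u) K)
    (descend_T2 (mkseq (fun k => digit u (K + k)%N) (n - K)) T00) T00.
  by rewrite size_mkseq.
have [c1 l1] := cvg_of_dist (fun K n Kn => (dist K n Kn).1).
have [c2 l2] := cvg_of_dist (fun K n Kn => (dist K n Kn).2).
have phiE : phi u = (limn (fun K => (A K).1), limn (fun K => (A K).2)).
  by rewrite /phi -AE.
have TA n : T2 R (A n) by exact: descend_T2.
split.
  rewrite phiE; split => /=.
  - by apply: limr_ge; [exact: c1|exists 0%N => // n _; case: (TA n)].
  - by apply: limr_ge; [exact: c2|exists 0%N => // n _; case: (TA n)].
  - rewrite -limD//; apply: limr_le; first exact: is_cvgD.
    by exists 0%N => // n _; case: (TA n).
move=> K; rewrite phiE /= /center codom_mkseq.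
have := descend_dist (mkseq (digit u) K) T00 (T2oW (@bary_T2o R)); rewrite size_mkseq.
rewrite -/(A K) => -[h1 h2]; have h3 := l1 K; have h4 := l2 K.
rewrite mulr_natl mulr2n; split.
  by rewrite -(subrKA (A K).1); apply: (le_trans (ler_normD _ _)); exact: lerD.
by rewrite -(subrKA (A K).2); apply: (le_trans (ler_normD _ _)); exact: lerD.
Qed.

End Phi.

(** * Digits of the net points *)

Section Net.
Context {R : realType} {m s : nat} (a : 'I_(4 ^ m) -> 'I_s -> R).
Hypothesis net : is_0ms_net a.

Lemma prod_pow4 (k : 'I_s -> nat) : (\sum_j k j = m)%N ->
  \prod_(j < s) (4%:R ^- k j) = 4%:R ^- m :> R.
Proof. by move=> <-; rewrite prodfV -expr_sum. Qed.

(** The value 1 is excluded by counting: each of the 4^m slabs of width 4^-m in coordinate j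
    contains a net point, distinct slabs contain distinct points, hence every one of the 4^m points
    lies in a slab. *)
Lemma net_lt1 i j : 0 <= a i j < 1.
Proof.
have /andP[-> _] := net.1 i j; rewrite /=.
pose k j' := if j' == j then m else 0%N.
have km : (\sum_j' k j' = m)%N by rewrite /k -big_mkcond big_pred1_eq.
pose c (q : 'I_(4 ^ m)) j' : nat := if j' == j then q : nat else 0%N.
have cb q j' : (c q j' < 4 ^ k j')%N by rewrite /c /k; case: eqP.
have /choice[g gP] q : exists i, forall j', (c q j')%:R * 4%:R ^- k j' <= a i j' <
    (c q j').+1%:R * 4%:R ^- k j'.
  by have [i' [Hi' _]] := net.2 k (c q) (cb q) (prod_pow4 km); exists i'.
have g_inj : injective g.
  move=> q q' gq; have := gP q j; have := gP q' j; rewrite gq /c /k !eqxx.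
  have p0 : 0 < 4%:R ^- m :> R by rewrite invr_gt0 exprn_gt0.
  move=> /andP[h1 h2] /andP[h3 h4]; apply/val_inj => /=.
  have := le_lt_trans h1 h4; have := le_lt_trans h3 h2.
  by rewrite !ltr_pM2r// !ltr_nat; lia.
have [g' _ gK] := injF_bij g_inj.
have := gP (g' i) j; rewrite gK /c /k eqxx => /andP[_ h].
apply: (lt_le_trans h); rewrite ler_pdivrMr ?exprn_gt0// mul1r -natrX ler_nat.
exact: ltn_ord.
Qed.

(** Common leading digits give common integer parts of the coordinates times 4^k_j, that is a common
    elementary box. *)
Lemma net_agree K (k : 'I_s -> nat) (i i' : 'I_(4 ^ m)) : (forall j, (k j <= K)%N) ->
  (\sum_j k j = m)%N ->
  (forall j, agree (k j) [ffun q : 'I_K => digit (a i j) q]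
     [ffun q : 'I_K => digit (a i' j) q]) -> i = i'.
Proof.
move=> kK km ag.
pose c j := Num.truncn (a i j * 4 ^+ k j).
have p0 n : 0 < 4 ^+ n :> R by rewrite exprn_gt0.
have box i0 j : Num.truncn (a i0 j * 4 ^+ k j) = c j ->
    (c j)%:R * 4%:R ^- k j <= a i0 j < (c j).+1%:R * 4%:R ^- k j.
  move=> <-; have /andP[a0 a1] := net_lt1 i0 j.
  rewrite ler_pdivrMr// ltr_pdivlMr//; apply: truncn_itv.
  by rewrite mulr_ge0// ltW.
have cb j : (c j < 4 ^ k j)%N.
  have /andP[a0 a1] := net_lt1 i j; have /andP[h _] := box i j erefl.
  rewrite -(ltr_nat R) natrX; move: h; rewrite ler_pdivrMr// => h.
  by apply: (le_lt_trans h); rewrite gtr_pMl.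
have [i0 [_ uniq_i]] := net.2 k c cb (prod_pow4 km).
rewrite -(uniq_i i); last by move=> j; exact: box.
apply: uniq_i => j; apply: box; rewrite /c; have /andP[a0 a1] := net_lt1 i j.
have /andP[a0' a1'] := net_lt1 i' j.
apply: truncn_digits_eq => // q qk; have qK := leq_trans qk (kK j).
by have /agreeP/(_ (Ordinal qK) qk) := ag j; rewrite !ffunE.
Qed.

End Net.

(** * Bounded random variables *)

Section BoundedRandomVariables.
Context {R : realType} {d : measure_display} {Omega : measurableType d}.
Variable P : probability Omega R.
Implicit Types (X Y : Omega -> R) (M : R).

Lemma bounded_integrable X M : measurable_fun setT X -> (forall w, `|X w| <= M) ->
  P.-integrable setT (EFin \o X).
Proof.
move=> mX XM; apply: measurable_bounded_integrable => //.
  exact: fin_num_fun_lty.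
exists M; split; first exact: num_real.
by move=> x Mx w _ /=; rewrite (le_trans (XM w))// ltW.
Qed.

Lemma Rintegral_cst1 (c : R) : \int[P]_(w in setT) c = c.
Proof. by rewrite Rintegral_cst//= probability_setT mulr1. Qed.

Lemma variance_bounded X M : measurable_fun setT X -> (forall w, `|X w| <= M) ->
  'V_P[X] = (\int[P]_w (X w ^+ 2) - (\int[P]_w X w) ^+ 2)%:E.
Proof.
move=> mX XM; have iX := bounded_integrable mX XM.
have M0 : 0 <= M := le_trans (normr_ge0 _) (XM point).
have mX2 : measurable_fun setT (fun w => X w ^+ 2) by exact: measurable_funX.
have iX2 : P.-integrable setT (EFin \o (fun w => X w ^+ 2)).
  apply: (bounded_integrable (M := M ^+ 2)) => // w.
  by rewrite normrX lerXn2r ?nnegrE.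
rewrite /variance covariance.unlock !expectation.unlock -/(Rintegral P setT X).
set mx := Rintegral P setT X.
have ic c : P.-integrable setT (EFin \o (fun=> c : R)).
  by apply: (bounded_integrable (M := `|c|)).
have iX' : P.-integrable setT (EFin \o (fun w => (2 * mx) * X w)).
  by have := integrableZl measurableT (2 * mx) iX.
have iXX : P.-integrable setT (EFin \o (fun w => X w ^+ 2 - (2 * mx) * X w)).
  by have := integrableB measurableT iX2 iX'.
transitivity (\int[P]_w (X w ^+ 2 - (2 * mx) * X w + mx ^+ 2)%:E)%E.
  by apply: eq_integral => w _; congr (_%:E); rewrite !fctE /=; ring.
rewrite -[LHS]fineK; last first.
  apply: integrable_fin_num => //.
  by have := integrableD measurableT iXX (ic (mx ^+ 2)).
congr (_%:E); rewrite -/(Rintegral P setT (fun w => X w ^+ 2 - (2 * mx) * X w + mx ^+ 2)).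
by rewrite RintegralD// RintegralB// RintegralZl// Rintegral_cst1 -/mx; ring.
Qed.

Lemma Rintegral_near X Y M eps : 0 <= eps -> measurable_fun setT X -> measurable_fun setT Y ->
  (forall w, `|X w| <= M) -> (forall w, `|Y w| <= M) ->
  {ae P, forall w, `|X w - Y w| <= eps} ->
  `|\int[P]_w X w - \int[P]_w Y w| <= eps.
Proof.
move=> e0 mX mY XM YM XY.
have iX := bounded_integrable mX XM; have iY := bounded_integrable mY YM.
have mXY : measurable_fun setT (fun w => X w - Y w) by exact: measurable_funB.
have iXY : P.-integrable setT (EFin \o (fun w => X w - Y w)).
  by have := integrableB measurableT iX iY.
rewrite -RintegralB//; apply: (le_trans (le_normr_Rintegral measurableT iXY)).
rewrite -lee_fin /Rintegral fineK; last first.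
  apply: integrable_fin_num => //.
  by have := integrable_norm iXY.
rewrite -[leRHS](_ : (\int[P]_(w in setT) eps%:E = eps%:E)%E); last first.
  by rewrite integral_cst//= probability_setT mule1.
apply: ae_ge0_le_integral => //.
- by apply/measurable_EFinP; exact: measurableT_comp.
- by apply: filterS XY => w /= h _; rewrite lee_fin.
Qed.

(** The second moment and the squared mean each move by at most 2 * M * eps. *)
Lemma variance_near X Y M eps : 0 <= eps -> measurable_fun setT X -> measurable_fun setT Y ->
  (forall w, `|X w| <= M) -> (forall w, `|Y w| <= M) ->
  {ae P, forall w, `|X w - Y w| <= eps} ->
  `|fine 'V_P[X] - fine 'V_P[Y]| <= 4 * M * eps.
Proof.
move=> e0 mX mY XM YM XY.
rewrite (variance_bounded mX XM) (variance_bounded mY YM)/=.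
have M0 : 0 <= M := le_trans (normr_ge0 _) (XM point).
have sq u v : `|u| <= M -> `|v| <= M -> `|u ^+ 2 - v ^+ 2| <= 2 * M * `|u - v|.
  move=> uM vM; rewrite subr_sqr normrM mulrC ler_wpM2r// (le_trans (ler_normD _ _))//.
  by rewrite mulr_natl mulr2n lerD.
have intM (Z : Omega -> R) : measurable_fun setT Z -> (forall w, `|Z w| <= M) ->
    `|\int[P]_w Z w| <= M.
  move=> mZ ZM; rewrite -[X in `|X|]subr0 -[X in _ - X](Rintegral_cst1 0).
  apply: (@Rintegral_near _ _ M) => //; first by move=> w; rewrite normr0.
  by apply: aeW => w; rewrite subr0.
have h1 : `|\int[P]_w (X w ^+ 2) - \int[P]_w (Y w ^+ 2)| <= 2 * M * eps.
  apply: (@Rintegral_near _ _ (M ^+ 2)); rewrite ?mulr_ge0//.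
  - exact: measurable_funX.
  - exact: measurable_funX.
  - by move=> w; rewrite normrX lerXn2r ?nnegrE.
  - by move=> w; rewrite normrX lerXn2r ?nnegrE.
  apply: filterS XY => w /= h; apply: (le_trans (sq _ _ (XM w) (YM w))).
  by rewrite ler_wpM2l// mulr_ge0.
have h2 := Rintegral_near e0 mX mY XM YM XY.
have h3 := sq _ _ (intM X mX XM) (intM Y mY YM).
have h4 : 2 * M * `|\int[P]_w X w - \int[P]_w Y w| <= 2 * M * eps.
  by rewrite ler_wpM2l// mulr_ge0.
set A := \int[P]_w X w in h2 h3 h4 *; set B := \int[P]_w Y w in h2 h3 h4 *.
set A2 := Rintegral _ _ _ in h1 *; set B2 := Rintegral _ _ _ in h1 *.
have -> : A2 - A ^+ 2 - (B2 - B ^+ 2) = (A2 - B2) - (A ^+ 2 - B ^+ 2) by ring.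
apply: (le_trans (ler_normB _ _)); lra.
Qed.

Definition finite_rv (T : finType) (X : Omega -> T) := forall t, measurable (X @^-1` [set t]).

Lemma finite_rv_comp (T : finType) (X : Omega -> T) (Phi : T -> R) : finite_rv X ->
  measurable_fun setT (fun w => Phi (X w)).
Proof.
move=> mX; have -> : (fun w => Phi (X w)) = (fun w => \sum_t Phi t * \1_(X @^-1` [set t]) w).
  apply/funext => w; rewrite (bigD1 (X w))//= indicE mem_set// mulr1 big1 ?addr0// => t tX.
  rewrite indicE memNset ?mulr0// => /= Xt.
  by rewrite Xt eqxx in tX.
by apply: measurable_sum => t; apply: measurable_funM => //; exact: measurable_indic.
Qed.

Lemma finite_rv_fun (T U : finType) (X : Omega -> T) (g : T -> U) :
  finite_rv X -> finite_rv (fun w => g (X w)).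
Proof.
move=> mX u.
have -> : (fun w => g (X w)) @^-1` [set u] = \bigcup_(t in [set t | g t = u]) (X @^-1` [set t]).
  by apply/seteqP; split => [w /= <-|w [t /= <- <-]//]; exists (X w).
by apply: fin_bigcup_measurable => //; exact: finite_finset.
Qed.

Lemma finite_rv_ffun (I T : finType) (X : I -> Omega -> T) :
  (forall i, finite_rv (X i)) -> finite_rv (fun w => [ffun i => X i w]).
Proof.
move=> mX t.
have -> : (fun w => [ffun i => X i w]) @^-1` [set t] =
    \bigcap_(i in [set: I]) (X i @^-1` [set t i]).
  apply/seteqP; split => [w /= <- i _ /=|w H]; first by rewrite ffunE.
  by apply/ffunP => i; rewrite ffunE; exact: H.
by apply: fin_bigcap_measurable => // i _; exact: mX.
Qed.

Lemma Rintegral_uniform (T : finType) (X : Omega -> T) (Phi : T -> R) : finite_rv X ->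
  (forall t, P (X @^-1` [set t]) = (#|T|%:R^-1)%:E) ->
  \int[P]_w Phi (X w) = avg Phi.
Proof.
move=> mX PX.
have ind t : P.-integrable setT (EFin \o (\1_(X @^-1` [set t]) : Omega -> R)).
  apply: (bounded_integrable (M := 1)); first exact: measurable_indic.
  by move=> w; rewrite indicE; case: (_ \in _); rewrite ?normr1 ?normr0.
have area t : \int[P]_w (\1_(X @^-1` [set t]) w : R) = #|T|%:R^-1.
  by rewrite /Rintegral integral_indic//= setIT PX.
have PhiE : (fun w => Phi (X w)) = (fun w => \sum_t Phi t * \1_(X @^-1` [set t]) w).
  apply/funext => w; rewrite (bigD1 (X w))//= indicE mem_set// mulr1 big1 ?addr0// => t tX.
  by rewrite indicE memNset ?mulr0// => /= Xt; rewrite Xt eqxx in tX.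
suff H (r : seq T) : P.-integrable setT
      (EFin \o (fun w => \sum_(t <- r) Phi t * \1_(X @^-1` [set t]) w)) /\
    \int[P]_w (\sum_(t <- r) Phi t * \1_(X @^-1` [set t]) w) =
    \sum_(t <- r) Phi t * #|T|%:R^-1.
  by rewrite PhiE (H _).2 -mulr_suml /avg mulrC.
elim: r => [|t r [IH1 IH2]].
  split; last by under eq_Rintegral do rewrite big_nil; rewrite Rintegral_cst1 big_nil.
  apply: (bounded_integrable (M := 0)) => [|w]; last by rewrite big_nil normr0.
  by apply: measurable_sum => t; apply: measurable_funM => //; exact: measurable_indic.
have int_t : P.-integrable setT (EFin \o (fun w => Phi t * \1_(X @^-1` [set t]) w)).
  by have := integrableZl measurableT (Phi t) (ind t).
split.
  have := integrableD measurableT int_t IH1; apply: eq_integrable => // w _ /=.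
  by rewrite big_cons EFinD.
under eq_Rintegral do rewrite big_cons.
by rewrite RintegralD// RintegralZl// IH2 area big_cons.
Qed.

End BoundedRandomVariables.

(** * The law of the scrambled digits *)

Section ScrambledNet.
Context {R : realType} {s m : nat} {d : measure_display} {Omega : measurableType d}.
Variables (P : probability Omega R) (pi : 'I_s * seq 'I_4 -> Omega -> {perm 'I_4}).
Hypothesis unif : uniform_permutations P pi.
Variable a : 'I_(4 ^ m) -> 'I_s -> R.
Hypothesis net : is_0ms_net a.

Lemma finite_rv_pi key : finite_rv (pi key).
Proof.
move=> t; have [mpi _ _] := unif; have := mpi key [set t]%SET.
by congr measurable; apply/seteqP; split => w /=; rewrite inE => /eqP.
Qed.

Lemma joint_law (N : finType) (key : N -> 'I_s * seq 'I_4) (sigma : {ffun N -> {perm 'I_4}}) :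
  injective key ->
  P ((fun w => [ffun v => pi (key v) w]) @^-1` [set sigma]) =
  (#|{: {ffun N -> {perm 'I_4}}}|%:R^-1)%:E.
Proof.
move=> key_inj; have [_ Ppi indep] := unif.
(* A prescribed value at each key in the image of [key], the full set elsewhere; independence is
   then applied to the list of keys in the image. *)
pose A x : {set {perm 'I_4}} := 
  if [pick v | key v == x] is Some v then [set sigma v]%SET else finset.setT.
have AE v : A (key v) = [set sigma v]%SET.
  rewrite /A; case: pickP => [v' /eqP/key_inj -> //|/(_ v)].
  by rewrite eqxx.
have setE (t : {perm 'I_4}) : [set` [set t]%SET] = [set t].
  by apply/seteqP; split => x /=; rewrite inE => /eqP.
have -> : (fun w => [ffun v => pi (key v) w]) @^-1` [set sigma] =
    \bigcap_(i in [set` map key (enum N)]) (pi i @^-1` [set` A i]).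
  apply/seteqP; split => [w /= ws i /= /mapP[v _ ->]|w H].
    by rewrite /= AE inE -ws ffunE.
  apply/ffunP => v; rewrite ffunE.
  have := H (key v); rewrite /= AE inE => h; apply/eqP/h.
  by apply: map_f; rewrite mem_enum.
have uJ : uniq [seq key v | v <- enum N] by rewrite map_inj_uniq// enum_uniq.
rewrite (indep _ A uJ) big_map -/(enum N) big_enum/=; congr (_%:E).
under eq_bigr do rewrite AE setE Ppi/=.
by rewrite prodr_const card_ffun card_Sn natrX exprVn.
Qed.

(** The digits that the scramble produces, as opposed to those that [digit] reads from the resulting
    real number. *)
Definition raw_digit (i : 'I_(4 ^ m)) (j : 'I_s) (w : Omega) (k : nat) : 'I_4 :=
  pi (j, mkseq (digit (a i j)) k) w (digit (a i j) k).

Definition scrambled_value i j w : R := of_digits R (raw_digit i j w).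

Lemma finite_rv_raw_digit i j k : finite_rv (fun w => raw_digit i j w k).
Proof.
exact: (finite_rv_fun (fun t : {perm 'I_4} => t (digit (a i j) k)) (finite_rv_pi _)).
Qed.

Lemma measurable_scrambled_value i j : measurable_fun setT (scrambled_value i j).
Proof.
apply: (measurable_fun_cvg (h := fun n w => partial_digits (raw_digit i j w) n)) => [n|w _].
  apply: measurable_sum => k; apply: measurable_funM => //.
  exact: (finite_rv_comp (fun c : 'I_4 => (c : nat)%:R) (finite_rv_raw_digit i j k)).
exact: cvg_partial_digits.
Qed.

Lemma finite_rv_digit (U : Omega -> R) k : measurable_fun setT U ->
  (forall w, 0 <= U w <= 1) -> finite_rv (fun w => digit (U w) k).
Proof.
move=> mU U01; pose q w : 'I_(4 ^ k.+1).+1 := inord (Num.truncn (U w * 4 ^+ k.+1)).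
have p0 : 0 < 4 ^+ k.+1 :> R by rewrite exprn_gt0.
have qE w : q w = Num.truncn (U w * 4 ^+ k.+1) :> nat.
  rewrite inordK// ltnS -(ler_nat R) natrX; have /andP[u0 u1] := U01 w.
  have h : 0 <= U w * 4 ^+ k.+1 by rewrite mulr_ge0// ltW.
  by have /andP[/le_trans-> //] := truncn_itv h; rewrite ger_pMl.
have mq : finite_rv q.
  move=> t; have mU' : measurable_fun setT (fun w => U w * 4 ^+ k.+1).
    exact: measurable_funM.
  have := mU' measurableT `[(t : nat)%:R, (t : nat).+1%:R[%classic (measurable_itv _).
  rewrite setTI.
  congr measurable; apply/seteqP; split => w /=; rewrite in_itv/=.
    by move=> /truncn_def; rewrite -qE => /val_inj.
  move=> <-; rewrite qE; apply: truncn_itv; have /andP[u0 _] := U01 w.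
  by rewrite mulr_ge0// ltW.
(* The top value 4^(k + 1) is attained only at U = 1, whose digits are all 3. *)
pose g (t : 'I_(4 ^ k.+1).+1) : 'I_4 :=
  if (t : nat) == (4 ^ k.+1)%N then ord_max else inord (t %% 4).
have -> : (fun w => digit (U w) k) = (fun w => g (q w)).
  apply/funext => w /=; rewrite /g qE /digit; have /andP[u0 u1] := U01 w.
  case: eqP => [->|/eqP un1].
    rewrite mul1r; suff -> : Num.truncn (4 ^+ k.+1 : R) = (4 ^ k.+1)%N by rewrite eqxx.
    by apply: truncn_def; rewrite -natrX lexx ltr_nat ltnSn.
  case: eqP => // e; have h : 0 <= U w * 4 ^+ k.+1 by rewrite mulr_ge0// ltW.
  have /andP[h1 _] := truncn_itv h; move: h1; rewrite e natrX ler_pMl// => h1.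
  by case/eqP: un1; apply/le_anti; rewrite u1 h1.
exact: (finite_rv_fun g mq).
Qed.

Section Level.
Variable K : nat.
Local Notation W := {ffun 'I_K -> 'I_4}.

Definition net_digits (i : 'I_(4 ^ m)) : {ffun 'I_s -> W} :=
  [ffun j => [ffun k : 'I_K => digit (a i j) k]].

Definition net_key (i : 'I_(4 ^ m)) (j : 'I_s) (k : 'I_K) : 'I_s * seq 'I_4 :=
  (j, mkseq (digit (a i j)) k).

(** The permutations met by the first K digits of the net points; the finite type of members of this
    list serves as the set of nodes. *)
Definition net_keys : seq ('I_s * seq 'I_4) :=
  [seq net_key p.1.1 p.1.2 p.2 | p <- enum {: 'I_(4 ^ m) * 'I_s * 'I_K}].

Lemma mem_net_keys i j k : net_key i j k \in net_keys.
Proof. by apply: (map_f (fun p => net_key p.1.1 p.1.2 p.2) (x := (i, j, k))); rewrite mem_enum. Qed.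

Definition net_node i j k : seq_sub net_keys := SeqSub (mem_net_keys i j k).

Lemma agree_net_digits (k : 'I_K) i i' j :
  agree k (net_digits i j) (net_digits i' j) <->
  mkseq (digit (a i j)) k = mkseq (digit (a i' j)) k.
Proof.
split=> [/agreeP H|H].
  apply: (@eq_from_nth _ 0); rewrite !size_mkseq// => q qk.
  have qK := ltn_trans qk (ltn_ord k).
  by rewrite !nth_mkseq//; have := H (Ordinal qK) qk; rewrite !ffunE.
apply/agreeP => q qk; rewrite !ffunE.
by have := congr1 (fun t => nth 0 t q) H; rewrite !nth_mkseq.
Qed.

Lemma net_node_inj i j k i' j' k' : net_node i j k = net_node i' j' k' ->
  [/\ j = j', k = k' & agree k (net_digits i j) (net_digits i' j)].
Proof.
move=> /(congr1 val) /= [jj kk]; have kk' : k = k' :> nat.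
  by have := congr1 size kk; rewrite !size_mkseq.
have e := val_inj kk'; subst j' k'; split => //.
exact/agree_net_digits.
Qed.

Lemma net_node_agree i i' j (k : 'I_K) :
  agree k (net_digits i j) (net_digits i' j) -> net_node i j k = net_node i' j k.
Proof. by move=> /agree_net_digits e; apply/val_inj; rewrite /= /net_key e. Qed.

Definition net_perms (w : Omega) : {ffun seq_sub net_keys -> {perm 'I_4}} :=
  [ffun v => pi (val v) w].

Lemma finite_rv_net_perms : finite_rv net_perms.
Proof. by apply: finite_rv_ffun => v; exact: finite_rv_pi. Qed.

Lemma Rintegral_net_perms Phi : \int[P]_w Phi (net_perms w) = avg Phi.
Proof.
apply: Rintegral_uniform; first exact: finite_rv_net_perms.
by move=> sigma; apply: joint_law; exact: val_inj.
Qed.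

Lemma scrambled_net i w : scrambled net_digits net_node i (net_perms w) =
  [ffun j => [ffun k : 'I_K => raw_digit i j w k]].
Proof. by apply/ffunP => j; apply/ffunP => k; rewrite !ffunE. Qed.

End Level.

Lemma measurable_raw_digit_max i j n :
  measurable [set w | forall k, (n <= k)%N -> raw_digit i j w k = ord_max].
Proof.
have -> : [set w | forall k, (n <= k)%N -> raw_digit i j w k = ord_max] =
    \bigcap_k [set w | (n <= k)%N -> raw_digit i j w k = ord_max].
  by apply/seteqP; split => w H; [move=> k _; exact: H|move=> k; exact: H].
apply: bigcapT_measurable => k; case: (leqP n k) => nk.
  have := finite_rv_raw_digit i j k ord_max.
  by congr measurable; apply/seteqP; split => w /=; [move=> -> //|apply].
rewrite [X in measurable X](_ : _ = setT)//.
by apply/seteqP; split.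
Qed.

(** The digits of a scrambled point are uniform, so L digits from position n on are all 3 with
    probability 4^-L, for every L. *)
Lemma raw_digit_max_null i j n :
  P [set w | forall k, (n <= k)%N -> raw_digit i j w k = ord_max] = 0%E.
Proof.
have mB := measurable_raw_digit_max i j n; set B := [set w | _] in mB *.
apply/eqP; rewrite eq_le measure_ge0 andbT; apply/lee_addgt0Pr => e e0; rewrite add0e.
have [L Le] := exprV2_small e0.
pose h (y : {ffun 'I_(n + L) -> 'I_4}) : R :=
  \prod_(k < n + L) (if (n <= k)%N then (y k == ord_max)%:R else 1).
pose H (w : {ffun 'I_s -> {ffun 'I_(n + L) -> 'I_4}}) := h (w j).
have avgH : avg H = 4 ^- L.
  rewrite (avg_upd j) -[RHS](avg_cst (T := {ffun 'I_s -> {ffun 'I_(n + L) -> 'I_4}}) _ card_Ws_gt0).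
  apply: eq_avg => y; transitivity (avg h).
    by apply: eq_avg => q; rewrite /H ffunE eqxx.
  rewrite /h (avg_prod (fun (k : 'I_(n + L)) (c : 'I_4) =>
    if (n <= k)%N then (c == ord_max)%:R else 1)).
  rewrite big_split_ord/= big1 ?mul1r => [|k _]; last first.
    by rewrite leqNgt ltn_ord avg_cst ?card_ord.
  rewrite (eq_bigr (fun=> 4^-1)) ?prodr_const ?card_ord ?exprVn// => k _.
  rewrite leq_addr /avg card_ord -[RHS]mulr1; congr (_ * _).
  by rewrite (bigD1 ord_max)//= big1 ?addr0// => c /negbTE ->.
have hK y : 0 <= h y <= 1.
  apply/andP; split; first by apply: prodr_ge0 => k _; case: ifP.
  apply: prodr_ile1 => k _; case: ifP => _; rewrite ?ler01 ?lexx//.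
  by case: (_ == _); rewrite ?ler01 ?lexx.
pose Phi sigma := H (scrambled (net_digits (n + L)) (@net_node (n + L)) i sigma).
pose X w := Phi (net_perms (n + L) w).
have mX : measurable_fun setT X.
  exact: (finite_rv_comp Phi (@finite_rv_net_perms (n + L))).
have iX : P.-integrable setT (EFin \o X).
  apply: (@bounded_integrable _ _ _ _ _ 1) => // w.
  have /andP[h0 h1] := hK (scrambled (net_digits (n + L)) (@net_node (n + L)) i
    (net_perms (n + L) w) j).
  by rewrite ger0_norm.
have iB : P.-integrable setT (EFin \o (\1_B : Omega -> R)).
  apply: (@bounded_integrable _ _ _ _ _ 1); first exact: measurable_indic.
  by move=> w; rewrite indicE; case: (_ \in _); rewrite ?normr1 ?normr0.
have EX : \int[P]_w X w = 4 ^- L.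
  rewrite /X Rintegral_net_perms /Phi.
  by rewrite avg_scrambled//; [exact: net_node_inj].
have PB : \int[P]_w (\1_B w : R) = fine (P B) by rewrite /Rintegral integral_indic//= setIT.
rewrite -[P B]fineK ?fin_num_measure// lee_fin -PB.
apply: (@le_trans _ _ (\int[P]_w X w)).
  apply: le_Rintegral => // w _; rewrite indicE; case: (boolP (w \in B)); last first.
    move=> _; rewrite /X /Phi.
    by case/andP: (hK (scrambled (net_digits (n + L)) (@net_node (n + L)) i
      (net_perms (n + L) w) j)).
  rewrite inE => Bw; rewrite /X /Phi /H scrambled_net /h ffunE big1// => k _.
  by case: ifP => // nk; rewrite ffunE Bw// eqxx.
rewrite EX; apply: le_trans (Le L (leqnn _)).
by rewrite lef_pV2 ?posrE ?exprn_gt0// lerXn2r ?nnegrE// ler_nat.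
Qed.

Lemma raw_digit_ae : {ae P, forall w, forall p : 'I_(4 ^ m) * 'I_s, forall n,
  exists2 k, (n <= k)%N & raw_digit p.1 p.2 w k != ord_max}.
Proof.
apply: filter_forall => p; apply: ae_foralln => n.
exists [set w | forall k, (n <= k)%N -> raw_digit p.1 p.2 w k = ord_max]; split.
- exact: measurable_raw_digit_max.
- exact: raw_digit_max_null.
move=> w /= H k nk; apply/eqP/negPn/negP => h; apply: H; by exists k.
Qed.

End ScrambledNet.

(** * The variance of the estimator *)

Section Main.
Context {R : realType} {s : nat}.
Variables (f : 'M[R]_(s.+1, 2) -> R) (D : mindex s.+1 -> 'M[R]_(s.+1, 2) -> R).
Hypothesis Dpartials : mixed_partials f D.
Hypothesis Dholder : holder_partials D.
Hypothesis Dpos : forall u : {set 'I_s.+1},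
  0 < norm2_coords u (fun e => integral_T2s (D e)) ^+ 2.

(** A positive norm has a nonzero coordinate; for u the full set its index takes one derivative in
    each variable x_j. *)
Lemma full_mindex : exists a : 'I_s.+1 -> 'I_2,
  integral_T2s (D [ffun j => Some (a j)]) != 0.
Proof.
have := Dpos [set: 'I_s.+1]%SET; rewrite /norm2_coords.
have [/existsP[e /andP[/eqP eT e0] _]|] :=
    boolP [exists e : mindex s.+1,
      (mindex_supp e == [set: 'I_s.+1]%SET) && (integral_T2s (D e) != 0)].
  exists (fun j => odflt 0 (e j)).
  rewrite (_ : [ffun _ => _] = e)//; apply/ffunP => j; rewrite ffunE.
  have : j \in mindex_supp e by rewrite eT inE.
  by rewrite inE; case: (e j).
rewrite negb_exists => /forallP h; rewrite big1 ?sqrtr0 ?expr0n ?ltxx// => e eT.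
by have := h e; rewrite eT /= negbK => /eqP ->; rewrite expr0n.
Qed.

Lemma ucont_partials e : ucont_T2s (D e).
Proof.
move=> eta eta0; have [r r0 H] := partial_at_ucont Dholder eta0.
by exists r => // x y Tx Ty xy; exact: H.
Qed.

Lemma riemann_sum_partials a : integral_T2s (D [ffun j => Some (a j)]) != 0 ->
  exists2 delta : R, 0 < delta & exists K1, forall K, (K1 <= K)%N ->
  2 * delta <= `|avg (at_centers (K := K) (partial_at D [ffun j => Some (a j)]))|.
Proof.
set e := [ffun j => _]; set I := integral_T2s _ => I0.
have I1 : 0 < `|I| by rewrite normr_gt0.
have V0 : 0 <= area_T2 ^+ s.+1 :> R by rewrite exprn_ge0// area_T2_ge0.
have V1 : 0 < area_T2 ^+ s.+1 + 1 :> R by rewrite ltr_wpDl.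
pose c : R := s.+1%:R * area_T2 ^+ s.+1 + 1.
have c0 : 0 < c by rewrite /c ltr_wpDl// mulr_ge0.
pose eta := `|I| / 2 / c.
have eta0 : 0 < eta by rewrite !divr_gt0.
have [r r0 Hr] := ucont_partials e eta0.
have [K1 Kr] := exprV2_small r0.
(* From |I| <= |I| / 2 + V |A| with V the volume of the domain; adding 1 to V keeps the denominator
   positive. *)
exists (`|I| / 4 / (area_T2 ^+ s.+1 + 1)); first by rewrite !divr_gt0.
exists K1 => K /Kr rK.
have closeK : close_T2s (D e) (2 ^- K) eta.
  move=> x y Tx Ty xy; apply: Hr => // j; have [h1 h2] := xy j.
  by split; [exact: le_trans h1 _|exact: le_trans h2 _].
have := riemann_T2s (ucont_partials e) closeK.
rewrite -/I -[riemann_sum K (D e)]/(avg (at_centers (partial_at D e))).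
set A := avg _ => HA.
have ceta : s.+1%:R * area_T2 ^+ s.+1 * eta <= `|I| / 2.
  rewrite /eta [_ * (_ / c)]mulrA ler_pdivrMr// [leLHS]mulrC ler_wpM2l//.
  by rewrite /c lerDl.
have tri : `|I| <= `|I - area_T2 ^+ s.+1 * A| + area_T2 ^+ s.+1 * `|A|.
  have := ler_normD (I - area_T2 ^+ s.+1 * A) (area_T2 ^+ s.+1 * A).
  by rewrite subrK normrM (ger0_norm V0).
rewrite mulrA ler_pdivrMr//.
have A0 : 0 <= `|A| by [].
rewrite mulrDr mulr1 [`|A| * _]mulrC.
lra.
Qed.

(** * The estimator for a fixed net and its truncations *)

Section Fixed.
Variables (m : nat) (a : 'I_(4 ^ m) -> 'I_s.+1 -> R).
Hypothesis net : is_0ms_net a.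
Variables (d : measure_display) (Omega : measurableType d) (P : probability Omega R).
Variable pi : 'I_s.+1 * seq 'I_4 -> Omega -> {perm 'I_4}.
Hypothesis unif : uniform_permutations P pi.

Let Z w := mu_hat f (geometric_net a (pi ^~ w)).

Let e0 : mindex s.+1 := [ffun=> None].

Lemma mu_hatE w : Z w = avg (fun i : 'I_(4 ^ m) =>
  partial_at D [ffun=> None] (fun j => phi (scrambled_value pi a i j w))).
Proof.
rewrite /Z /mu_hat /avg card_ord; congr (_ * _); apply: eq_bigr => i _.
rewrite /partial_at Dpartials.1//.
by apply: point_of_T2s => j; case: (phi_near (scrambled_value pi a i j w)).
Qed.

Lemma card_points_gt0 : (0 < #|'I_(4 ^ m)|)%N. Proof. by rewrite card_ord expn_gt0. Qed.

(** A limit of functions of finitely many digits. Taking the digits of the scrambled real values,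
    not the raw digits, makes the convergence hold at every w. *)
Lemma measurable_mu_hat : measurable_fun setT Z.
Proof.
pose X K (w : Omega) : {ffun 'I_(4 ^ m) * 'I_s.+1 -> {ffun 'I_K -> 'I_4}} :=
  [ffun p => [ffun k : 'I_K => digit (scrambled_value pi a p.1 p.2 w) k]].
pose Phi K (x : {ffun 'I_(4 ^ m) * 'I_s.+1 -> {ffun 'I_K -> 'I_4}}) : R :=
  avg (fun i => partial_at D [ffun=> None] (fun j => center (x (i, j)))).
apply: (measurable_fun_cvg (h := fun K w => Phi K (X K w))) => [K|w _].
  apply: finite_rv_comp; apply: finite_rv_ffun => -[i j]; apply: finite_rv_ffun => k.
  apply: finite_rv_digit; first exact: (measurable_scrambled_value unif).
  by move=> w; rewrite of_digits_ge0 of_digits_le1.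
apply/cvgrPdist_le => e e_gt0; have [r r0 Hr] := partial_at_ucont Dholder e_gt0.
have [K rK] := exprV2_small (divr_gt0 r0 (ltr0Sn R 1)); exists K => // k /= /rK kr.
rewrite mu_hatE /Phi -avgB; apply: (le_trans (ler_norm_avg _)).
rewrite -[leRHS](avg_cst (T := 'I_(4 ^ m)) _ card_points_gt0); apply: ler_avg => i.
apply: Hr.
- by move=> j; case: (phi_near (scrambled_value pi a i j w)).
- by move=> j; exact/T2oW/center_T2o.
move=> j; have [_ /(_ k)[h1 h2]] := phi_near (scrambled_value pi a i j w).
rewrite ffunE; have kr2 : 2 / 2 ^+ k <= r by rewrite mulrC -ler_pdivlMr.
by split; [exact: le_trans h1 _|exact: le_trans h2 _].
Qed.

Let ZK K w := estim (net_digits a K) (@net_node R s.+1 m a K)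
  (at_centers (partial_at D [ffun=> None])) (net_perms pi a K w).

(** The truncation uses the raw digits, whose law is known; they are the digits of the scrambled
    values outside a null set. *)
Lemma mu_hat_near eps : 0 < eps -> exists K0, forall K, (K0 <= K)%N ->
  {ae P, forall w, `|Z w - ZK K w| <= eps}.
Proof.
move=> eps0; have [r r0 Hr] := partial_at_ucont Dholder eps0.
have [K0 rK] := exprV2_small (divr_gt0 r0 (ltr0Sn R 1)); exists K0 => K /rK Kr.
apply: filterS (raw_digit_ae unif a) => w Hw.
rewrite mu_hatE /ZK /estim -avgB; apply: (le_trans (ler_norm_avg _)).
rewrite -[leRHS](avg_cst (T := 'I_(4 ^ m)) _ card_points_gt0); apply: ler_avg => i.
rewrite scrambled_net; apply: Hr.
- by move=> j; case: (phi_near (scrambled_value pi a i j w)).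
- by move=> j; exact/T2oW/center_T2o.
move=> j; have [_ /(_ K)[h1 h2]] := phi_near (scrambled_value pi a i j w).
rewrite ffunE; have kr2 : 2 / 2 ^+ K <= r by rewrite mulrC -ler_pdivlMr.
have -> : [ffun k : 'I_K => raw_digit pi a i j w k] =
    [ffun k : 'I_K => digit (scrambled_value pi a i j w) k].
  by apply/ffunP => k; rewrite !ffunE digit_of_digits//; exact: (Hw (i, j)).
by split; [exact: le_trans h1 _|exact: le_trans h2 _].
Qed.

(** The bounds are the same for all large K, while the variance of the truncated estimator comes
    within any e > 0 of the variance of Z. *)
Lemma variance_mu_hat (lo hi : R) K0 : (forall K, (K0 <= K)%N ->
    lo <= avg (fun sigma => estim (net_digits a K) (@net_node R s.+1 m a K)
        (at_centers (partial_at D [ffun=> None])) sigma ^+ 2) -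
      avg (at_centers (K := K) (partial_at D [ffun=> None])) ^+ 2 <= hi) ->
  (lo%:E <= 'V_P[Z] <= hi%:E)%E.
Proof.
move=> HK; have [M HM] := partial_at_bounded Dholder.
have ZM w : `|Z w| <= M.
  rewrite mu_hatE; apply: (le_trans (ler_norm_avg _)).
  rewrite -[leRHS](avg_cst (T := 'I_(4 ^ m)) _ card_points_gt0); apply: ler_avg => i; apply: HM.
  by move=> j; case: (phi_near (scrambled_value pi a i j w)).
have ZKM K w : `|ZK K w| <= M.
  apply: (le_trans (ler_norm_avg _)).
  rewrite -[leRHS](avg_cst (T := 'I_(4 ^ m)) _ card_points_gt0); apply: ler_avg => i; apply: HM.
  by move=> j; exact/T2oW/center_T2o.
have M0 : 0 <= M := le_trans (normr_ge0 _) (ZM point).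
have mZ := measurable_mu_hat.
have mZK K : measurable_fun setT (ZK K).
  exact: (finite_rv_comp _ (finite_rv_net_perms unif (a := a) (K := K))).
have VZK K : fine 'V_P[ZK K] = avg (fun sigma => estim (net_digits a K) (@net_node R s.+1 m a K)
        (at_centers (partial_at D [ffun=> None])) sigma ^+ 2) -
      avg (at_centers (K := K) (partial_at D [ffun=> None])) ^+ 2.
  rewrite (variance_bounded P (mZK K) (ZKM K))/=; pose Phi sigma :=
    estim (net_digits a K) (@net_node R s.+1 m a K)
      (at_centers (partial_at D [ffun=> None])) sigma.
  congr (_ - _ ^+ 2); first exact: (Rintegral_net_perms unif (fun sigma => Phi sigma ^+ 2)).
  rewrite (Rintegral_net_perms unif Phi) /Phi.
  rewrite /estim avg_avg -[RHS](avg_cst (T := 'I_(4 ^ m)) _ card_points_gt0); apply: eq_avg => i.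
  by apply: avg_scrambled; exact: net_node_inj.
have near e : 0 < e -> exists K, lo <= fine 'V_P[ZK K] <= hi /\
    `|fine 'V_P[Z] - fine 'V_P[ZK K]| <= e.
  move=> e_gt0; have c0 : 0 < 4 * M + 1 by rewrite ltr_wpDl// mulr_ge0.
  have [K1 H1] := mu_hat_near (divr_gt0 e_gt0 c0).
  exists (maxn K0 K1); split; first by rewrite VZK HK// leq_maxl.
  apply: (le_trans (variance_near (ltW (divr_gt0 e_gt0 c0)) mZ (mZK _) ZM (ZKM _)
    (H1 _ (leq_maxr _ _)))).
  by rewrite [_ * (_ / _)]mulrA ler_pdivrMr// mulrC ler_wpM2l ?(ltW e_gt0)// lerDl.
rewrite (variance_bounded P mZ ZM) !lee_fin.
have -> : \int[P]_w (Z w ^+ 2) - (\int[P]_w Z w) ^+ 2 = fine 'V_P[Z].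
  by rewrite (variance_bounded P mZ ZM).
apply/andP; split; apply/ler_addgt0Pr => e /near[K [/andP[h1 h2]]];
  rewrite ler_norml => /andP[h3 h4]; lra.
Qed.

End Fixed.

Lemma scrambled_net_variance : exists c C : R, [/\ 0 < c, 0 < C &
    \forall m \near \oo,
      forall (a : 'I_(4 ^ m) -> 'I_s.+1 -> R), is_0ms_net a ->
      forall (d : measure_display) (Omega : measurableType d)
        (P : probability Omega R)
        (pi : 'I_s.+1 * seq 'I_4 -> Omega -> {perm 'I_4}),
        uniform_permutations P pi ->
        ((c * (m%:R ^+ s / 4 ^+ (2 * m)))%:E <=
           'V_P[fun w => mu_hat f (geometric_net a (pi ^~ w))] <=
         (C * (m%:R ^+ s / 4 ^+ (2 * m)))%:E)%E].
Proof.
have [a0 Ia0] := full_mindex.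
have [delta delta0 [K1 HK1]] := riemann_sum_partials Ia0.
have [M HM] := partial_at_bounded Dholder.
have GM e x : (forall j, T2o (x j)) -> `|partial_at D e x| <= M.
  by move=> Tx; apply: HM => j; exact: T2oW.
have Gcont (eta : R) : 0 < eta -> exists2 r : R, 0 < r &
    forall e j x p q, (forall j, T2o (x j)) -> T2o p -> T2o q ->
    `|p.1 - q.1| <= r -> `|p.2 - q.2| <= r ->
    `|partial_at D e (fupd x j p) - partial_at D e (fupd x j q)| <= eta.
  move=> eta0; have [r r0 Hr] := partial_at_ucont Dholder eta0.
  exists r => // e j x p q Tx Tp Tq pq1 pq2; apply: Hr.
  - by move=> j'; exact/T2oW/fupd_T2o.
  - by move=> j'; exact/T2oW/fupd_T2o.
  move=> j'; rewrite /fupd; case: eqP => // _.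
  by rewrite !subrr normr0 ltW.
have [c [C [c0 C0 [m0 Hm]]]] :=
  finite_variance (partials_partial_at Dpartials) GM Gcont delta0 HK1.
exists c, C; split => //; exists m0 => // m /= /Hm[K0 HK] a net d Omega P pi unif.
apply: (variance_mu_hat unif (K0 := K0)) => K K0K.
apply: (HK K K0K).
- by move=> *; exact: net_node_inj.
- by move=> *; exact: net_node_agree.
- by rewrite card_ord.
move=> k kK km i i' ii'; apply: (net_agree net kK km) => j.
by have := ii' j; rewrite !ffunE.
Qed.

End Main.

Theorem corollary1 (R : realType) (s : nat) (hs : (1 <= s <= 4)%N)
  (f : 'M[R]_(s, 2) -> R) (hf : class_F f) :
  exists c C : R, [/\ 0 < c, 0 < C &
    \forall m \near \oo,
      forall (a : 'I_(4 ^ m) -> 'I_s -> R), is_0ms_net a ->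
      forall (d : measure_display) (Omega : measurableType d)
        (P : probability Omega R)
        (pi : 'I_s * seq 'I_4 -> Omega -> {perm 'I_4}),
        uniform_permutations P pi ->
        ((c * (m%:R ^+ s.-1 / 4 ^+ (2 * m)))%:E <=
           'V_P[fun w => mu_hat f (geometric_net a (pi ^~ w))] <=
         (C * (m%:R ^+ s.-1 / 4 ^+ (2 * m)))%:E)%E].
Proof.
case: s hs f hf => [//|s] _ f [D [Dpartials Dholder Dpos]].
exact: scrambled_net_variance Dpartials Dholder Dpos.
Qed.
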